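(* Let $f:\mathbb{R}\to\mathbb{R}^d$ be the flux of a scalar conservation law (so $N=1$) and let $\sigma$ be a Young measure from $\mathbb{R}^d$ to $\mathbb{R}$. If $\sigma$ is uniformly bounded, then there exists an entropy measure-valued (EMV) solution $\nu$ (a Young measure from $\mathbb{R}^d\times\mathbb{R}_+$ to $\mathbb{R}$) of the measure-valued Cauchy problem $$\partial_t\langle \nu,\mathrm{id}\rangle+\nabla_x\cdot\langle\nu,f\rangle=0,\qquad \nu_{(x,0)}=\sigma_x .$$
   Context: Notation: $\mathbb{R}_+=[0,\infty)$; $\mathrm{id}(\xi)=\xi$; the flux $f$ is continuously differentiable. A Young measure from a Borel set $D\subset\mathbb{R}^k$ to $\mathbb{R}^N$ is a map $z\mapsto \nu_z$ from $D$ to the set of Borel probability measures on $\mathbb{R}^N$ such that $z\mapsto\langle\nu_z,g\rangle:=\int_{\mathbb{R}^N} g(\xi)\,d\nu_z(\xi)$ is Borel measurable for every $g\in C_0(\mathbb{R}^N)$ (continuous functions vanishing at infinity). It is uniformly bounded if there is a compact $K\subset\mathbb{R}^N$ with $\operatorname{supp}\nu_z\subset K$ for all $z\in D$. Scalar entropy pair: a pair $(\eta,q)$ with $\eta:\mathbb{R}\to\mathbb{R}$ convex and $q:\mathbb{R}\to\mathbb{R}^d$ satisfying $q'=\eta' f'$, i.e. $q(u)=\int^u\eta'(\xi)f'(\xi)\,d\xi$ up to an additive constant. A Young measure $\nu$ from $\mathbb{R}^d\times\mathbb{R}_+$ to $\mathbb{R}$ is an EMV solution with initial data $\sigma$ if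 (the pairings below being well defined and locally integrable) (1) for all $\varphi\in C_c^1(\mathbb{R}^d\times\mathbb{R}_+)$, $$\int_{\mathbb{R}_+}\int_{\mathbb{R}^d}\partial_t\varphi\,\langle\nu_{(x,t)},\mathrm{id}\rangle+\nabla_x\varphi\cdot\langle\nu_{(x,t)},f\rangle\,dx\,dt+\int_{\mathbb{R}^d}\varphi(x,0)\langle\sigma_x,\mathrm{id}\rangle\,dx=0;$$ (2) for every entropy pair $(\eta,q)$ and all $0\le\varphi\in C_c^1(\mathbb{R}^d\times\mathbb{R}_+)$, $$\int_{\mathbb{R}_+}\int_{\mathbb{R}^d}\partial_t\varphi\,\langle\nu_{(x,t)},\eta\rangle+\nabla_x\varphi\cdot\langle\nu_{(x,t)},q\rangle\,dx\,dt+\int_{\mathbb{R}^d}\varphi(x,0)\langle\sigma_x,\eta\rangle\,dx\ge0 .$$ *)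

(* Defs.v *)
From HB Require Import structures.
From mathcomp Require Import all_boot all_order all_algebra.
From mathcomp Require Import all_classical all_reals all_analysis.
From mathcomp Require Import measurable_realfun.
Set Implicit Arguments.
Unset Strict Implicit.
Unset Printing Implicit Defensive.
Import Order.TTheory GRing.Theory Num.Theory.
Import numFieldNormedType.Exports.
Local Open Scope classical_set_scope.
Local Open Scope ring_scope.

(* Borel sigma-algebra of the normed space of matrices; used for R^d = 'rV_d. *)
HB.instance Definition _ (R : realType) (m n : nat) :=
  @isMeasurable.Build (sigma_display (@open 'M[R]_(m, n))) 'M[R]_(m, n)
    <<s @open 'M[R]_(m, n) >>
    (@sigma_algebra0 _ _ _) (@sigma_algebraC _ _) (@sigma_algebra_bigcup _ _ _).

Section lebesgue_measure_rV.
Context {R : realType}.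

Lemma measurable_coord_rV d (j : 'I_d) :
  measurable_fun setT (fun v : 'rV[R]_d => v ord0 j : measurableTypeR R).
Proof.
apply: (@measurability _ _ _ (measurableTypeR R) _ _ _ (RGenOpens.measurableE R)).
move=> _ [_ [a [b ->] <-]]; rewrite setTI; apply: sub_sigma_algebra.
have /continuousP := @coord_continuous R 1 d ord0 j; apply; exact: interval_open.
Qed.

Lemma measurable_fun_rV dT (T : measurableType dT) d (g : T -> 'rV[R]_d) :
  (forall j, measurable_fun setT (fun z => g z ord0 j : measurableTypeR R)) ->
  measurable_fun setT g.
Proof.
move=> mg; apply: (@measurability _ _ _ _ _ _ (@open 'rV[R]_d)) => //.
move=> _ [U oU <-]; rewrite setTI.
pose c (q : 'rV[rat]_d) : 'rV[R]_d := map_mx ratr q.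
pose B (p : 'rV[rat]_d * nat) := ball (c p.1) p.2.+1%:R^-1.
rewrite (_ : g @^-1` U =
    \bigcup_p (if `[< B p `<=` U >] then g @^-1` B p else set0)); last first.
  apply/seteqP; split => [z Uz|z [p _]]; last first.
    by case: asboolP => // BU; exact: BU.
  have /nbhs_ballP[e /= e0 eU] : nbhs (g z) U by exact: open_nbhs_nbhs.
  pose k := Num.truncn (2 / e).
  have k0 : (0 : R) < k.+1%:R^-1 by rewrite invr_gt0.
  have ke : k.+1%:R^-1 < e / 2.
    rewrite -[ltRHS]invrK ltf_pV2 ?posrE ?invr_gt0 ?divr_gt0//.
    by rewrite invf_div truncnS_gt.
  have q_ j : exists q : rat, `|g z ord0 j - ratr q| < k.+1%:R^-1.
    have [q] := @rat_in_itvoo R (g z ord0 j - k.+1%:R^-1)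
      (g z ord0 j + k.+1%:R^-1) ltac:(by rewrite ltrBlDr -addrA ltrDl addr_gt0).
    rewrite in_itv/= => /andP[q1 q2]; exists q.
    by rewrite distrC ltr_distl q1 q2.
  have [q qP] := choice q_.
  have cz : ball (c (\row_j q j)) k.+1%:R^-1 (g z).
    by split => // i j; rewrite (ord1 i) !mxE /ball/= distrC.
  exists ((\row_j q j), k) => //; case: asboolP => // -[] y By; apply: eU.
  rewrite (splitr e); apply: (@ball_triangle _ _ (c (\row_j q j))).
    by apply: ball_sym; apply: le_ball cz; exact: ltW.
  by apply: le_ball By; exact: ltW.
apply: countable_bigcupT_measurable => // p.
case: ifP => // _; have -> : g @^-1` B p =
    \bigcap_(j in [set: 'I_d]) ((fun z => g z ord0 j) @^-1` ball (c p.1 ord0 j) p.2.+1%:R^-1).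
  apply/seteqP; split => z /= Bz.
    by move=> j _; case: Bz => _; exact.
  by split => [|i j]; [rewrite invr_gt0|rewrite (ord1 i); exact: Bz].
apply: fin_bigcap_measurable => [|j _]; first exact: finite_finset.
rewrite -[X in measurable X]setTI; apply: mg => //.
by apply: open_measurable; exact: ball_open.
Qed.

Definition cons_rV d (p : measurableTypeR R * 'rV[R]_d) : 'rV[R]_d.+1 :=
  row_mx (p.1 : R)%:M p.2.

Lemma measurable_cons_rV d : measurable_fun setT (@cons_rV d).
Proof.
apply: measurable_fun_rV => j; rewrite /cons_rV.
have [i ji|k jk] := @splitP 1 d j.
  rewrite (_ : (fun _ => _) = fst)//; apply/funext => p /=.
  rewrite [j](_ : _ = lshift d i); last exact/val_inj.
  by rewrite (@row_mxEl _ 1 1 d) (ord1 i) mxE eqxx.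
rewrite (_ : (fun _ => _) = (fun v : 'rV[R]_d => v ord0 k : measurableTypeR R) \o snd).
  exact: measurableT_comp (measurable_coord_rV k) measurable_snd.
apply/funext => p /=; rewrite [j](_ : _ = rshift 1 k); last exact/val_inj.
by rewrite (@row_mxEr _ 1 1 d).
Qed.

Definition uncons_rV d (v : 'rV[R]_d.+1) : measurableTypeR R * 'rV[R]_d :=
  (v ord0 ord0, \row_j v ord0 (lift ord0 j)).

Lemma cons_rVK d : cancel (@cons_rV d) (@uncons_rV d).
Proof.
move=> [x v]; rewrite /uncons_rV /cons_rV /=; congr pair.
  have -> : (ord0 : 'I_d.+1) = lshift d (ord0 : 'I_1) by exact/val_inj.
  by rewrite (@row_mxEl _ 1 1 d) mxE eqxx.
apply/rowP => j; rewrite mxE.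
have -> : lift ord0 j = rshift 1 j by exact/val_inj.
by rewrite (@row_mxEr _ 1 1 d).
Qed.

Lemma measurable_uncons_rV d : measurable_fun setT (@uncons_rV d).
Proof.
apply/measurable_fun_pairP; split; first exact: measurable_coord_rV.
apply: measurable_fun_rV => j /=; under eq_fun do rewrite mxE.
exact: measurable_coord_rV.
Qed.

Section step.
Variables (d : nat) (m : {sigma_finite_measure set 'rV[R]_d -> \bar R}).

Local Notation mu1 := (@lebesgue_measure R \x m)%E.
Definition lebesgue_cons_rV : set 'rV[R]_d.+1 -> \bar R :=
  pushforward mu1 (@cons_rV d).

Let lebesgue_cons_rV0 : lebesgue_cons_rV set0 = 0%E.
Proof. by rewrite /lebesgue_cons_rV /pushforward preimage_set0 measure0. Qed.

Let lebesgue_cons_rV_ge0 A : (0 <= lebesgue_cons_rV A)%E.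
Proof. by rewrite /lebesgue_cons_rV /pushforward; exact: measure_ge0. Qed.

Let lebesgue_cons_rV_sigma_additive : semi_sigma_additive lebesgue_cons_rV.
Proof.
move=> F mF tF mUF; rewrite /lebesgue_cons_rV /pushforward preimage_bigcup.
have mc A : measurable A -> measurable (@cons_rV d @^-1` A).
  by move=> mA; rewrite -[X in measurable X]setTI; exact: measurable_cons_rV.
apply: measure_semi_sigma_additive.
- by move=> n; exact: mc.
- by move=> i j _ _ [p [Fi Fj]]; apply: tF => //; exists (cons_rV p).
- by rewrite -preimage_bigcup; exact: mc.
Qed.

HB.instance Definition _ := isMeasure.Build _ _ _ lebesgue_cons_rV
  lebesgue_cons_rV0 lebesgue_cons_rV_ge0 lebesgue_cons_rV_sigma_additive.

Let sigma_finite_lebesgue_cons_rV : sigma_finite setT lebesgue_cons_rV.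
Proof.
have /sigma_finiteP[F [TF ndF Foo]] := sigma_finiteT (@lebesgue_measure R).
have /sigma_finiteP[G [TG ndG Goo]] := sigma_finiteT m.
exists (fun n => @uncons_rV d @^-1` (F n `*` G n)).
  rewrite -preimage_bigcup -[LHS](preimage_setT (@uncons_rV d)); congr (_ @^-1` _).
  rewrite -setXTT TF TG predeqE => -[x y]; split.
    move=> [/= [n _ Fnx] [k _ Gky]]; exists (maxn n k) => //; split.
    - by move: x Fnx; exact/subsetPset/ndF/leq_maxl.
    - by move: y Gky; exact/subsetPset/ndG/leq_maxr.
  by move=> [n _ []/= ? ?]; split; exists n.
move=> k; have [mF Fk] := Foo k; have [mG Gk] := Goo k; split.
  rewrite -[X in measurable X]setTI; apply: measurable_uncons_rV => //.
  exact: measurableX.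
rewrite /lebesgue_cons_rV /pushforward -comp_preimage.
rewrite (_ : _ \o _ = id); last by apply/funext => p; exact: cons_rVK.
by rewrite preimage_id product_measure1E// lte_mul_pinfty// ge0_fin_numE.
Qed.

HB.instance Definition _ :=
  Measure_isSigmaFinite.Build _ _ _ lebesgue_cons_rV sigma_finite_lebesgue_cons_rV.
End step.

(* Lebesgue measure on R^d: the d-fold product of Lebesgue measure on R,
   transported to row vectors along R * R^d = R^(d+1). *)
Fixpoint lebesgue_rV d : {sigma_finite_measure set 'rV[R]_d -> \bar R} :=
  if d is d'.+1 then lebesgue_cons_rV (lebesgue_rV d') else \d_(0 : 'rV[R]_0).

End lebesgue_measure_rV.

Section young_measure.
Context {R : realType}.
Local Notation prob := (probability (measurableTypeR R) R).

(* C_0(R) *)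
Definition continuous_vanishing (g : R -> R) : Prop :=
  [/\ continuous g, g x @[x --> +oo] --> 0 & g x @[x --> -oo] --> 0].

(* <mu, g>; this is a junk value when g is not mu-integrable, which
   wd_pairing and wd_pairing0 below rule out wherever unbounded g are used. *)
Definition pairing (mu : prob) (g : R -> R) : R := \int[mu]_xi g xi.

Definition pairing_rV d (mu : prob) (g : R -> 'rV[R]_d) : 'rV[R]_d :=
  \row_i pairing mu (fun xi => g xi ord0 i).

Definition msupport (mu : prob) : set R :=
  [set x | forall U : set R, open U -> U x -> (0 < mu U)%E].

(* nu is a total function, but its values outside D are unconstrained. *)
Definition young_measure dT (T : measurableType dT) (D : set T)
    (nu : T -> prob) : Prop :=
  measurable D /\
  forall g, continuous_vanishing g -> measurable_fun D (fun z => pairing (nu z) g).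

Definition uniformly_bounded T (D : set T) (nu : T -> prob) : Prop :=
  exists2 K : set R, compact K & forall z, D z -> msupport (nu z) `<=` K.

End young_measure.

Section emv.
Context {R : realType} {d : nat}.
Local Notation prob := (probability (measurableTypeR R) R).
Local Notation leb := (@lebesgue_measure R).

Definition C1_flux (f : R -> 'rV[R]_d) : Prop :=
  (forall xi, derivable f xi 1) /\ continuous (derive1 f).

(* R^d x [0, +oo[ *)
Definition half_space : set ('rV[R]_d * R) := setT `*` `[0, +oo[.

(* For a merely convex eta, the pointwise derivative exists off a countable set
   and q is defined by integrating eta' f'; the junk value of derive1 eta on the
   exceptional set does not contribute to the integral. *)
Definition entropy_pair (f : R -> 'rV[R]_d) (eta : R -> R) (q : R -> 'rV[R]_d) :=
  convex_function (E := R^o) setT eta /\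
  forall (a b : R) i, a <= b ->
    q b ord0 i - q a ord0 i = \int[leb]_(xi in `[a, b]) (derive1 eta xi * derive1 f xi ord0 i).

(* phi in C^1_c(R^d x [0,+oo[), together with its partial derivatives
   phi_t and phi_x; the time derivative is one-sided at t = 0, and phi need not
   vanish there. Values outside the half space are irrelevant. *)
Definition C1c_half_space (phi phi_t : 'rV[R]_d * R -> R)
    (phi_x : 'rV[R]_d * R -> 'rV[R]_d) : Prop :=
  [/\ {within half_space, continuous phi},
      {within half_space, continuous phi_t} /\
        {within half_space, continuous phi_x},
      forall x t, 0 <= t ->
        (s - t)^-1 * (phi (x, s) - phi (x, t))
          @[s --> within [set s | 0 <= s] t^'] --> phi_t (x, t),
      forall x t i, 0 <= t ->
        is_derive x (delta_mx ord0 i) (fun y => phi (y, t)) (phi_x (x, t) ord0 i)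
    & compact (closure (half_space `&` [set z | phi z != 0]))].

(* z |-> <nu_z, g> is well defined and locally integrable on R^d x [0, +oo[;
   wd_pairing0 is the analogue for the initial data on R^d. *)
Definition wd_pairing (nu : 'rV[R]_d * R -> prob) (g : R -> R) : Prop :=
  (forall z, half_space z -> (nu z).-integrable setT (EFin \o g)) /\
  forall K : set ('rV[R]_d * R), compact K -> K `<=` half_space ->
    (lebesgue_rV d \x leb)%E.-integrable K (fun z => (pairing (nu z) g)%:E).

Definition wd_pairing0 (sigma : 'rV[R]_d -> prob) (g : R -> R) : Prop :=
  (forall x, (sigma x).-integrable setT (EFin \o g)) /\
  forall K : set 'rV[R]_d, compact K ->
    (lebesgue_rV d).-integrable K (fun x => (pairing (sigma x) g)%:E).

Definition weak_form (nu : 'rV[R]_d * R -> prob) (sigma : 'rV[R]_d -> prob)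
    (g : R -> R) (G : R -> 'rV[R]_d) (phi phi_t : 'rV[R]_d * R -> R)
    (phi_x : 'rV[R]_d * R -> 'rV[R]_d) : R :=
  \int[leb]_(t in `[0, +oo[) \int[lebesgue_rV d]_x
    (phi_t (x, t) * pairing (nu (x, t)) g +
     \sum_i phi_x (x, t) ord0 i * pairing_rV (nu (x, t)) G ord0 i) +
  \int[lebesgue_rV d]_x (phi (x, 0) * pairing (sigma x) g).

Definition wd_weak_form (nu : 'rV[R]_d * R -> prob) (sigma : 'rV[R]_d -> prob)
    (g : R -> R) (G : R -> 'rV[R]_d) : Prop :=
  [/\ wd_pairing nu g, forall i, wd_pairing nu (fun xi => G xi ord0 i)
    & wd_pairing0 sigma g].

Definition EMV_solution (f : R -> 'rV[R]_d) (sigma : 'rV[R]_d -> prob)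
    (nu : 'rV[R]_d * R -> prob) : Prop :=
  [/\ young_measure half_space nu,
      wd_weak_form nu sigma id f /\
      (forall phi phi_t phi_x, C1c_half_space phi phi_t phi_x ->
         weak_form nu sigma id f phi phi_t phi_x = 0)
    & forall eta q, entropy_pair f eta q ->
        wd_weak_form nu sigma eta q /\
        (forall phi phi_t phi_x, C1c_half_space phi phi_t phi_x ->
           (forall z, half_space z -> 0 <= phi z) ->
           0 <= weak_form nu sigma eta q phi phi_t phi_x)].

End emv.

(* Main.v *)
Require Import Defs.
From HB Require Import structures.
From mathcomp Require Import finmap.
From mathcomp Require Import all_boot all_order all_algebra.
From mathcomp Require Import all_classical all_reals all_analysis.
From mathcomp Require Import measurable_realfun.
From mathcomp Require Import ring lra.


(** The solution is a limit of random approximate solutions.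

    Probability measures carried by [- M, M] are laws of random variables on
    [0, 1]: sigma_x is the law of its quantile function w |-> u0 (x, w)
    (pairing_quantile). For each w, the function u0 (., w) is ordinary initial
    data for the scalar conservation law, and the (2d+1)-point Lax-Friedrichs
    scheme with steps h and tau = 2 a h / (2d+1) evolves it. The scheme acts
    on functions defined on the whole of R^d, without a spatial grid, so that
    translation invariance of Lebesgue measure replaces the combinatorics of
    cells. If a |f_i'| <= 1 on [- M, M], the functions v |-> v -+ a f_i(v)
    are nondecreasing there. This gives the bound by M (lax_friedrichs_bound)
    and, for every entropy pair, a discrete entropy inequality
    (lax_friedrichs_entropy): the value produced by the scheme is compared
    with the stencil values by means of the subgradient inequality for eta and
    its counterpart for eta -+ a q_i (entropy_dissipation). Taking the
    expectation in w turns it into an inequality between the functions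
    mean eta and mean q_i of space-time, in other words between pairings with
    the laws of the approximate solution (mean_entropy). For the identity and
    f there is equality (mean_conservation).

    Tested against phi and integrated over space-time, all shifts can be moved
    onto phi (summation_by_parts). The resulting difference quotients of phi
    converge in L^1 to phi_t and to the components of phi_x, and the first
    time layer, where the approximate solution is u0, produces the integral of
    phi (x, 0) against sigma (backward_difference, integral_initial_term).

    It remains to pass to the limit in the laws, which only converge weakly.
    By the layer-cake formula the expectation of g (u) is governed by the tails
    P (r < u), r rational. Along an ultrafilter the tails converge weak-* in
    L^oo (weak_cluster, a consequence of the Radon-Nikodym theorem), and the
    limits are again nonincreasing in r (weak_cluster_monotone). Up to jumps
    they are the tails of a measure nu_z, namely of the law of the
    corresponding quantile function (young_limit). Multiplying strong convergence of the
    quotients by weak convergence of the pairings identifies the limit of the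
    tested scheme with the weak form (residual_limit), which is therefore
    zero for the identity and nonnegative for entropies. *)

Set Implicit Arguments.
Unset Strict Implicit.
Unset Printing Implicit Defensive.
Import Order.TTheory GRing.Theory Num.Theory.
Import numFieldNormedType.Exports.
Local Open Scope classical_set_scope.
Local Open Scope ring_scope.

(** * Ultrafilter limits and dominated set functions *)

Section ultralimit.
Context {R : realType} (U : set_system nat) {UU : UltraFilter U}.

(** Bounded sequences converge along an ultrafilter, because [- C, C] is compact.
    Taking all weak limits along one ultrafilter avoids extracting subsequences. *)
Lemma ultra_cvg (a : nat -> R) C : (forall n, `|a n| <= C) -> cvg (a @ U).
Proof.
move=> aC.
have FF : ProperFilter (a @ U) by exact: fmap_proper_filter.
have := @segment_compact R (- C) C; rewrite compact_ultra => /(_ (a @ U)).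
case=> [| |l [_ /= al]].
- split=> // G PG aUG; apply/seteqP; split => // A GA.
  have [|nA] := in_ultra_setVsetC (a @^-1` A) UU; first by [].
  have /aUG GnA : (a @ U) (~` A) by exact: nA.
  by case: (@filter_not_empty _ G PG); rewrite -(setICr A); exact: filterI.
- by rewrite /fmap /=; apply: filterE => n; rewrite /= in_itv/= -ler_norml.
- by apply/cvg_ex; exists l.
Qed.

End ultralimit.

Section dominated_additive.
Context d (T : measurableType d) (R : realType) (m : {finite_measure set T -> \bar R}).
Variable L : set T -> R.
Hypothesis L0 : forall A, measurable A -> 0 <= L A.
Hypothesis Lm : forall A, measurable A -> ((L A)%:E <= m A)%E.
Hypothesis LU : forall A B, measurable A -> measurable B -> [disjoint A & B] ->
  L (A `|` B) = L A + L B.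

Lemma dominated_additive0 : L set0 = 0.
Proof.
by apply/eqP; rewrite eq_le L0// andbT -lee_fin (le_trans (Lm _))// measure0.
Qed.

(** Finite additivity survives weak limits, countable additivity does not; it is
    recovered from the domination by m, since the tails of a disjoint union have
    vanishing m-measure. *)
Lemma dominated_sigma_additive : semi_sigma_additive (EFin \o L).
Proof.
move=> F mF tF mUF.
have Ln n : L (\big[setU/set0]_(i < n) F i) = \sum_(0 <= i < n) L (F i).
  elim: n => [|n IH]; first by rewrite big_ord0 big_nil dominated_additive0.
  rewrite big_ord_recr big_nat_recr//= LU//; first by rewrite IH.
    exact: bigsetU_measurable.
  apply/disj_setPS; rewrite -bigcup_mkord setI_bigcupl => x [i /= ni [Fi Fn]].
  by have := tF i n I I (ex_intro _ x (conj Fi Fn)) => e; move: ni; rewrite e ltnn.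
pose r n := (\bigcup_i F i) `\` \big[setU/set0]_(i < n) F i.
have mr n : measurable (r n) by apply: measurableD => //; exact: bigsetU_measurable.
have LE n : \sum_(0 <= i < n) L (F i) = L (\bigcup_i F i) - L (r n).
  have -> : \bigcup_i F i = \big[setU/set0]_(i < n) F i `|` r n.
    rewrite /r setDUK// -bigcup_mkord; apply: bigcup_sub => i _.
    exact: bigcup_sup.
  rewrite LU//; [by rewrite Ln addrK|exact: bigsetU_measurable|].
  by apply/disj_setPS => x [? []].
have rcvg : (m \o r) n @[n --> \oo] --> 0%E.
  rewrite (_ : 0%E = m (\bigcap_n r n)).
    apply: nonincreasing_cvg_mu => //.
    - by rewrite ltey_eq fin_num_measure.
    - exact: bigcap_measurable.
    - move=> i j ij; apply/subsetPset; apply: setDS.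
      exact: subset_bigsetU.
  rewrite (_ : \bigcap_n r n = set0) ?measure0//; apply/seteqP; split => // x rx.
  have [[i _ Fi] _] := rx 0%N I.
  have [_ []] := rx i.+1 I.
  by rewrite -bigcup_mkord; exists i => //=.
have Lr : L (r n) @[n --> \oo] --> 0.
  apply/(@squeeze_cvgr _ _ _ _ (cst 0) (fine \o (m \o r))).
  - apply: nearW => n; rewrite L0//= -lee_fin fineK//=; first exact: Lm.
    exact: fin_num_measure.
  - exact: cvg_cst.
  - exact: (fine_cvg rcvg).
have LUr : (L (\bigcup_i F i) - L (r n)) @[n --> \oo] --> L (\bigcup_i F i).
  by rewrite -[X in _ --> X]subr0; apply: cvgB => //; exact: cvg_cst.
rewrite (_ : (fun n => _) = (fun n => (L (\bigcup_i F i) - L (r n))%:E)); last first.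
  by apply/funext => n; rewrite sumEFin LE.
exact: cvg_EFin (nearW _ _) LUr.
Qed.

End dominated_additive.

(** * Integrals of real-valued functions *)

Section real_integrals.
Context d (T : measurableType d) (R : realType) (mu : {measure set T -> \bar R}).
Implicit Types (D : set T) (f g : T -> R).

Lemma integrable_mul_bounded D f g C : measurable D ->
  mu.-integrable D (EFin \o f) -> measurable_fun D g ->
  (forall x, D x -> `|g x| <= C) -> mu.-integrable D (fun x => (f x * g x)%:E).
Proof.
move=> mD fi mg gC.
apply: (@le_integrable _ _ _ _ _ mD _ (fun x => (C%:E * (f x)%:E)%E)).
- apply/measurable_EFinP/measurable_funM => //.
  exact/measurable_EFinP/(measurable_int mu).
- move=> x Dx; rewrite -EFinM !abse_EFin lee_fin !normrM mulrC.
  by apply: ler_wpM2r => //; rewrite (le_trans (gC _ Dx))// ler_norm.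
- exact: integrableZl.
Qed.

Lemma integrable_bounded D f C : measurable D -> (mu D < +oo)%E ->
  measurable_fun D f -> (forall x, D x -> `|f x| <= C) ->
  mu.-integrable D (EFin \o f).
Proof.
move=> mD Doo mf fC; apply: measurable_bounded_integrable => //.
exists C; split; first exact: num_real.
by move=> M CM x Dx; apply: le_trans (ltW CM); exact: fC.
Qed.

Lemma integrable_addr D f g : measurable D -> mu.-integrable D (EFin \o f) ->
  mu.-integrable D (EFin \o g) -> mu.-integrable D (fun x => (f x + g x)%:E).
Proof. by move=> mD fi gi; under eq_fun do rewrite EFinD; exact: integrableD. Qed.

Lemma integrable_subr D f g : measurable D -> mu.-integrable D (EFin \o f) ->
  mu.-integrable D (EFin \o g) -> mu.-integrable D (fun x => (f x - g x)%:E).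
Proof. by move=> mD fi gi; under eq_fun do rewrite EFinB; exact: integrableB. Qed.

Lemma integrable_scaler D c f : measurable D -> mu.-integrable D (EFin \o f) ->
  mu.-integrable D (fun x => (c * f x)%:E).
Proof. by move=> mD fi; under eq_fun do rewrite EFinM; exact: integrableZl. Qed.

Lemma Rintegral_mul_bounded D f g C : measurable D ->
  mu.-integrable D (EFin \o f) -> measurable_fun D g ->
  (forall x, D x -> `|g x| <= C) ->
  `|\int[mu]_(x in D) (f x * g x)| <= C * \int[mu]_(x in D) `|f x|.
Proof.
move=> mD fi mg gC; have fgi := integrable_mul_bounded mD fi mg gC.
apply: (le_trans (le_normr_Rintegral mD fgi)).
rewrite -RintegralZl//; last exact: integrable_norm.
apply: le_Rintegral => //; first exact: (integrable_norm fgi).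
  by apply: integrable_scaler => //; exact: integrable_norm.
by move=> x Dx; rewrite normrM mulrC ler_wpM2r// gC.
Qed.

Lemma integrable_sumr D (I : Type) (s : seq I) (f : I -> T -> R) : measurable D ->
  (forall i, mu.-integrable D (EFin \o f i)) ->
  mu.-integrable D (fun x => (\sum_(i <- s) f i x)%:E).
Proof.
move=> mD fi; elim: s => [|i s IH].
  by under eq_fun do rewrite big_nil; exact: integrable0.
by under eq_fun do rewrite big_cons; exact: integrable_addr.
Qed.

Lemma Rintegral_sumr D (I : Type) (s : seq I) (f : I -> T -> R) : measurable D ->
  (forall i, mu.-integrable D (EFin \o f i)) ->
  \int[mu]_(x in D) (\sum_(i <- s) f i x) = \sum_(i <- s) \int[mu]_(x in D) f i x.
Proof.
move=> mD fi; elim: s => [|i s IH].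
  by under eq_Rintegral do rewrite big_nil; rewrite big_nil /Rintegral integral0.
under eq_Rintegral do rewrite big_cons; rewrite big_cons RintegralD//; first by rewrite IH.
exact: integrable_sumr.
Qed.

Lemma EFin_Rintegral D f : measurable D -> mu.-integrable D (EFin \o f) ->
  (\int[mu]_(x in D) f x)%:E = (\int[mu]_(x in D) (f x)%:E)%E.
Proof. by move=> mD fi; rewrite /Rintegral fineK//; exact: integrable_fin_num. Qed.

(** Apply the hypothesis to the set where g < f: there f - g is positive, but its
    integral is not. *)
Lemma ae_le_Rintegral D f g : measurable D ->
  mu.-integrable D (EFin \o f) -> mu.-integrable D (EFin \o g) ->
  (forall A, measurable A -> A `<=` D ->
     \int[mu]_(x in A) f x <= \int[mu]_(x in A) g x) ->
  mu.-negligible [set x | D x /\ g x < f x].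
Proof.
move=> mD fi gi fg; set A := [set x | _].
have mf : measurable_fun D f by exact/measurable_EFinP/(measurable_int mu).
have mg : measurable_fun D g by exact/measurable_EFinP/(measurable_int mu).
have mA : measurable A by exact: (measurable_fun_ltr mg mf mD (Y := [set true])).
have AD : A `<=` D by move=> x [].
have fAi : mu.-integrable A (EFin \o f) by exact: (integrableS mD).
have gAi : mu.-integrable A (EFin \o g) by exact: (integrableS mD).
have : ae_eq mu A (EFin \o (fun x => f x - g x)) (cst 0%E).
  apply/ae_eq_integral_abs => //.
    by apply/measurable_EFinP/measurable_funB; exact: measurable_funS AD _.
  rewrite (eq_integral (fun x => (f x - g x)%:E)); last first.
    by move=> x /[!inE] -[_ ?]; rewrite /= ger0_norm// subr_ge0 ltW.
  rewrite -EFin_Rintegral//; last exact: integrable_subr.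
  congr EFin; apply/eqP; rewrite eq_le RintegralB//; rewrite subr_le0 fg//=.
  rewrite -RintegralB//; apply: Rintegral_ge0 => x [_ ?].
  by rewrite subr_ge0 ltW.
apply: negligibleS => x [Dx gf] /= /(_ (conj Dx gf)) [] /eqP.
by rewrite subr_eq0 => /eqP e; move: gf; rewrite e ltxx.
Qed.

Import HBSimple.

(** Reduces convergence of integrals against simple functions to convergence of
    integrals over measurable sets. *)
Lemma Rintegral_sfun_mul E (s : {sfun T >-> R}) f : measurable E ->
  mu.-integrable E (EFin \o f) ->
  \int[mu]_(x in E) (s x * f x) =
  \sum_(y <- fset_set (range s)) y * \int[mu]_(x in s @^-1` [set y] `&` E) f x.
Proof.
move=> mE fi.
have ms y : measurable (s @^-1` [set y]) by [].
have i1 y : mu.-integrable E (EFin \o (f \_ (s @^-1` [set y]))).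
  rewrite -restrict_EFin; apply/integrable_restrict => //.
  by apply: integrableS fi => //; exact: measurableI.
rewrite (@eq_Rintegral _ _ _ _ _ (fun x => \sum_(y <- fset_set (range s))
    y * (f \_ (s @^-1` [set y])) x)).
  rewrite Rintegral_sumr//; last by move=> y; exact: integrable_scaler.
  by apply: eq_bigr => y _; rewrite RintegralZl// Rintegral_mkcondl.
move=> x _; rewrite {1}fimfunE fsbig_finite//= mulr_suml.
apply: eq_bigr => y _; rewrite -mulrA patchE indicE.
by case: ifPn => _; rewrite ?mul1r ?mul0r.
Qed.

End real_integrals.

Lemma Rintegral_prob_bounded d (T : measurableType d) (R : realType)
    (P : probability T R) (f : T -> R) (C : R) :
  P.-integrable setT (EFin \o f) -> (forall t, `|f t| <= C) -> `|\int[P]_t f t| <= C.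
Proof.
move=> fi fC; apply: (le_trans (le_normr_Rintegral _ fi)) => //.
have -> : C = \int[P]_t C.
  by rewrite Rintegral_cst// (_ : fine (P setT) = 1) ?mulr1// probability_setT.
apply: le_Rintegral => //; first exact: (integrable_norm fi).
exact: finite_measure_integrable_cst.
Qed.

Lemma Rintegral_itv_cst (R : realType) (a b c : R) : a <= b ->
  \int[@lebesgue_measure R]_(x in `[a, b]) c = c * (b - a).
Proof.
move=> ab; rewrite Rintegral_cst//; congr (_ * _).
suff : fine (@lebesgue_measure R `[a, b]%classic) = b - a by [].
rewrite lebesgue_measure_itv/= lte_fin.
by move: ab; rewrite le_eqVlt => /predU1P[->|->//]; rewrite ltxx subrr.
Qed.

Lemma measurable_superlevel d (T : measurableType d) (R : realType) (X : T -> R) (r : R) :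
  measurable_fun setT X -> measurable [set t | r < X t].
Proof.
move=> mX; rewrite -[X in measurable X]setTI.
exact: (measurable_fun_ltr (measurable_cst r) mX measurableT (Y := [set true])).
Qed.

(** The three-epsilon argument, along an arbitrary filter. *)
Lemma cvg_uniform_approx (R : realType) (I : Type) (F : set_system I)
    {FF : Filter F} (a : I -> R) (l : R) :
  (forall e, 0 < e -> exists b l', [/\ forall n, `|a n - b n| <= e,
     `|l - l'| <= e & b @ F --> l']) -> a @ F --> l.
Proof.
move=> H; apply/cvgrPdist_le => e e0.
have e3 : 0 < e / 3 by rewrite divr_gt0.
have [b [l' [ab ll' /cvgrPdist_le/(_ _ e3) bl']]] := H _ e3.
apply: filterS bl' => n bn.
rewrite (_ : l - a n = (l - l') + (l' - b n) - (a n - b n)); last by ring.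
rewrite (_ : e = e / 3 + e / 3 + e / 3); last by field.
apply: (le_trans (ler_normB _ _)); apply: lerD (ab n).
exact: (le_trans (ler_normD _ _) (lerD ll' bn)).
Qed.

Lemma cvg_sumr (R : realType) (I J : Type) (F : set_system I) {FF : Filter F}
    (s : seq J) (a : J -> I -> R) (l : J -> R) :
  (forall j, a j @ F --> l j) ->
  (\sum_(j <- s) a j i) @[i --> F] --> \sum_(j <- s) l j.
Proof.
move=> al; elim: s => [|j s IH].
  by rewrite big_nil; under eq_cvg do rewrite big_nil; exact: cvg_cst.
by rewrite big_cons; under eq_cvg do rewrite big_cons; exact: cvgD.
Qed.

Lemma Rintegral_dominated d (T : measurableType d) (R : realType)
    (mu : {measure set T -> \bar R}) (D : set T) (f_ : nat -> T -> R) (f G : T -> R) :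
  measurable D -> (forall n, measurable_fun D (f_ n)) -> measurable_fun D f ->
  (forall x, D x -> f_ ^~ x @ \oo --> f x) ->
  mu.-integrable D (EFin \o G) -> (forall n x, D x -> `|f_ n x| <= G x) ->
  [/\ mu.-integrable D (EFin \o f),
      \int[mu]_(x in D) `|f_ n x - f x| @[n --> \oo] --> 0 &
      \int[mu]_(x in D) f_ n x @[n --> \oo] --> \int[mu]_(x in D) f x].
Proof.
move=> mD mf_ mf ff Gi fG.
have [] := @dominated_convergence _ _ _ mu D mD (fun n => EFin \o f_ n) (EFin \o f) (EFin \o G).
- by move=> n; exact/measurable_EFinP.
- exact/measurable_EFinP.
- by apply: aeW => x Dx; apply/cvg_EFin; [exact: nearW|exact: ff].
- exact: Gi.
- by apply: aeW => x n Dx; rewrite /= lee_fin fG.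
move=> fi c1 c2; split => //.
- by have /fine_cvgP[_] := c1; apply: cvg_trans; exact: near_eq_cvg (nearW _ _).
- have fifin : (\int[mu]_(x in D) (f x)%:E)%E \is a fin_num by exact: integrable_fin_num.
  by move: c2; rewrite -(fineK fifin) => /fine_cvgP[_].
Qed.

Section Rintegral_prod.
Context d1 d2 (T1 : measurableType d1) (T2 : measurableType d2) (R : realType).
Variable m1 : {sigma_finite_measure set T1 -> \bar R}.
Variable m2 : {sigma_finite_measure set T2 -> \bar R}.
Variable f : T1 * T2 -> R.
Hypothesis fi : (m1 \x m2)%E.-integrable setT (EFin \o f).

Lemma Rintegral_prod12 : \int[(m1 \x m2)%E]_z f z = \int[m1]_x \int[m2]_y f (x, y).
Proof.
have [mF _] := integrableP _ _ _ (integrable_fubini_F fi).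
rewrite /Rintegral -integral12_prod_meas1//; congr fine.
apply: ae_eq_integral => //.
  by apply/measurable_EFinP; apply: measurableT_comp mF.
have := ae_integrable1 fi; apply: filterS => x ix _.
by rewrite fineK//; exact: integrable_fin_num.
Qed.

Lemma Rintegral_prod21 : \int[(m1 \x m2)%E]_z f z = \int[m2]_y \int[m1]_x f (x, y).
Proof.
have mG := measurable_fubini_G fi.
rewrite /Rintegral -integral21_prod_meas1//; congr fine.
apply: ae_eq_integral => //.
  by apply/measurable_EFinP; apply: measurableT_comp mG.
have := ae_integrable2 fi; apply: filterS => x ix _.
by rewrite fineK//; exact: integrable_fin_num.
Qed.

End Rintegral_prod.

(** Strong convergence in L^1 times bounded weak-* convergence. Two filters occur: the
    factors psi_ converge as n tends to infinity, the factors E only along a finer filter. *)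
Lemma cvg_Rintegral_mul d (T : measurableType d) (R : realType)
    (mu : {measure set T -> \bar R}) (U : set_system nat) {FU : Filter U}
    (psi_ E : nat -> T -> R) (psi : T -> R) (C l : R) :
  \oo `<=` U ->
  (forall n, mu.-integrable setT (EFin \o psi_ n)) -> mu.-integrable setT (EFin \o psi) ->
  \int[mu]_z `|psi_ n z - psi z| @[n --> \oo] --> 0 ->
  (forall n, measurable_fun setT (E n)) -> (forall n z, `|E n z| <= C) ->
  \int[mu]_z (psi z * E n z) @[n --> U] --> l ->
  \int[mu]_z (psi_ n z * E n z) @[n --> U] --> l.
Proof.
move=> ooU ii i psiL mE EC El.
have psi0 : \int[mu]_z `|psi_ n z - psi z| @[n --> U] --> 0.
  by move=> A /psiL; exact: ooU.
rewrite -[l]add0r; under eq_cvg => n.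
  rewrite (_ : \int[mu]_z _ =
    (\int[mu]_z (psi_ n z * E n z) - \int[mu]_z (psi z * E n z)) + \int[mu]_z (psi z * E n z)); last by rewrite subrK.
  over.
apply: cvgD El; apply/norm_cvg0P.
apply: (@squeeze_cvgr _ _ _ _ (cst 0) (fun n => C * \int[mu]_z `|psi_ n z - psi z|)).
- apply: nearW => n; rewrite normr_ge0/=.
  have E1 : \int[mu]_z (psi_ n z * E n z) - \int[mu]_z (psi z * E n z) =
      \int[mu]_z ((psi_ n z - psi z) * E n z).
    rewrite -RintegralB//.
    - by apply: eq_Rintegral => z _; rewrite mulrBl.
    - by apply: (@integrable_mul_bounded _ _ _ _ _ _ _ C).
    - by apply: (@integrable_mul_bounded _ _ _ _ _ _ _ C).
  by rewrite E1; apply: Rintegral_mul_bounded => //; exact: integrable_subr.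
- exact: cvg_cst.
- by rewrite -(mulr0 C); apply: cvgMr.
Qed.

(** * Weak cluster points of functions with values in [0, 1] *)

Section weak_cluster_finite.
Context d (T : measurableType d) (R : realType).
Variables (mu : {sigma_finite_measure set T -> \bar R}).
Variables (U : set_system nat) (UU : UltraFilter U).
Variables (h : nat -> T -> R).
Hypothesis mh : forall n, measurable_fun setT (h n).
Hypothesis h01 : forall n x, 0 <= h n x <= 1.
Variables (E : set T) (mE : measurable E) (Efin : (mu E < +oo)%E).

Let I n A := \int[mu]_(x in A `&` E) h n x.
Let L A := lim (I n A @[n --> U]).

Let hi n A : measurable A -> mu.-integrable (A `&` E) (EFin \o h n).
Proof.
move=> mA; apply: (@integrable_bounded _ _ _ _ _ _ 1).
- exact: measurableI.
- by apply: le_lt_trans Efin; apply: le_measure; rewrite ?inE//; exact: measurableI.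
- exact: measurable_funTS.
- by move=> x _; have /andP[h0 h1] := h01 n x; rewrite ger0_norm.
Qed.

Let muE A : measurable A -> mu (A `&` E) \is a fin_num.
Proof.
move=> mA; rewrite ge0_fin_numE//; apply: le_lt_trans Efin.
by apply: le_measure; rewrite ?inE//; exact: measurableI.
Qed.

Let I_ge0 n A : 0 <= I n A.
Proof. by apply: Rintegral_ge0 => x _; have /andP[] := h01 n x. Qed.

Let I_le n A : measurable A -> I n A <= fine (mu (A `&` E)).
Proof.
move=> mA; have mAE : measurable (A `&` E) by exact: measurableI.
rewrite -[leRHS]mul1r -Rintegral_cst//; apply: le_Rintegral => //.
- exact: hi.
- apply: (@integrable_bounded _ _ _ _ _ _ 1) => //.
    by rewrite -ge0_fin_numE// muE.
  by move=> x _; rewrite normr1.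
- by move=> x _; have /andP[] := h01 n x.
Qed.

Let I_cvg A : measurable A -> I n A @[n --> U] --> L A.
Proof.
move=> mA; have : cvg (I n A @[n --> U]); last by [].
apply: (@ultra_cvg _ _ _ _ (fine (mu (A `&` E)))) => n.
by rewrite ger0_norm ?I_le.
Qed.

Let L_ge0 A : measurable A -> 0 <= L A.
Proof.
move=> mA; apply: limr_ge; first exact: (cvgP (L A) (I_cvg mA)).
by apply: nearW => n; exact: I_ge0.
Qed.

Let L_le A : measurable A -> L A <= fine (mu (A `&` E)).
Proof.
move=> mA; apply: limr_le; first exact: (cvgP (L A) (I_cvg mA)).
by apply: nearW => n; exact: I_le.
Qed.

Let L_add A B : measurable A -> measurable B -> [disjoint A & B] ->
  L (A `|` B) = L A + L B.
Proof.
move=> mA mB AB; apply: cvg_lim => //.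
rewrite (_ : (fun n => _) = (fun n => I n A + I n B)).
  by apply: cvgD; exact: I_cvg.
apply/funext => n; rewrite /I setIUl Rintegral_setU//.
- exact: measurableI.
- exact: measurableI.
- by rewrite -setIUl; apply: hi; exact: measurableU.
- move/disj_setPS : AB => AB; apply/disj_setPS => x [[Ax _] [Bx _]].
  by exact: (AB x).
Qed.

Import HBSimple.

(** Weak-* compactness on a set of finite measure. The limits L A of the integrals of
    h n over A form a measure dominated by mu, and its Radon-Nikodym density is the
    limit g. Convergence against indicators extends to simple functions by linearity
    and to integrable functions by density. *)
Lemma weak_cluster_finite : exists g : T -> R,
  [/\ measurable_fun setT g, forall x, 0 <= g x <= 1 &
   forall psi, mu.-integrable E (EFin \o psi) ->
     (\int[mu]_(x in E) (psi x * h n x)) @[n --> U] -->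
      \int[mu]_(x in E) (psi x * g x)].
Proof.
(* L is an additive set function on measurable sets only. *)
pose L' A := if pselect (measurable A) then (L A)%:E else 0%E.
have L'E A : measurable A -> L' A = (L A)%:E by rewrite /L'; case: pselect.
have Lm A : measurable A -> ((L A)%:E <= mfrestr mE Efin A)%E.
  by move=> mA; rewrite /= /mfrestr/= /mrestr -(fineK (muE mA)) lee_fin L_le.
have L'0 : L' set0 = 0%E by rewrite L'E// (dominated_additive0 L_ge0 Lm).
have L'ge0 A : (0 <= L' A)%E.
  by rewrite /L'; case: pselect => // mA; rewrite lee_fin L_ge0.
have L'sigma : semi_sigma_additive L'.
  move=> F mF tF mUF; rewrite L'E//.
  rewrite (_ : (fun n => _) = (fun n => \sum_(0 <= i < n) (EFin \o L) (F i))%E).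
    exact: (dominated_sigma_additive L_ge0 Lm L_add).
  by apply/funext => n; apply: eq_bigr => i _; rewrite L'E.
pose mL := isMeasure.Build _ _ _ L' L'0 L'ge0 L'sigma.
pose nu0 : {measure set T -> \bar R} := HB.pack L' mL.
have finL : fin_num_fun nu0 by move=> A mA; rewrite /= L'E.
pose nu1 := Measure_isFinite.Build _ _ _ nu0 finL.
pose nu : {finite_measure set T -> \bar R} := HB.pack L' mL nu1.
have numu : nu `<< mu.
  apply/null_content_dominatesP => A mA muA; rewrite /= L'E//.
  apply/eqP; rewrite eqe eq_le L_ge0// andbT (le_trans (L_le mA))//.
  rewrite (_ : mu (A `&` E) = 0%E)//; apply/eqP; rewrite eq_le measure_ge0 andbT.
  by rewrite -muA; apply: le_measure; rewrite ?inE//; exact: measurableI.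
have [k [k0 kfin ki kE]] := radon_nikodym_sigma_finite numu.
pose k' := fine \o k.
have k'K : EFin \o k' = k by apply/funext => x; rewrite /= fineK.
have k'i A : measurable A -> mu.-integrable A (EFin \o k').
  by move=> mA; rewrite k'K; exact: (integrableS measurableT).
have mk' : measurable_fun setT k' by apply/measurable_EFinP; rewrite k'K; case/integrableP : ki.
have k'E A : measurable A -> \int[mu]_(x in A) k' x = L A.
  move=> mA; have := kE _ mA; rewrite /= L'E// -k'K => /(congr1 fine)/= ->.
  by [].
(* The density is at most 1 almost everywhere; g has to be so everywhere. *)
pose g x := Num.min (k' x) 1.
have mg : measurable_fun setT g by exact: measurable_minr.
have g01 x : 0 <= g x <= 1.
  by rewrite /g le_min ge_min lexx orbT ler01 andbT fine_ge0.
have gi A : measurable A -> mu.-integrable (A `&` E) (EFin \o g).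
  move=> mA; apply: (@integrable_bounded _ _ _ _ _ _ 1).
  - exact: measurableI.
  - by rewrite -ge0_fin_numE// muE.
  - exact: measurable_funTS.
  - by move=> x _; have /andP[h0 h1] := g01 x; rewrite ger0_norm.
have gE A : measurable A -> \int[mu]_(x in A `&` E) g x = L A.
  move=> mA; have mAE : measurable (A `&` E) by exact: measurableI.
  rewrite (_ : L A = L (A `&` E)); last by rewrite /L /I -setIA setIid.
  rewrite -k'E// /Rintegral; congr fine; apply: ge0_ae_eq_integral => //.
  - by apply/measurable_EFinP; exact: measurable_funTS.
  - by apply/measurable_EFinP; exact: measurable_funTS.
  - by move=> x _; rewrite lee_fin; have /andP[] := g01 x.
  - by move=> x _; rewrite lee_fin fine_ge0.
  have : mu.-negligible [set x | (A `&` E) x /\ 1 < k' x].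
    apply: ae_le_Rintegral => //; first exact: k'i.
      apply: (@integrable_bounded _ _ _ _ _ _ 1) => //.
      + by rewrite -ge0_fin_numE// muE.
      + by move=> x _; rewrite normr1.
    move=> B mB BAE; rewrite k'E// Rintegral_cst// mul1r (le_trans (L_le mB))//.
    by rewrite setIidl// => x /BAE[].
  apply: negligibleS => x /= /not_implyP[AEx]; rewrite /g => gk; split => //.
  by rewrite ltNge; apply: contra_notN gk => k1; rewrite min_l.
exists g; split => // psi psii.
have [s [si _ spsi]] := approximation_sfun_integrable mE psii.
have gC x : E x -> `|g x| <= 1 by move=> _; have /andP[h0 h1] := g01 x; rewrite ger0_norm.
have hC n x : E x -> `|h n x| <= 1 by move=> _; have /andP[h0 h1] := h01 n x; rewrite ger0_norm.
have hEi n : mu.-integrable E (EFin \o h n) by rewrite -(setTI E); exact: hi.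
have gEi : mu.-integrable E (EFin \o g) by rewrite -(setTI E); exact: gi.
have scvg m : (\int[mu]_(x in E) (s m x * h n x)) @[n --> U] -->
      \int[mu]_(x in E) (s m x * g x).
  rewrite Rintegral_sfun_mul//.
  under eq_cvg do rewrite Rintegral_sfun_mul//.
  apply: cvg_sumr => y; rewrite gE//; apply: cvgM; first exact: cvg_cst.
  exact: I_cvg.
apply: cvg_uniform_approx => e e0.
have := spsi; move=> /fine_cvgP[_ /cvgrPdist_le/(_ _ e0)[m _ /(_ m (leqnn m))]].
rewrite /= sub0r normrN => se.
have psisi : mu.-integrable E (EFin \o (fun x => psi x - s m x)).
  by apply: integrable_subr.
have close (f : T -> R) : measurable_fun setT f -> (forall x, E x -> `|f x| <= 1) ->
    `|\int[mu]_(x in E) (psi x * f x) - \int[mu]_(x in E) (s m x * f x)| <= e.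
  move=> mf f1; have mfE : measurable_fun E f by exact: measurable_funTS.
  rewrite -RintegralB//; [|exact: integrable_mul_bounded f1|exact: integrable_mul_bounded f1].
  rewrite (@eq_Rintegral _ _ _ _ _ (fun x => (psi x - s m x) * f x)); last first.
    by move=> x _; rewrite mulrBl.
  apply: (le_trans (Rintegral_mul_bounded mE psisi mfE f1)).
  by rewrite mul1r; apply: le_trans se; rewrite ler_norm.
exists (fun n => \int[mu]_(x in E) (s m x * h n x)), (\int[mu]_(x in E) (s m x * g x)).
by split => // [n|]; apply: close => //; exact: hC.
Qed.

End weak_cluster_finite.

Section weak_cluster.
Context d (T : measurableType d) (R : realType).
Variables (mu : {sigma_finite_measure set T -> \bar R}).
Variables (U : set_system nat) (UU : UltraFilter U).

Lemma Rintegral_bigsetU (E : (set T)^nat) (f : T -> R) n :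
  (forall i, measurable (E i)) -> trivIset setT E ->
  mu.-integrable setT (EFin \o f) ->
  \int[mu]_(x in \big[setU/set0]_(i < n) E i) f x =
  \sum_(i <- iota 0 n) \int[mu]_(x in E i) f x.
Proof.
move=> mE tE fi; elim: n => [|n IH].
  by rewrite big_ord0 big_nil Rintegral_set0.
have mB : measurable (\big[setU/set0]_(i < n) E i) by exact: bigsetU_measurable.
have -> : iota 0 n.+1 = rcons (iota 0 n) n by rewrite -cats1 -addn1 iotaD.
rewrite big_ord_recr big_rcons/= -IH Rintegral_setU//.
  by apply: (integrableS measurableT) fi => //; exact: measurableU.
apply/disj_setPS; rewrite -bigcup_mkord => x [[i /= ni Ei] En].
by have := tE i n I I (ex_intro _ x (conj Ei En)) => e; move: ni; rewrite e ltnn.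
Qed.

Lemma Rintegral_tail (E : (set T)^nat) (f : T -> R) :
  (forall i, measurable (E i)) -> \bigcup_i E i = setT ->
  mu.-integrable setT (EFin \o f) ->
  \int[mu]_(x in ~` \big[setU/set0]_(i < n) E i) `|f x| @[n --> \oo] --> 0.
Proof.
move=> mE cE fi; pose C n := ~` \big[setU/set0]_(i < n) E i.
have mC n : measurable (C n) by apply: measurableC; exact: bigsetU_measurable.
have mf : measurable_fun setT f by apply/measurable_EFinP; exact: (measurable_int mu).
have mf' n : measurable_fun setT ((fun x => `|f x|%:E) \_ (C n)).
  apply/(measurable_restrictT _ _).1 => //; apply/measurable_EFinP.
  by apply: measurable_funTS; exact: measurableT_comp.
have [] := @dominated_convergence _ _ _ mu _ measurableT
  (fun n => (fun x => `|f x|%:E) \_ (C n)) (cst 0%E) (fun x => `|f x|%:E) mf'.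
- exact: measurable_cst.
- apply: aeW => x _; have : (\bigcup_i E i) x by rewrite cE.
  move=> [j _ Ej]; apply: cvg_near_cst; exists j.+1 => // n /= jn.
  rewrite patchE memNset// /C/= => CEx; apply: CEx.
  by rewrite -bigcup_mkord; exists j.
- exact: (integrable_norm fi).
- apply: aeW => x n _; rewrite patchE; case: ifPn => _; first by rewrite /= normr_id.
  by rewrite abse0 lee_fin.
move=> _ _; rewrite integral0 => /fine_cvgP[_]; apply: cvg_trans.
apply: near_eq_cvg; apply: nearW => n.
by rewrite /Rintegral [in RHS]integral_mkcond.
Qed.

Variables (h : nat -> T -> R).
Hypothesis mh : forall n, measurable_fun setT (h n).
Hypothesis h01 : forall n x, 0 <= h n x <= 1.

(** The limits obtained on the pieces of a countable partition into sets of finite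
    measure are glued. As the h n are uniformly bounded, an integrable psi makes the
    contribution of all but finitely many pieces small uniformly in n. *)
Lemma weak_cluster : exists g : T -> R,
  [/\ measurable_fun setT g, forall x, 0 <= g x <= 1 &
   forall psi, mu.-integrable setT (EFin \o psi) ->
     (\int[mu]_x (psi x * h n x)) @[n --> U] --> \int[mu]_x (psi x * g x)].
Proof.
have [F TF /all_and2[mF Ffin]] := sigma_finiteT mu.
pose E := seqDU F.
have mE j : measurable (E j).
  by apply: measurableD => //; exact: bigsetU_measurable.
have tE : trivIset setT E by exact: trivIset_seqDU.
have cE : \bigcup_j E j = setT by rewrite -seqDU_bigcup_eq -TF.
have Efin j : (mu (E j) < +oo)%E.
  apply: le_lt_trans (Ffin j); apply: le_measure; rewrite ?inE//.
  exact: subDsetl.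
have /choice[g_ gP] j := weak_cluster_finite UU mh h01 (mE j) (Efin j).
have /choice[ix ixP] (x : T) : exists j, E j x.
  have : (\bigcup_j E j) x by rewrite cE.
  by move=> [j _ Ejx]; exists j.
pose g x := g_ (ix x) x.
have gE j x : E j x -> g x = g_ j x.
  by move=> Ejx; rewrite /g (tE (ix x) j I I)//; exists x.
have mg : measurable_fun setT g.
  rewrite -cE; apply/measurable_fun_bigcup => // j.
  apply: (eq_measurable_fun (g_ j)) => [x /[!inE] /gE//|].
  by apply: measurable_funTS; case: (gP j).
have g01 x : 0 <= g x <= 1.
  by have [_ + _] := gP (ix x); exact.
exists g; split => // psi psii.
have bd (f : T -> R) : (forall x, 0 <= f x <= 1) -> forall D x, D x -> `|f x| <= 1.
  by move=> f01 D x _; have /andP[? ?] := f01 x; rewrite ger0_norm.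
apply: cvg_uniform_approx => e e0.
have /cvgrPdist_le/(_ _ e0)[J _ /(_ J (leqnn J))] := Rintegral_tail mE cE psii.
set B := \big[setU/set0]_(i < J) E i; rewrite /= sub0r normrN => tail.
have mB : measurable B by exact: bigsetU_measurable.
have close (f : T -> R) : measurable_fun setT f -> (forall x, 0 <= f x <= 1) ->
    `|\int[mu]_x (psi x * f x) - \int[mu]_(x in B) (psi x * f x)| <= e.
  move=> mf f01; have fi := integrable_mul_bounded measurableT psii mf (bd _ f01 _).
  rewrite -(setvU B) Rintegral_setU//; [|exact: measurableC|
    by rewrite setvU|by apply/disj_setPS => x []].
  rewrite addrK; apply: (@le_trans _ _ (1 * \int[mu]_(x in ~` B) `|psi x|)).
    apply: Rintegral_mul_bounded.
    + exact: measurableC.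
    + by apply: (integrableS measurableT) psii => //; exact: measurableC.
    + exact: measurable_funTS.
    + exact: bd.
  by rewrite mul1r; apply: le_trans tail; rewrite ler_norm.
exists (fun n => \int[mu]_(x in B) (psi x * h n x)), (\int[mu]_(x in B) (psi x * g x)).
split => [n| |]; [exact: close|exact: close|].
rewrite Rintegral_bigsetU//; last first.
  exact: integrable_mul_bounded measurableT psii mg (bd _ g01 _).
under eq_cvg => n.
  rewrite Rintegral_bigsetU//; last first.
    exact: integrable_mul_bounded measurableT psii (mh n) (bd _ (h01 n) _).
  over.
apply: cvg_sumr => j; have [_ _ gj] := gP j.
rewrite (@eq_Rintegral _ _ _ _ _ (fun x => psi x * g_ j x)).
  by apply: gj; exact: (integrableS measurableT).
by move=> x /[!inE] Ejx; rewrite (gE _ _ Ejx).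
Qed.

End weak_cluster.

(** Testing against the indicators of sets of finite measure suffices. *)
Lemma weak_limit_le d (T : measurableType d) (R : realType)
    (mu : {sigma_finite_measure set T -> \bar R}) (U : set_system nat)
    (FU : ProperFilter U) (h k : nat -> T -> R) (g l : T -> R) :
  (forall n, measurable_fun setT (h n)) -> (forall n x, 0 <= h n x <= 1) ->
  (forall n, measurable_fun setT (k n)) -> (forall n x, 0 <= k n x <= 1) ->
  measurable_fun setT g -> (forall x, 0 <= g x <= 1) ->
  measurable_fun setT l -> (forall x, 0 <= l x <= 1) ->
  (forall psi, mu.-integrable setT (EFin \o psi) ->
     (\int[mu]_x (psi x * h n x)) @[n --> U] --> \int[mu]_x (psi x * g x)) ->
  (forall psi, mu.-integrable setT (EFin \o psi) ->
     (\int[mu]_x (psi x * k n x)) @[n --> U] --> \int[mu]_x (psi x * l x)) ->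
  (forall n x, h n x <= k n x) ->
  mu.-negligible [set x | l x < g x].
Proof.
move=> mh h01 mk k01 mg g01 ml l01 hg kl hk.
have [F TF /all_and2[mF Ffin]] := sigma_finiteT mu.
have bd (f : T -> R) : (forall x, 0 <= f x <= 1) -> forall D x, D x -> `|f x| <= 1.
  by move=> f01 D x _; have /andP[? ?] := f01 x; rewrite ger0_norm.
have bi D (f : T -> R) : measurable D -> (mu D < +oo)%E -> measurable_fun setT f ->
    (forall x, 0 <= f x <= 1) -> mu.-integrable D (EFin \o f).
  move=> mD Doo mf f01; apply: (@integrable_bounded _ _ _ _ _ _ 1) => //.
    exact: measurable_funTS.
  exact: bd.
rewrite (_ : [set x | _] = \bigcup_j [set x | F j x /\ l x < g x]); last first.
  apply/seteqP; split => [x /= lg|x [j _ []//]].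
  have : (\bigcup_j F j) x by rewrite -TF.
  by move=> [j _ Fj]; exists j.
apply: negligible_bigcup => j.
have Fj := Ffin j.
apply: ae_le_Rintegral => //; [exact: bi|exact: bi|].
move=> A mA AF; have Aoo : (mu A < +oo)%E.
  by apply: le_lt_trans (Ffin j); apply: le_measure; rewrite ?inE.
have Ai : mu.-integrable setT (EFin \o (\1_A : T -> R)).
  rewrite (_ : EFin \o _ = (EFin \o cst (1 : R)) \_ A); last first.
    by rewrite restrict_EFin; apply/funext => x /=; rewrite patchE indicE; case: ifPn.
  by apply/(integrable_mkcond _ mA).1; apply: bi => // x; rewrite ler01 lexx.
have E f : \int[mu]_(x in A) f x = \int[mu]_x ((\1_A : T -> R) x * f x).
  rewrite Rintegral_mkcond; apply: eq_Rintegral => x _; rewrite patchE indicE.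
  by case: ifPn; rewrite ?mul1r ?mul0r.
rewrite !E; apply: ler_cvg_to (hg _ Ai) (kl _ Ai) _.
by apply: nearW => n; rewrite -!E; apply: le_Rintegral => //; apply: bi.
Qed.

(** * Quantile functions and the layer-cake formula *)

Lemma mem_setb T (b : pred T) t : (t \in [set t | b t]) = b t.
Proof. by apply/idP/idP; rewrite inE. Qed.

Section layer_cake.
Context d (T : measurableType d) (R : realType) (P : probability T R).
Variables (X : T -> R) (mX : measurable_fun setT X).
Variables (r : nat -> R) (K : nat).
Hypothesis r_nd : {homo r : i j / (i <= j)%N >-> i <= j}.
Hypothesis Xr : forall t, r 0%N <= X t <= r K.
Variables (g : R -> R) (e C : R).
Hypothesis mg : measurable_fun setT g.
Hypothesis gC : forall y, r 0%N <= y <= r K -> `|g y| <= C.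
Hypothesis ge : forall j y, (j < K)%N -> r j <= y <= r j.+1 -> `|g y - g (r j.+1)| <= e.
Variable c : nat -> R.
Hypothesis cP : forall j, (j < K)%N ->
  c j.+1 <= fine (P [set t | r j < X t]) <= c j.
Hypothesis c0 : c 0%N <= 1.
Hypothesis cK : 0 <= c K.

Lemma step_approx k y : 0 <= e -> (k <= K)%N -> r 0%N <= y -> y <= r k ->
  `|g y - (g (r 0%N) + \sum_(0 <= j < k) (g (r j.+1) - g (r j)) * (r j < y)%R%:R)| <= e.
Proof.
move=> e0; elim: k => [|k IH] kK ry yr.
  rewrite big_nil addr0 (_ : y = r 0%N) ?subrr ?normr0//.
  by apply/eqP; rewrite eq_le ry yr.
rewrite big_nat_recr//=; have [yrk|rky] := leP y (r k).
  by rewrite mulr0 addr0; apply: IH => //; exact: ltnW.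
rewrite mulr1 (_ : \sum_(0 <= j < k) _ = g (r k) - g (r 0%N)); last first.
  rewrite -(telescope_sumr (g \o r) (leq0n k)); apply: eq_big_nat => j /andP[_ jk].
  by rewrite (le_lt_trans _ rky) ?mulr1//; apply: r_nd; exact: ltnW.
rewrite (_ : g (r 0%N) + _ = g (r k.+1)); last by ring.
by apply: ge => //; rewrite (ltW rky).
Qed.

(** The step function equal to g (r j.+1) on ]r j, r j.+1] is, by Abel summation, a
    combination of the indicators of r j < y; its expectation at X is the combination
    of the tails of X. The weights c j may differ from these tails by a shift of one
    index, which costs a second e after telescoping: this leaves room for the jumps of
    a tail function that is known at rational levels only. *)
Lemma layer_cake_approx : 0 <= e ->
  `|\int[P]_t g (X t) -
    (g (r 0%N) + \sum_(0 <= j < K) (g (r j.+1) - g (r j)) * c j)| <= e + e.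
Proof.
move=> e0.
have mgX : measurable_fun setT (g \o X) by exact: measurableT_comp.
have P1 : fine (P setT) = 1 by rewrite probability_setT.
have PT : (P setT < +oo)%E by rewrite probability_setT ltry.
have gXi : P.-integrable setT (EFin \o (g \o X)).
  by apply: (@integrable_bounded _ _ _ _ _ _ C) => // t _; exact: gC.
have mA j : measurable [set t | r j < X t] by exact: measurable_superlevel.
pose p j := fine (P [set t | r j < X t]).
pose ind j t : R := (r j < X t)%R%:R.
pose D j := g (r j.+1) - g (r j).
pose S t := \sum_(0 <= j < K) D j * ind j t.
pose s t := g (r 0%N) + S t.
have i1 j : P.-integrable setT (EFin \o ind j).
  rewrite (_ : ind j = \1_[set t | r j < X t]); first exact: integrable_indic.
  by apply/funext => t; rewrite indicE mem_setb.
have Di j : P.-integrable setT (EFin \o (fun t => D j * ind j t)).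
  by have := @integrable_scaler _ _ _ P setT (D j) (ind j) measurableT (i1 j).
have ci : P.-integrable setT (EFin \o cst (g (r 0%N))) by exact: finite_measure_integrable_cst.
have sumi : P.-integrable setT (EFin \o S) by exact: integrable_sumr.
have si : P.-integrable setT (EFin \o s) by exact: integrable_addr.
have sE : \int[P]_t s t = g (r 0%N) + \sum_(0 <= j < K) D j * p j.
  rewrite RintegralD// Rintegral_cst// P1 mulr1; congr (_ + _).
  rewrite Rintegral_sumr//; apply: eq_bigr => j _; rewrite RintegralZl//; congr (_ * _).
  rewrite /p /Rintegral -[in RHS](setIT [set t | _]) -integral_indic//; congr fine.
  by apply: eq_integral => t _; rewrite indicE mem_setb.
rewrite (_ : _ - _ = (\int[P]_t g (X t) - \int[P]_t s t) + (\int[P]_t s t -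
    (g (r 0%N) + \sum_(0 <= j < K) (g (r j.+1) - g (r j)) * c j))); last by ring.
apply: (le_trans (ler_normD _ _)); apply: lerD.
  rewrite -RintegralB//; apply: (le_trans (le_normr_Rintegral _ _)) => //.
    exact: integrable_subr.
  rewrite -[leRHS]mulr1 -[X in _ <= _ * X](_ : fine (P setT) = 1); last first.
    by rewrite probability_setT.
  rewrite -Rintegral_cst//; apply: le_Rintegral => //.
  - by apply: integrable_norm; exact: integrable_subr.
  - exact: finite_measure_integrable_cst.
  - by move=> t _; have /andP[? ?] := Xr t; exact: step_approx.
rewrite sE opprD addrACA subrr add0r -sumrB.
apply: (le_trans (ler_norm_sum _ _ _)).
apply: (@le_trans _ _ (\sum_(0 <= j < K) e * (c j - c j.+1))).
  rewrite !big_nat; apply: ler_sum => j /andP[_ jK].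
  rewrite -mulrBr normrM; have /andP[cp pc] := cP jK.
  apply: ler_pM => //.
    rewrite distrC; apply: ge => //; rewrite lexx/=; exact: r_nd.
  rewrite distrC ger0_norm ?subr_ge0//; exact: lerB.
rewrite -mulr_sumr -[leRHS]mulr1; apply: ler_wpM2l => //.
rewrite -[X in X <= _]opprK -sumrN (eq_bigr (fun j => c j.+1 - c j)); last first.
  by move=> j _; rewrite opprB.
by rewrite telescope_sumr// opprB; apply: le_trans c0; rewrite gerBl.
Qed.

End layer_cake.

Lemma uniform_continuity_itv (R : realType) (g : R -> R) (a b e : R) :
  continuous g -> 0 < e -> exists2 del : R, 0 < del &
    forall x y, a <= x <= b -> `|x - y| <= del -> `|g x - g y| <= e.
Proof.
move=> cg e0; have /compact_near_coveringP := @segment_compact R a b.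
move=> /(_ R (0^'+) (fun del x => forall y, `|x - y| <= del -> `|g x - g y| <= e)).
have e2 : 0 < e / 2 by rewrite divr_gt0.
move=> /(_ _ _)[x _|del /= del0 Hdel].
  have /cvgrPdist_le/(_ _ e2)/nbhs_ballP[del /= del0 gdel] := cg x.
  have d2 : 0 < del / 2 by rewrite divr_gt0.
  exists (ball x (del / 2), [set t | t < del / 2]).
    split; first by apply/nbhs_ballP; exists (del / 2).
    exact: nbhs_right_lt.
  move=> [x' t] /= [xx' tdel] y x'y.
  rewrite (_ : g x' - g y = (g x - g y) - (g x - g x')); last by ring.
  rewrite [leRHS]splitr; apply: (le_trans (ler_normB _ _)); apply: lerD.
    apply: gdel; rewrite /ball/= (_ : x - y = (x - x') + (x' - y)); last by ring.
    rewrite [ltRHS]splitr; apply: (le_lt_trans (ler_normD _ _)).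
    by apply: ltrD => //; apply: le_lt_trans tdel.
  by apply: gdel; rewrite /ball/=; apply: (lt_trans xx'); rewrite ltr_pdivrMr// ltr_pMr// ltr1n.
exists (del / 2); first by rewrite divr_gt0.
move=> x y xab xy; apply: (Hdel (del / 2)) => //=.
- by rewrite sub0r normrN gtr0_norm ?divr_gt0// ltr_pdivrMr// ltr_pMr// ltr1n.
- by rewrite divr_gt0.
Qed.

Section grid.
Context {R : realType}.

(** The K.+1 equally spaced points of [- M, M]. They are rational because weak limits
    of tails are only available at countably many levels. *)
Definition grid (M K j : nat) : rat := - M%:R + (2 * M * j)%:R / K%:R.

Lemma grid0 M K : grid M K 0 = - M%:R.
Proof. by rewrite /grid muln0 mul0r addr0. Qed.

Lemma gridK M K : (0 < K)%N -> grid M K K = M%:R.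
Proof.
move=> K0; rewrite /grid natrM mulfK; last by rewrite pnatr_eq0 -lt0n.
by rewrite natrM; ring.
Qed.

Lemma grid_le M K i j : (i <= j)%N -> grid M K i <= grid M K j.
Proof.
move=> ij; rewrite lerD2l ler_wpM2r ?invr_ge0// ler_nat.
by rewrite leq_mul2l ij orbT.
Qed.

Lemma grid_lt M K i j : (0 < M)%N -> (0 < K)%N -> (i < j)%N -> grid M K i < grid M K j.
Proof.
move=> M0 K0 ij; rewrite ltrD2l ltr_pM2r ?invr_gt0 ?ltr0n// ltr_nat.
by rewrite ltn_mul2l ij andbT muln_gt0.
Qed.

Lemma grid_fine (g : R -> R) (M : nat) (e : R) : continuous g -> 0 < e ->
  exists2 K, (0 < K)%N & forall j y, (j < K)%N ->
    ratr (grid M K j) <= y <= ratr (grid M K j.+1) ->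
    `|g y - g (ratr (grid M K j.+1))| <= e.
Proof.
move=> cg e0; have [del del0 gdel] := uniform_continuity_itv (- M%:R) M%:R cg e0.
pose K := (Num.truncn ((2 * M)%:R / del)).+1.
have Kdel : (2 * M)%:R / K%:R <= del.
  rewrite ler_pdivrMr ?ltr0n// mulrC -ler_pdivrMr//.
  by rewrite ltW// /K truncnS_gt.
have rM i : ratr (grid M K i) = - M%:R + (2 * M)%:R * (i%:R / K%:R) :> R.
  by rewrite /grid rmorphD rmorphN/= fmorph_div/= !ratr_nat natrM mulrA.
exists K => // j y jK /andP[jy yj]; apply: gdel.
  apply/andP; split.
    apply: le_trans jy; rewrite rM lerDl; by apply: mulr_ge0.
  apply: (le_trans yj); rewrite -(ratr_nat R M) ler_rat -(@gridK M K)//.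
  exact: grid_le.
rewrite distrC ger0_norm ?subr_ge0//; apply: le_trans Kdel.
rewrite lerBlDr; apply: (le_trans _ (lerD (lexx _) jy)).
rewrite !rM -addn1 natrD le_eqVlt; apply/orP; left; apply/eqP.
by ring.
Qed.

End grid.

Section quantile.
Context {R : realType}.
Variable M : nat.

Definition in_range (q : rat) := (- M%:R <= q) && (q < M%:R).

Definition quantile_term (h : rat -> R) (w : R) (n : nat) : R :=
  let q := odflt 0 (unpickle n) in
  if in_range q && (w < h q) then ratr q else - M%:R.

(** For h q = mu ]q, +oo[ this is a decreasing quantile function of mu, with values
    cut off to [- M, M]. The supremum over rationals is written as that of a sequence,
    which makes it jointly measurable in h and w for an arbitrary family h. *)
Definition quantile (h : rat -> R) (w : R) : R := sups (quantile_term h w) 0.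

Lemma quantile_term_bound h w n : - M%:R <= quantile_term h w n <= M%:R.
Proof.
rewrite /quantile_term; case: ifPn => [/andP[/andP[q1 q2] _]|_].
  by rewrite -(ratr_nat R M) -rmorphN !ler_rat q1 ltW.
by rewrite lexx ge0_cp.
Qed.

Let range_sup h w : has_sup (sdrop (quantile_term h w) 0).
Proof.
split; first by exists (quantile_term h w 0%N); exists 0%N.
by exists M%:R => _ [n _ <-]; have /andP[] := quantile_term_bound h w n.
Qed.

Lemma quantile_bound h w : - M%:R <= quantile h w <= M%:R.
Proof.
apply/andP; split.
  have /andP[h1 _] := quantile_term_bound h w 0%N.
  by apply: (le_trans h1); apply: sup_upper_bound => //; exists 0%N.
apply: ge_sup; first by case: (range_sup h w).
by move=> _ [n _ <-]; have /andP[] := quantile_term_bound h w n.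
Qed.

Lemma quantile_gt h w xi : - M%:R <= xi ->
  xi < quantile h w <-> exists q, [/\ in_range q, w < h q & xi < ratr q].
Proof.
move=> Mxi; split => [xq|[q [qM wq xq]]].
  have [_ [n _ <-]] := sup_gt (proj1 (range_sup h w)) xq.
  rewrite /quantile_term; case: ifPn => [/andP[qM wq] xq'|_].
    by exists (odflt 0 (unpickle n)).
  by move=> /(le_lt_trans Mxi); rewrite ltxx.
apply: (lt_le_trans xq); apply: sup_upper_bound => //.
by exists (pickle q) => //; rewrite /quantile_term pickleK/= qM wq.
Qed.

Lemma measurable_quantile d (T : measurableType d) (h : rat -> T -> R) :
  (forall q, measurable_fun setT (h q)) ->
  measurable_fun setT (fun z : T * measurableTypeR R => quantile (h ^~ z.1) z.2).
Proof.
move=> mh; apply: (measurable_fun_sups (h := fun n z => quantile_term (h ^~ z.1) z.2 n)).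
  move=> z _; exists M%:R => _ [n _ <-].
  by have /andP[] := quantile_term_bound (h ^~ z.1) z.2 n.
move=> n; rewrite /quantile_term; case: in_range => /=; last exact: measurable_cst.
apply: measurable_fun_ifT => //.
apply: measurable_fun_ltr => //; exact: measurableT_comp.
Qed.

Local Notation P := (uniform_prob (@ltr01 R)).

Lemma uniform_lt c : 0 <= c <= 1 -> fine (P [set w : measurableTypeR R | w < c]) = c.
Proof.
move=> /andP[c0 c1]; rewrite /uniform_prob integral_uniform_pdf.
rewrite (_ : _ `&` _ = `[0, c[%classic); last first.
  apply/seteqP; split => x /=; rewrite !in_itv/=.
    by move=> [-> /andP[-> _]].
  by move=> /andP[-> xc]; rewrite xc (ltW (lt_le_trans xc c1)).
rewrite (eq_integral (fun=> 1%E)).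
  rewrite integral_cst//= mul1e lebesgue_measure_itv/= lte_fin.
  by move: c0; rewrite le_eqVlt => /predU1P[<-|->]; rewrite ?ltxx ?oppr0 ?addr0.
move=> x; rewrite inE/= in_itv/= => /andP[x0 xc].
by rewrite /uniform_pdf x0 (ltW (lt_le_trans xc c1))/= subr0 invr1.
Qed.

End quantile.

Lemma continuous_itv_bounded (R : realType) (g : R -> R) (a b : R) :
  continuous g -> exists2 C, 0 <= C & forall y, a <= y <= b -> `|g y| <= C.
Proof.
move=> cg; have : compact (g @` `[a, b]).
  apply: continuous_compact; last exact: segment_compact.
  exact: continuous_subspaceT.
move=> /compact_bounded[C [_ CP]]; exists (`|C| + 1); first by rewrite addr_ge0.
move=> y yab; apply: (CP (`|C| + 1)); first by rewrite ltr_pwDr// ler_norm.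
by exists y => //=; rewrite in_itv.
Qed.

Section quantile_law.
Context {R : realType}.
Variable M : nat.
Hypothesis M0 : (0 < M)%N.
Local Notation P := (uniform_prob (@ltr01 R)).

Lemma measurable_quantile1 (h : rat -> R) :
  measurable_fun setT (fun w : measurableTypeR R => quantile M h w).
Proof.
have := @measurable_quantile R M _ (measurableTypeR R) (fun q _ => h q) (fun=> measurable_cst _).
exact: (@measurable_fun_pair2 _ _ _ _ _ _ _ (0 : measurableTypeR R)).
Qed.

Lemma ratr_grid0 K : ratr (grid M K 0) = - M%:R :> R.
Proof. by rewrite grid0 rmorphN/= ratr_nat. Qed.

Lemma ratr_gridK K : (0 < K)%N -> ratr (grid M K K) = M%:R :> R.
Proof. by move=> K0; rewrite gridK// ratr_nat. Qed.

Lemma in_range_grid K j : (j < K)%N -> in_range M (grid M K j).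
Proof.
move=> jK; have K0 : (0 < K)%N by exact: leq_ltn_trans jK.
rewrite /in_range -(grid0 M K) grid_le//= -(gridK M K0).
exact: grid_lt.
Qed.

(** P (r < quantile) need not equal h r where h jumps, but it lies between the values
    of h at r and at any larger rational, which is what layer_cake_approx asks for. *)
Lemma quantile_approx (h : rat -> R) (g : R -> R) (e : R) K :
  (forall q, 0 <= h q <= 1) -> (forall p q, p <= q -> h q <= h p) ->
  continuous g -> 0 < e -> (0 < K)%N ->
  (forall j y, (j < K)%N ->
    ratr (grid M K j) <= y <= ratr (grid M K j.+1) ->
    `|g y - g (ratr (grid M K j.+1))| <= e) ->
  `|\int[P]_w g (quantile M h w) - (g (- M%:R) + \sum_(0 <= j < K)
     (g (ratr (grid M K j.+1)) - g (ratr (grid M K j))) * h (grid M K j))| <= e + e.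
Proof.
move=> h01 h_ni cg e0 K0 gK; pose r j : R := ratr (grid M K j).
have [C C0 gC] := continuous_itv_bounded (- M%:R) M%:R cg.
rewrite -(ratr_grid0 K); pose c j := if (j < K)%N then h (grid M K j) else 0.
rewrite (_ : \sum_(0 <= j < K) _ = \sum_(0 <= j < K) (g (r j.+1) - g (r j)) * c j); last first.
  by apply: eq_big_nat => j /andP[_ jK]; rewrite /c jK.
have mX := measurable_quantile1 h.
apply: (@layer_cake_approx _ _ _ P _ mX r K _ _ g e C) => //.
- by move=> i j ij; rewrite ler_rat grid_le.
- by move=> w; rewrite /r ratr_grid0 ratr_gridK// quantile_bound.
- exact: continuous_measurable_fun.
- by move=> y; rewrite /r ratr_grid0 ratr_gridK//; exact: gC.
- move=> j jK; have rj : - M%:R <= r j by rewrite -(ratr_grid0 K) ler_rat grid_le.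
  have mA : measurable [set w | r j < quantile M h w] by exact: measurable_superlevel.
  have mlt q : measurable [set w : measurableTypeR R | w < h q].
    by rewrite (_ : [set w | _] = `]-oo, h q[%classic).
  have Pfin A : measurable A -> P A \is a fin_num by move=> mA'; exact: fin_num_measure.
  apply/andP; split.
    rewrite /c; case: ifPn => [j1K|_]; last by rewrite fine_ge0.
    rewrite -(uniform_lt (h01 (grid M K j.+1))) fine_le ?Pfin//.
    apply: le_measure; rewrite ?inE// => w /= wh; apply/quantile_gt => //.
    exists (grid M K j.+1); split => //; first exact: in_range_grid.
    by rewrite ltr_rat grid_lt.
  rewrite /c jK -(uniform_lt (h01 (grid M K j))) fine_le ?Pfin//.
  apply: le_measure; rewrite ?inE// => w /= /quantile_gt-/(_ rj)[q [_ wq]].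
  rewrite ltr_rat => /ltW rq; apply: (lt_le_trans wq); exact: h_ni.
- by rewrite /c K0; have /andP[] := h01 (grid M K 0).
- by rewrite /c ltnn.
- exact: ltW.
Qed.

(** The counterpart of quantile_approx with the actual tails of X: two random variables
    whose tails agree on the grid have nearly the same expectation of g. *)
Lemma tail_approx d (T : measurableType d) (Q : probability T R) (X : T -> R)
    (g : R -> R) (e : R) K : measurable_fun setT X ->
  (forall t, - M%:R <= X t <= M%:R) -> continuous g -> 0 < e -> (0 < K)%N ->
  (forall j y, (j < K)%N ->
    ratr (grid M K j) <= y <= ratr (grid M K j.+1) ->
    `|g y - g (ratr (grid M K j.+1))| <= e) ->
  `|\int[Q]_t g (X t) - (g (- M%:R) + \sum_(0 <= j < K)
     (g (ratr (grid M K j.+1)) - g (ratr (grid M K j))) *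
       fine (Q [set t | ratr (grid M K j) < X t]))| <= e + e.
Proof.
move=> mX XM cg e0 K0 gK; pose r j : R := ratr (grid M K j).
have [C C0 gC] := continuous_itv_bounded (- M%:R) M%:R cg.
pose p j := fine (Q [set t | r j < X t]).
rewrite -(ratr_grid0 K); pose c j := if (j < K)%N then p j else 0.
rewrite (_ : \sum_(0 <= j < K) _ = \sum_(0 <= j < K) (g (r j.+1) - g (r j)) * c j); last first.
  by apply: eq_big_nat => j /andP[_ jK]; rewrite /c jK.
have mA j : measurable [set t | r j < X t] by exact: measurable_superlevel.
have Qfin A : measurable A -> Q A \is a fin_num by move=> ?; exact: fin_num_measure.
apply: (@layer_cake_approx _ _ _ Q _ mX r K _ _ g e C) => //.
- by move=> i j ij; rewrite ler_rat grid_le.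
- by move=> t; rewrite /r ratr_grid0 ratr_gridK.
- exact: continuous_measurable_fun.
- by move=> y; rewrite /r ratr_grid0 ratr_gridK//; exact: gC.
- move=> j jK; rewrite /c jK lexx andbT; case: ifPn => [_|_]; last by rewrite fine_ge0.
  rewrite fine_le ?Qfin//; apply: le_measure; rewrite ?inE// => t /=.
  by apply: le_lt_trans; rewrite ler_rat grid_le.
- by rewrite /c K0 /p -lee_fin fineK ?Qfin//; exact: probability_le1.
- by rewrite /c ltnn.
- exact: ltW.
Qed.

End quantile_law.

Section bounded_support.
Context {R : realType}.
Local Notation prob := (probability (measurableTypeR R) R).
Local Notation P := (uniform_prob (@ltr01 R)).

(** The complement of the support is covered by the countably many null intervals with
    rational end points. *)
Lemma msupport_null (mu : prob) (M : R) : msupport mu `<=` `[- M, M] ->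
  mu (~` `[- M, M]%classic) = 0%E.
Proof.
move=> sM; pose I (q : rat * rat) : set R := `](ratr q.1), (ratr q.2)[%classic.
pose F n := if `[< mu (I (odflt (0, 0) (unpickle n))) = 0%E >]
  then I (odflt (0, 0) (unpickle n)) else set0.
have mF n : measurable (F n) by rewrite /F; case: ifP => _ //; exact: measurable_itv.
have F0 n : mu.-negligible (F n).
  apply/negligibleP => //; rewrite /F; case: asboolP => // _; exact: measurable_itv.
have : mu.-negligible (\bigcup_n F n) by exact: negligible_bigcup.
move=> N; apply/negligibleP; first by apply: measurableC; exact: measurable_itv.
apply: negligibleS N => y yM.
have /existsNP[V /not_implyP[oV /not_implyP[Vy /negP V0]]] : ~ msupport mu y by move=> /sM.
have muV : mu V = 0%E by apply/eqP; rewrite eq_le measure_ge0 andbT leNgt.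
have /nbhs_ballP[e /= e0 eV] : nbhs y V by exact: open_nbhs_nbhs.
have [a ay] := @rat_in_itvoo R (y - e) y ltac:(by rewrite gtrBl).
have [b yb] := @rat_in_itvoo R y (y + e) ltac:(by rewrite ltrDl).
move: ay yb; rewrite !in_itv/= => /andP[ya ay] /andP[yb bye].
exists (pickle (a, b)) => //; rewrite /F pickleK/= asboolT; last first.
  apply/eqP; rewrite eq_le measure_ge0 andbT -muV; apply: le_measure; rewrite ?inE//.
  - exact: measurable_itv.
  - exact: open_measurable.
  - move=> z; rewrite /I/= in_itv/= => /andP[az zb]; apply: eV.
    rewrite /ball/= ltr_distlC; apply/andP; split.
      exact: lt_trans az.
    exact: lt_trans bye.
by rewrite /I/= in_itv/= ay.
Qed.

Lemma Rintegral_concentrated (mu : prob) (A : set R) (f g : R -> R) :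
  mu (~` A) = 0%E -> measurable A -> measurable_fun setT f -> measurable_fun setT g ->
  (forall x, A x -> f x = g x) -> \int[mu]_x f x = \int[mu]_x g x.
Proof.
move=> A0 mA mf mg fg; rewrite /Rintegral; congr fine; apply: ae_eq_integral => //.
- exact/measurable_EFinP.
- exact/measurable_EFinP.
exists (~` A); split => //; first exact: measurableC.
by move=> x /= H Ax; apply: H => _; rewrite fg.
Qed.

(** The truncation of t to [0, 1]; with absolute values its continuity is immediate. *)
Definition clamp01 (t : R) : R := (`|t| - `|t - 1| + 1) / 2.

Lemma clamp01_ge0 t : 0 <= clamp01 t <= 1.
Proof. by rewrite /clamp01; case: (ger0P t); case: (ger0P (t - 1)); lra. Qed.

Lemma clamp01_le0 t : t <= 0 -> clamp01 t = 0.
Proof.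
move=> t0; rewrite /clamp01 ler0_norm// ler0_norm; first by lra.
by rewrite subr_le0 (le_trans t0).
Qed.

Lemma clamp01_ge1 t : 1 <= t -> clamp01 t = 1.
Proof.
move=> t1; rewrite /clamp01 ger0_norm ?(le_trans _ t1)// ger0_norm ?subr_ge0//.
by lra.
Qed.

Lemma continuous_clamp01 (f : R -> R) : continuous f -> continuous (clamp01 \o f).
Proof.
move=> cf x; rewrite /clamp01 /=; apply: cvgMl; apply: cvgD; last exact: cvg_cst.
apply: cvgB; first by apply: cvg_norm; exact: cf.
by apply: cvg_norm; apply: cvgB; [exact: cf|exact: cvg_cst].
Qed.

Section tail.
Variable M : R.
Let chi (y : R) := clamp01 (M + 1 - `|y|).
Let psi r n (y : R) := clamp01 (n.+1%:R * (y - r)) * chi y.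

(** A continuous approximation of the indicator of ]r, +oo[. The factor chi is 1 on
    [- M, M] and cuts it off at infinity. *)
Lemma continuous_vanishing_tail r n : continuous_vanishing (psi r n).
Proof.
have chi0 y : M + 1 <= `|y| -> psi r n y = 0.
  by move=> My; rewrite /psi /chi [X in _ * X]clamp01_le0 ?mulr0// subr_le0.
split.
- move=> y; apply: cvgM.
    apply: (@continuous_clamp01 (fun y => n.+1%:R * (y - r))) => x.
    by apply: cvgMr; apply: cvgB; [exact: cvg_id|exact: cvg_cst].
  apply: (@continuous_clamp01 (fun y => M + 1 - `|y|)) => x.
  by apply: cvgB; [exact: cvg_cst|apply: cvg_norm; exact: cvg_id].
- apply: cvg_near_cst; near=> y; apply: chi0.
  by rewrite (le_trans _ (ler_norm _))//; near: y; exact: nbhs_pinfty_ge.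
- apply: cvg_near_cst; near=> y; apply: chi0.
  rewrite -normrN (le_trans _ (ler_norm _))// lerNr; near: y.
  by apply: nbhs_ninfty_le; rewrite num_real.
Unshelve. all: by end_near. Qed.

Lemma tail_cvg (mu : prob) r : mu (~` `[- M, M]%classic) = 0%E ->
  pairing mu (psi r n) @[n --> \oo] --> fine (mu `]r, +oo[%classic).
Proof.
move=> mu0; pose f (y : R) := \1_(`]r, +oo[%classic : set R) y * chi y.
have mchi : measurable_fun setT chi.
  apply: continuous_measurable_fun => y.
  apply: (@continuous_clamp01 (fun y => M + 1 - `|y|)) => x.
  by apply: cvgB; [exact: cvg_cst|apply: cvg_norm; exact: cvg_id].
have mf : measurable_fun setT f by apply: measurable_funM.
rewrite (_ : fine _ = \int[mu]_y f y).
  have [] := @Rintegral_dominated _ _ _ mu setT (psi r) f (cst 1) measurableT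
    (fun n => continuous_measurable_fun (let: And3 c _ _ := continuous_vanishing_tail r n in c)) mf.
  - move=> y _; rewrite /psi /f; apply: cvgMl; rewrite indicE mem_setE in_itv/= andbT.
    have [yr|ry] := leP y r.
      apply: cvg_near_cst; apply: nearW => n; apply: clamp01_le0.
      by rewrite mulr_ge0_le0// subr_le0.
    apply: cvg_near_cst; exists (Num.truncn (y - r)^-1) => // n /= yn; apply: clamp01_ge1.
    rewrite -ler_pdivrMr ?subr_gt0// div1r ltW//.
    by apply: (lt_le_trans (truncnS_gt _)); rewrite ler_nat ltnS.
  - exact: finite_measure_integrable_cst.
  - move=> n y _; rewrite /psi normrM.
    have /andP[a0 a1] := clamp01_ge0 (n.+1%:R * (y - r)).
    have /andP[b0 b1] := clamp01_ge0 (M + 1 - `|y|).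
    by rewrite !ger0_norm// mulr_ile1.
  - by [].
rewrite (@Rintegral_concentrated mu `[- M, M]%classic f (\1_(`]r, +oo[%classic : set R)))//.
  by rewrite /Rintegral integral_indic//= setIT.
move=> y /=; rewrite in_itv/= => yM; rewrite /f /chi clamp01_ge1 ?mulr1//.
by move: yM; rewrite -ler_norml; lra.
Qed.

(** A Young measure is given as measurable against functions vanishing at infinity;
    its tails are limits of such pairings. *)
Lemma measurable_tail d (T : measurableType d) (nu : T -> prob) r :
  (forall z, nu z (~` `[- M, M]%classic) = 0%E) ->
  (forall g, continuous_vanishing g -> measurable_fun setT (fun z => pairing (nu z) g)) ->
  measurable_fun setT (fun z => fine (nu z `]r, +oo[%classic)).
Proof.
move=> nu0 mnu; apply: (@measurable_fun_cvg _ _ _ _ (fun n z => pairing (nu z) (psi r n))).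
  by move=> n; apply: mnu; exact: continuous_vanishing_tail.
by move=> z _; exact: tail_cvg.
Qed.

End tail.

Variable M : nat.
Hypothesis M0 : (0 < M)%N.

(** Both sides have the tails of mu, so that quantile_approx and tail_approx bound their
    difference by any e. Truncating the identity to [- M, M] supplies the bounded random
    variable of law mu. *)
Lemma pairing_quantile (mu : prob) (g : R -> R) :
  mu (~` `[- M%:R, M%:R]%classic) = 0%E -> continuous g ->
  pairing mu g = \int[P]_w g (quantile M (fun q => fine (mu `]ratr q, +oo[%classic)) w).
Proof.
move=> mu0 cg; pose h q := fine (mu `]ratr q, +oo[%classic).
have mufin A : measurable A -> mu A \is a fin_num by move=> mA; exact: fin_num_measure.
have h01 q : 0 <= h q <= 1.
  rewrite fine_ge0//= -lee_fin fineK ?mufin//; exact: probability_le1.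
have h_ni p q : p <= q -> h q <= h p.
  move=> pq; rewrite fine_le ?mufin//; apply: le_measure; rewrite ?inE//.
  by apply: subset_itvr; rewrite leBSide/= ler_rat.
(* The identity truncated to [- M, M], equal to it almost everywhere for mu. *)
pose X (y : R) : R := Num.max (- M%:R) (Num.min M%:R y).
have MM : - M%:R <= M%:R :> R by rewrite ge0_cp.
have mX : measurable_fun setT X by apply: measurable_maxr => //; exact: measurable_minr.
have Xb y : - M%:R <= X y <= M%:R.
  by rewrite /X le_max lexx/= ge_max MM/= ge_min lexx.
have gX : pairing mu g = \int[mu]_y g (X y).
  apply: (Rintegral_concentrated mu0) => //.
  - exact: continuous_measurable_fun.
  - by apply: measurableT_comp => //; exact: continuous_measurable_fun.
  by move=> y /=; rewrite in_itv/= => /andP[y1 y2]; rewrite /X min_r// max_r.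
apply/eqP; rewrite -subr_eq0 -normr_le0; apply/ler_addgt0Pr => e e0; rewrite add0r.
have e4 : 0 < e / 4 by rewrite divr_gt0.
have [K K0 gK] := grid_fine M cg e4.
pose r j : R := ratr (grid M K j).
have A1 := quantile_approx M0 h01 h_ni cg e4 K0 gK.
have A2 := tail_approx mu mX Xb cg e4 K0 gK; rewrite -gX in A2.
have tailE j : (j < K)%N -> fine (mu [set t | r j < X t]) = h (grid M K j).
  move=> jK; rewrite (_ : [set t | _] = `]r j, +oo[%classic)//.
  have /andP[q1 q2] := @in_range_grid M M0 K j jK.
  have r1 : - M%:R <= r j by rewrite /r -(ratr_nat R M) -rmorphN ler_rat.
  have r2 : r j < M%:R by rewrite /r -(ratr_nat R M) ltr_rat.
  apply/seteqP; split => y /=; rewrite in_itv/= andbT /X lt_max lt_min.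
    by move=> /orP[/(le_lt_trans r1)|/andP[]//]; rewrite ltxx.
  by move=> ry; rewrite r2 ry orbT.
rewrite (eq_big_nat _ _ (F2 := fun j => (g (r j.+1) - g (r j)) * h (grid M K j))) in A2; last first.
  by move=> j /andP[_ jK]; rewrite tailE.
rewrite [leRHS](_ : e = (e / 4 + e / 4) + (e / 4 + e / 4)); last by field.
rewrite -(subrKA (g (- M%:R) + \sum_(0 <= j < K) (g (r j.+1) - g (r j)) * h (grid M K j))).
by apply: (le_trans (ler_normD _ _)); apply: lerD; last by rewrite distrC.
Qed.

End bounded_support.

(** Adding C makes F nonnegative, so that Tonelli's theorem applies. *)
Lemma measurable_Rintegral_param d1 d2 (T1 : measurableType d1)
    (T2 : measurableType d2) (R : realType) (P : probability T2 R)
    (F : T1 * T2 -> R) (C : R) :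
  measurable_fun setT F -> (forall z, `|F z| <= C) ->
  measurable_fun setT (fun x => \int[P]_y F (x, y)).
Proof.
move=> mF FC.
have FC0 z : 0 <= F z + C by rewrite addrC -lerBlDl sub0r lerNl (le_trans _ (FC z))// -normrN ler_norm.
have mFC : measurable_fun setT (fun z => (F z + C)%:E).
  by apply/measurable_EFinP; exact: measurable_funD.
have := @measurable_fun_fubini_tonelli_F _ _ T1 T2 R P _ mFC _.
move=> /(_ (fun z => ltac:(by rewrite lee_fin))) /(measurableT_comp (fine_measurable measurableT)).
move=> mI; rewrite (_ : (fun x => _) = (fun x => \int[P]_y (F (x, y) + C) - C)).
  by apply: measurable_funB => //; exact: mI.
apply/funext => x; have Fi : P.-integrable setT (EFin \o (fun y => F (x, y))).
  have PT : (P setT < +oo)%E by rewrite probability_setT ltry.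
  apply: (@integrable_bounded _ _ _ _ _ _ C) => //.
  exact: measurable_fun_pair2.
rewrite RintegralD//; last exact: finite_measure_integrable_cst.
by rewrite Rintegral_cst// (_ : fine (P setT) = 1) ?probability_setT// mulr1 addrK.
Qed.

(** * Translations, boxes and Borel sets of space-time *)

Section measure_preserving.
Local Open Scope ereal_scope.

Definition measure_preserving d (T : measurableType d) (R : realType)
    (m : set T -> \bar R) (s : T -> T) :=
  measurable_fun setT s /\ forall A, measurable A -> m (s @^-1` A) = m A.

Lemma preserving_integral d (T : measurableType d) (R : realType)
    (m : {measure set T -> \bar R}) (s : T -> T) (f : T -> \bar R) :
  measure_preserving m s -> measurable_fun setT f -> (forall x, 0 <= f x) ->
  \int[m]_x f (s x) = \int[m]_x f x.
Proof.
move=> [ms mE] mf f0; rewrite -[LHS](@ge0_integral_pushforward _ _ _ _ _ s ms m setT f)//.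
by apply: eq_measure_integral => A mA _; exact: mE.
Qed.

Lemma preserving_integrable d (T : measurableType d) (R : realType)
    (m : {measure set T -> \bar R}) (s : T -> T) (f : T -> \bar R) :
  measure_preserving m s -> m.-integrable setT f -> m.-integrable setT (f \o s).
Proof.
move=> ps /integrableP[mf fi]; apply/integrableP; split.
  by apply: measurableT_comp => //; case: ps.
rewrite (preserving_integral (f := fun x => `|f x|) ps)//.
exact: measurableT_comp.
Qed.

Lemma preserving_Rintegral d (T : measurableType d) (R : realType)
    (m : {measure set T -> \bar R}) (s : T -> T) (f : T -> R) :
  measure_preserving m s -> m.-integrable setT (EFin \o f) ->
  (\int[m]_x f (s x) = \int[m]_x f x)%R.
Proof.
move=> ps fi; have fsi := preserving_integrable ps fi; have [ms mE] := ps.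
rewrite /Rintegral; congr fine.
have mf : measurable_fun setT (EFin \o f) by case/integrableP : fi.
transitivity (\int[pushforward m s]_x (f x)%:E).
  by rewrite (@integral_pushforward _ _ _ _ _ s ms m setT (EFin \o f) mf).
by apply: eq_measure_integral => A mA _; exact: mE.
Qed.

(** The sections of the preimage of A are preimages of sections of A. *)
Lemma preserving_prod d1 d2 (T1 : measurableType d1) (T2 : measurableType d2)
    (R : realType) (m1 : {sigma_finite_measure set T1 -> \bar R})
    (m2 : {sigma_finite_measure set T2 -> \bar R}) (s1 : T1 -> T1) (s2 : T2 -> T2) :
  measure_preserving m1 s1 -> measure_preserving m2 s2 ->
  measure_preserving (m1 \x m2) (fun z => (s1 z.1, s2 z.2)).
Proof.
move=> p1 p2; have [ms1 m1E] := p1; have [ms2 m2E] := p2; split.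
  by apply: measurable_fun_pair; exact: measurableT_comp.
move=> A mA; rewrite /product_measure1.
have -> : m2 \o xsection ((fun z => (s1 z.1, s2 z.2)) @^-1` A) =
    (m2 \o xsection A) \o s1.
  apply/funext => x /=; rewrite -[RHS]m2E; last exact: measurable_xsection.
  by congr (m2 _); rewrite !xsectionE.
rewrite (preserving_integral (f := m2 \o xsection A) p1)//.
exact: measurable_fun_xsection.
Qed.

Lemma lebesgue_shift (R : realType) (a : R) :
  measure_preserving (@lebesgue_measure R) (fun x : measurableTypeR R => (x + a)%R).
Proof.
have ms : @measurable_fun _ _ (measurableTypeR R) (measurableTypeR R) setT
    (fun x => (x + a)%R).
  exact: measurable_funD.
split=> // A mA.
pose s : {mfun measurableTypeR R >-> measurableTypeR R} :=
  HB.pack (fun x : measurableTypeR R => (x + a)%R)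
    (isMeasurableFun.Build _ _ (measurableTypeR R) (measurableTypeR R) _ ms).
apply/esym; apply: (@lebesgue_measure_unique _ (pushforward (@lebesgue_measure R) s)) => //.
move=> _ [[b c] _ <-].
have pre : (fun x => (x + a)%R) @^-1` `]b, c]%classic = `](b - a)%R, (c - a)%R]%classic.
  by apply/seteqP; split => x /=; rewrite !in_itv/= ltrBlDr lerBrDr.
change (lebesgue_measure `]b, c]%classic =
  lebesgue_measure ((fun x => (x + a)%R) @^-1` `]b, c]%classic)).
rewrite pre.
rewrite !lebesgue_measure_itv/= !lte_fin ltrD2r; case: ifPn => // _.
by rewrite -!EFinB; congr EFin; ring.
Qed.

End measure_preserving.

Section row_vectors.
Context {R : realType}.

Lemma rV0E (x y : 'rV[R]_0) : x = y.
Proof. by apply/rowP => -[]. Qed.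

Lemma cons_rV_ord0 d (p : measurableTypeR R * 'rV[R]_d) : cons_rV p ord0 ord0 = p.1.
Proof. by have /= := congr1 fst (cons_rVK p). Qed.

Lemma cons_rV_lift d (p : measurableTypeR R * 'rV[R]_d) j :
  cons_rV p ord0 (lift ord0 j) = p.2 ord0 j.
Proof. by have := congr1 (fun q : measurableTypeR R * 'rV[R]_d => q.2 ord0 j) (cons_rVK p); rewrite /= mxE. Qed.

Lemma cons_rV_shift d (x : R) (y : 'rV[R]_d) (v : 'rV[R]_d.+1) :
  cons_rV (x, y) + v = cons_rV (x + v ord0 ord0, y + \row_j v ord0 (lift ord0 j)).
Proof.
apply/rowP => j; rewrite mxE; case: (unliftP ord0 j) => [k ->|->].
  by rewrite !cons_rV_lift/= !mxE.
by rewrite !cons_rV_ord0.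
Qed.

Lemma rV_shift d (v : 'rV[R]_d) : measure_preserving (lebesgue_rV d) (fun x => x + v).
Proof.
elim: d v => [|d IH] v.
  rewrite (_ : (fun x => x + v) = id); last by apply/funext => x; exact: rV0E.
  by split => //; exact: measurable_id.
pose v' : 'rV[R]_d := \row_j v ord0 (lift ord0 j).
have ms : measurable_fun setT (fun x : 'rV[R]_d.+1 => x + v).
  apply: measurable_fun_rV => j; under eq_fun do rewrite mxE.
  by apply: measurable_funD => //; exact: measurable_coord_rV.
split => // A mA.
have mcA : measurable (@cons_rV R d @^-1` A).
  by rewrite -[X in measurable X]setTI; exact: measurable_cons_rV.
have [_ E] : measure_preserving (@lebesgue_measure R \x lebesgue_rV d)%E
    (fun z => ((z.1 + v ord0 ord0)%R, z.2 + v')).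
  exact: (preserving_prod (lebesgue_shift _) (IH v')).
transitivity ((@lebesgue_measure R \x lebesgue_rV d)%E (@cons_rV R d @^-1` A)); last by [].
rewrite -E//.
transitivity ((@lebesgue_measure R \x lebesgue_rV d)%E
  (@cons_rV R d @^-1` ((fun x => x + v) @^-1` A))); first by [].
congr (_ _); apply/seteqP.
by split => -[x y]; rewrite /preimage/= cons_rV_shift.
Qed.

Local Notation lebZ d := (lebesgue_rV d \x @lebesgue_measure R)%E.

Lemma space_time_shift d (v : 'rV[R]_d) (s : R) :
  measure_preserving (lebZ d) (fun z => (z.1 + v, z.2 + s)).
Proof. exact: (preserving_prod (rV_shift v) (lebesgue_shift s)). Qed.

Definition cube d (J : R) : set 'rV[R]_d := [set x | forall j, `|x ord0 j| <= J].

Lemma measurable_cube d J : measurable (@cube d J).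
Proof.
rewrite (_ : cube J = \bigcap_(j in [set: 'I_d]) [set x | `|x ord0 j| <= J]); last first.
  by apply/seteqP; split => x /= xJ j; [move=> _|]; exact: xJ.
apply: fin_bigcap_measurable; first exact: finite_finset.
move=> j _; rewrite -[X in measurable X]setTI.
have mj : measurable_fun setT (fun x : 'rV[R]_d => `|x ord0 j| : measurableTypeR R).
  by apply: measurableT_comp => //; exact: measurable_coord_rV.
exact: (measurable_fun_ler mj (measurable_cst
  (J : measurableTypeR R)) measurableT (Y := [set true])).
Qed.

Lemma lebesgue_itv_fin (J : R) : @lebesgue_measure R `[- J, J]%classic \is a fin_num.
Proof. by rewrite lebesgue_measure_itv/=; case: ifPn. Qed.

Lemma cube_finite d J : (lebesgue_rV d (cube J) < +oo)%E.
Proof.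
elim: d => [|d IH].
  by rewrite /= (le_lt_trans (probability_le1 (\d_(0 : 'rV[R]_0)) (measurable_cube J)))// ltry.
rewrite /= /lebesgue_cons_rV /pushforward.
rewrite (_ : _ @^-1` _ = `[- J, J]%classic `*` @cube d J); last first.
  apply/seteqP; split => -[x y]; rewrite /cube/= in_itv/= -ler_norml.
    move=> xyJ; split; first by have := xyJ ord0; rewrite cons_rV_ord0.
    by move=> j; have := xyJ (lift ord0 j); rewrite cons_rV_lift.
  move=> [xJ yJ] j; case: (unliftP ord0 j) => [k ->|->].
    by rewrite cons_rV_lift; exact: yJ.
  by rewrite cons_rV_ord0.
rewrite product_measure1E//; last exact: measurable_cube.
apply: lte_mul_pinfty => //.
exact: lebesgue_itv_fin.
Qed.

Definition box d (J : R) : set ('rV[R]_d * R) := cube J `*` `[- J, J]%classic.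

Lemma measurable_box d J : measurable (@box d J : set ('rV[R]_d * measurableTypeR R)).
Proof. by apply: measurableX; [exact: measurable_cube|exact: measurable_itv]. Qed.

Lemma box_finite d J : (lebZ d (box J) < +oo)%E.
Proof.
rewrite product_measure1E//; last exact: measurable_cube.
rewrite lte_mul_pinfty ?ge0_fin_numE ?cube_finite//.
have := lebesgue_itv_fin J; rewrite ge0_fin_numE//.
Qed.

Definition swap_uncons d (v : 'rV[R]_d.+1) : 'rV[R]_d * R :=
  ((uncons_rV v).2, (uncons_rV v).1).

Lemma continuous_swap_uncons d : continuous (@swap_uncons d).
Proof.
move=> v A /nbhs_ballP[e /= e0 eA]; apply/nbhs_ballP; exists e => //= w [e1 vw].
apply: eA; split; last exact: vw.
by split => // i j; rewrite !mxE; exact: vw.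
Qed.

(** The sigma-algebra of space-time is the product one. Its open sets are measurable
    since space-time is homeomorphic to R^(d+1), whose sigma-algebra is the Borel one. *)
Lemma open_measurable_space_time d (A : set ('rV[R]_d * R)) : open A ->
  measurable (A : set ('rV[R]_d * measurableTypeR R)).
Proof.
move=> oA; have mA : measurable (@swap_uncons d @^-1` A).
  apply: sub_sigma_algebra; have /continuousP := @continuous_swap_uncons d; exact.
have ms : measurable_fun setT
    (fun z : 'rV[R]_d * measurableTypeR R => cons_rV (z.2, z.1)).
  apply: measurableT_comp; first exact: measurable_cons_rV.
  exact: measurable_fun_pair.
rewrite -[X in measurable X]setTI (_ : A = (fun z => cons_rV (z.2, z.1)) @^-1` (@swap_uncons d @^-1` A)).
  exact: ms.
by apply/seteqP; split => -[x t]; rewrite /preimage/= /swap_uncons cons_rVK.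
Qed.

Lemma closed_measurable_space_time d (A : set ('rV[R]_d * R)) : closed A ->
  measurable (A : set ('rV[R]_d * measurableTypeR R)).
Proof.
move=> cA; rewrite -(setCK A); apply: measurableC.
by apply: open_measurable_space_time; exact: closed_openC.
Qed.

Lemma within_continuous_measurable d (D : set ('rV[R]_d * R)) (f : 'rV[R]_d * R -> R) :
  measurable (D : set ('rV[R]_d * measurableTypeR R)) -> {within D, continuous f} ->
  measurable_fun (D : set ('rV[R]_d * measurableTypeR R)) f.
Proof.
move=> mD /continuousP cf; apply: (measurability _ (RGenOpens.measurableE R)) => //.
move=> _ [_ [a [b ->] <-]].
have oU := cf `]a, b[%classic ltac:(exact: interval_open).
have [V oV VD] := (open_subspaceP _ _).1 oU.
rewrite setIC -VD; apply: measurableI => //; exact: open_measurable_space_time.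
Qed.

Lemma compact_box d (K : set ('rV[R]_d * R)) : compact K ->
  exists2 J, 0 <= J & K `<=` box J.
Proof.
move=> /compact_bounded[J [_ KJ]]; exists (`|J| + 1); first by rewrite addr_ge0.
move=> z Kz; have : `|z| <= `|J| + 1 by apply: KJ => //; rewrite ltr_pwDr// ler_norm.
rewrite prod_normE ge_max => /andP[z1 z2]; split; last by rewrite /= in_itv/= -ler_norml.
move=> j; apply: le_trans z1; rewrite (_ : `|z.1| = mx_norm z.1)// mx_normrE.
exact: (le_bigmax _ (fun ij : 'I_1 * 'I_d => `|z.1 ij.1 ij.2|) (ord0, j)).
Qed.

End row_vectors.

(** * Convex entropies and their fluxes *)

Section convex_slopes.
Context {R : realType} (eta : R -> R).
Hypothesis cvx : convex_function (E := R^o) setT eta.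

Let slope x y := (eta y - eta x) / (y - x).

Lemma convex_combination a b c : a < b -> b < c ->
  eta b * (c - a) <= eta a * (c - b) + eta c * (b - a).
Proof.
move=> ab bc; have ac : a < c by exact: lt_trans bc.
have ca0 : 0 < c - a by rewrite subr_gt0.
have t0 : 0 <= (c - b) / (c - a) by rewrite divr_ge0// subr_ge0 ltW.
have t1 : (c - b) / (c - a) <= 1.
  by rewrite ler_pdivrMr// mul1r lerD2l lerN2 ltW.
pose t := (c - b) / (c - a).
have H : eta (t * a + (1 - t) * c) <= t * eta a + (1 - t) * eta c.
  exact: (@cvx (Itv01 t0 t1) a c (mem_setT _) (mem_setT _)).
move: H; have -> : t * a + (1 - t) * c = b by rewrite /t; field; rewrite gt_eqF.
rewrite -(ler_pM2r ca0) => /le_trans; apply.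
by rewrite le_eqVlt; apply/orP; left; apply/eqP; rewrite /t; field; rewrite gt_eqF.
Qed.

Lemma slope_le a b c : a < b -> b < c -> slope a b <= slope b c.
Proof.
move=> ab bc; have H := convex_combination ab bc; have ac := lt_trans ab bc.
rewrite /slope ler_pdivrMr ?subr_gt0// mulrAC ler_pdivlMr ?subr_gt0//.
by lra.
Qed.

(** The right derivative of eta, as the slopes at x decrease when y decreases to x. *)
Definition right_slope x := inf [set slope x y | y in [set y | x < y]].

Let has_inf_slopes x : has_inf [set slope x y | y in [set y | x < y]].
Proof.
split; first by exists (slope x (x + 1)), (x + 1) => //=; rewrite ltrDl.
exists (slope (x - 1) x) => _ [y /= xy <-]; apply: slope_le => //.
by rewrite gtrBl.
Qed.

Lemma right_slope_le x y : x < y -> right_slope x <= slope x y.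
Proof. by move=> xy; apply: ge_inf; [case: (has_inf_slopes x)|exists y]. Qed.

Lemma le_right_slope x y : x < y -> slope x y <= right_slope y.
Proof.
move=> xy; apply: lb_le_inf; first by case: (has_inf_slopes y).
by move=> _ [z /= yz <-]; exact: slope_le.
Qed.

Lemma right_slope_nd : {homo right_slope : x y / x <= y}.
Proof.
move=> x y; rewrite le_eqVlt => /predU1P[->//|xy].
exact: le_trans (right_slope_le xy) (le_right_slope xy).
Qed.

Lemma convex_increment_ge x y : x <= y -> right_slope x * (y - x) <= eta y - eta x.
Proof.
rewrite le_eqVlt => /predU1P[->|xy]; first by rewrite !subrr mulr0.
by rewrite -ler_pdivlMr ?subr_gt0// right_slope_le.
Qed.

Lemma convex_increment_le x y : x <= y -> eta y - eta x <= right_slope y * (y - x).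
Proof.
rewrite le_eqVlt => /predU1P[->|xy]; first by rewrite !subrr mulr0.
by rewrite -ler_pdivrMr ?subr_gt0// le_right_slope.
Qed.

Lemma right_slope_subgradient x y : right_slope x * (y - x) <= eta y - eta x.
Proof.
have [xy|/ltW yx] := leP x y; first exact: convex_increment_ge.
by rewrite -[y - x]opprB mulrN lerNl opprB convex_increment_le.
Qed.

(** The discontinuities of the right slope, stated by a gap so that a rational can be
    chosen inside it. *)
Definition slope_jump : set R := [set x | exists u v, [/\ u < v,
  forall y, y < x -> right_slope y <= u & forall y, x < y -> v <= right_slope y]].

(** The gaps at distinct points are disjoint and each contains a rational. *)
Lemma countable_slope_jump : countable slope_jump.
Proof.
have /choice[r rP] (x : R) : exists r : rat, slope_jump x -> exists u v,
    [/\ u < ratr r < v, forall y, y < x -> right_slope y <= u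
      & forall y, x < y -> v <= right_slope y].
  have [[u [v [uv xu xv]]]|nx] := pselect (slope_jump x); last by exists 0.
  have [r] := rat_in_itvoo uv; rewrite in_itv/= => uvr.
  by exists r => _; exists u, v.
apply/countable_injP; exists (choice.pickle \o r) => x y /[!inE] jx jy /=.
move=> /(pcan_inj choice.pickleK) rxy.
have lt_r a b : slope_jump a -> slope_jump b -> a < b -> r a < r b.
  move=> /rP[u [v [/andP[_ rv] _ av]]] /rP[u' [v' [/andP[ur _] bu _]]] ab.
  have [am mb] := midf_lt ab; rewrite -(ltr_rat R).
  by apply: (lt_le_trans rv); apply: (le_trans (av _ am)); apply: (le_trans (bu _ mb)); exact: ltW.
apply/eqP; rewrite eq_le !leNgt; apply/andP; split; apply/negP.
  by move=> /(lt_r _ _ jy jx); rewrite rxy ltxx.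
by move=> /(lt_r _ _ jx jy); rewrite rxy ltxx.
Qed.

(** Difference quotients at x lie between right slopes at points near x. *)
Lemma derive1_right_slope x : ~ slope_jump x -> derive1 eta x = right_slope x.
Proof.
move=> njx; apply: cvg_lim => //; apply/cvgrPdist_lt => e e0.
have [y1 y1x sy1] : exists2 y, y < x & right_slope x - e < right_slope y.
  apply: contrapT => H; apply: njx; exists (right_slope x - e), (right_slope x).
  split; first by rewrite gtrBl.
    by move=> y yx; rewrite leNgt; apply/negP => ey; apply: H; exists y.
  by move=> y /ltW; exact: right_slope_nd.
have [y2 xy2 sy2] : exists2 y, x < y & right_slope y < right_slope x + e.
  apply: contrapT => H; apply: njx; exists (right_slope x), (right_slope x + e).
  split; first by rewrite ltrDl.
    by move=> y /ltW; exact: right_slope_nd.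
  by move=> y yx; rewrite leNgt; apply/negP => ey; apply: H; exists y.
have d0 : 0 < Num.min (x - y1) (y2 - x) by rewrite lt_min !subr_gt0 y1x.
apply/nbhs_ballP; exists (Num.min (x - y1) (y2 - x)) => //= h.
rewrite /ball/= sub0r normrN lt_min => /andP[h1 h2] h0.
have [hp|hn] := ltrP 0 h.
  have xh : x < h + x by rewrite ltrDr.
  have -> : h^-1 *: (eta (h + x) - eta x) = slope x (h + x).
    by rewrite /slope addrK mulrC.
  rewrite distrC ger0_norm ?subr_ge0 ?right_slope_le// ltrBlDl.
  apply: le_lt_trans sy2; apply: (le_trans (le_right_slope xh)).
  by apply: right_slope_nd; move: h2; rewrite gtr0_norm// ltrBrDr => /ltW.
have {}hn : h < 0 by rewrite lt_neqAle h0.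
have hx : h + x < x by rewrite gtrDr.
have -> : h^-1 *: (eta (h + x) - eta x) = slope (h + x) x.
  by rewrite /slope opprD addrCA subrr addr0 invrN mulrN -mulNr opprB mulrC.
rewrite ger0_norm ?subr_ge0 ?le_right_slope// ltrBlDr -ltrBlDl.
apply: (lt_le_trans sy1); apply: le_trans (right_slope_le hx).
apply: right_slope_nd; move: h1; rewrite ltr0_norm// => h1.
by rewrite -subr_ge0; lra.
Qed.

End convex_slopes.

Lemma lipschitz_continuous (R : realType) (g : R -> R) :
  (forall J, exists L, forall x y, - J <= x -> x <= y -> y <= J ->
     `|g y - g x| <= L * (y - x)) -> continuous g.
Proof.
move=> gL x; have [L gJ] := gL (`|x| + 1).
apply/cvgrPdist_le => e e0.
have L0 : 0 < `|L| + 1 by rewrite ltr_wpDl.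
have d0 : 0 < Num.min 1 (e / (`|L| + 1)) by rewrite lt_min ltr01 divr_gt0.
apply/nbhs_ballP; exists (Num.min 1 (e / (`|L| + 1))) => //= y.
rewrite /ball/= lt_min ltr_pdivlMr// => /andP[xy1 xye].
have nx := ler_norm x; have nx' : - x <= `|x| by rewrite -normrN ler_norm.
have [y1 y2] : - (`|x| + 1) <= y /\ y <= `|x| + 1.
  by move: xy1; rewrite ltr_distl => /andP[]; lra.
have step u v : - (`|x| + 1) <= u -> u <= v -> v <= `|x| + 1 ->
    `|u - v| * (`|L| + 1) < e -> `|g v - g u| <= e.
  move=> u1 uv v1 uve; apply: (le_trans (gJ _ _ u1 uv v1)); apply/ltW.
  apply: le_lt_trans uve; rewrite distrC ger0_norm ?subr_ge0// mulrC.
  apply: ler_wpM2l; first by rewrite subr_ge0.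
  by rewrite (le_trans (ler_norm L))// lerDl.
have [xy|/ltW yx] := leP x y.
  by rewrite distrC; apply: step => //; lra.
by apply: step => //; [lra|rewrite distrC].
Qed.

Section convex_integral.
Context {R : realType} (eta : R -> R).
Hypothesis cvx : convex_function (E := R^o) setT eta.
Local Notation leb := (@lebesgue_measure R).
Local Notation s := (right_slope eta).

Lemma measurable_right_slope : measurable_fun setT s.
Proof. by apply: nondecreasing_measurable => // x y; exact: (right_slope_nd cvx). Qed.

Lemma measurable_derive1_convex : measurable_fun setT (derive1 eta).
Proof.
have cN := countable_slope_jump eta.
have mN : measurable (slope_jump eta) by apply: countable_measurable => // t; exact: measurable_set1.
rewrite -(setvU (slope_jump eta)); apply/measurable_funU => //; first exact: measurableC.
split.
  apply: (eq_measurable_fun s) => [x /[!inE] jx|].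
    by rewrite derive1_right_slope.
  by apply: measurable_funTS; exact: measurable_right_slope.
move=> _ Y mY; apply: countable_measurable => [t|]; first exact: measurable_set1.
exact: sub_countable (subset_card_le (@subIsetl _ _ _)) cN.
Qed.

Lemma integral_derive1_convex (phi : R -> R) a b : measurable_fun setT phi ->
  \int[leb]_(xi in `[a, b]) (derive1 eta xi * phi xi) =
  \int[leb]_(xi in `[a, b]) (s xi * phi xi).
Proof.
move=> mphi; rewrite /Rintegral; congr fine; apply: ae_eq_integral => //.
- apply/measurable_EFinP/measurable_funM; apply: measurable_funTS => //.
  exact: measurable_derive1_convex.
- apply/measurable_EFinP/measurable_funM; apply: measurable_funTS => //.
  exact: measurable_right_slope.
exists (slope_jump eta); split.
- apply: countable_measurable; last exact: countable_slope_jump.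
  by move=> t; exact: measurable_set1.
- by apply: countable_lebesgue_measure0; exact: countable_slope_jump.
- move=> x /= H; apply: contrapT => jx; apply: H => _.
  by rewrite derive1_right_slope.
Qed.

Lemma itv_integrable (g : R -> R) (a b C : R) : measurable_fun setT g ->
  (forall x, a <= x <= b -> `|g x| <= C) -> leb.-integrable `[a, b] (EFin \o g).
Proof.
move=> mg gC.
have Ioo : (leb `[a, b]%classic < +oo)%E.
  by rewrite lebesgue_measure_itv/=; case: ifPn => _ //; rewrite -EFinB ltry.
apply: (@integrable_bounded _ _ _ _ _ _ C) => //; first exact: measurable_funTS.
Qed.

Lemma right_slope_bound a b x : a <= x <= b -> `|s x| <= Num.max `|s a| `|s b|.
Proof.
move=> /andP[/(right_slope_nd cvx) ax /(right_slope_nd cvx) xb].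
rewrite le_max; have [x0|/ltW x0] := leP 0 (s x).
  by rewrite ger0_norm//; apply/orP; right; exact: le_trans xb (ler_norm _).
rewrite ler0_norm//; apply/orP; left; rewrite -[leRHS]normrN.
by apply: le_trans (ler_norm _); rewrite lerN2.
Qed.

Lemma right_slope_integrable a b : leb.-integrable `[a, b] (EFin \o s).
Proof.
apply: itv_integrable (measurable_right_slope) _.
exact: right_slope_bound.
Qed.

Lemma Rintegral_itv_split (g : R -> R) (a b c : R) : a <= b -> b <= c ->
  leb.-integrable `[a, c] (EFin \o g) ->
  \int[leb]_(x in `[a, c]) g x = \int[leb]_(x in `[a, b]) g x + \int[leb]_(x in `[b, c]) g x.
Proof.
move=> ab bc gi; rewrite -[X in _ = _ + X]Rintegral_itv_obnd_cbnd; last first.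
  by apply: integrableS gi => //; apply: subset_itvr; rewrite bnd_simp.
have := Rintegral_itvB gi (x := b); rewrite !bnd_simp => /(_ ab bc) <-.
by rewrite addrC subrK.
Qed.

(** On each of n intervals of length (b - a) / n, the integral of the right slope and
    the increment of eta are both between the length times the end values of the slope.
    The errors telescope to (b - a) (s b - s a) / n. *)
Lemma Rintegral_right_slope a b : a <= b ->
  \int[leb]_(x in `[a, b]) s x = eta b - eta a.
Proof.
move=> ab.
have bound x y : x <= y -> s x * (y - x) <= \int[leb]_(z in `[x, y]) s z <= s y * (y - x).
  move=> xy; have cE c : c * (y - x) = \int[leb]_(z in `[x, y]) c.
    by rewrite Rintegral_itv_cst.
  have ci c : leb.-integrable `[x, y] (EFin \o (fun=> c)).
    by apply: (@itv_integrable _ _ _ `|c|).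
  rewrite !cE; apply/andP; split; apply: le_Rintegral => //;
    (try exact: right_slope_integrable);
    by move=> z /=; rewrite in_itv/= => /andP[xz zy]; exact: (right_slope_nd cvx).
have err k d : 0 <= d -> `|\int[leb]_(x in `[a, a + k%:R * d]) s x - (eta (a + k%:R * d) - eta a)| <=
    d * (s (a + k%:R * d) - s a).
  move=> d0; elim: k => [|k IH].
    by rewrite !mul0r !addr0 !subrr mulr0 set_itv1 Rintegral_set1 subrr normr0.
  have ak : a <= a + k%:R * d by rewrite lerDl mulr_ge0.
  have kk : a + k%:R * d <= a + k.+1%:R * d by rewrite lerD2l ler_wpM2r// ler_nat.
  rewrite (Rintegral_itv_split ak kk); last exact: right_slope_integrable.
  set x := a + k%:R * d in ak kk IH *; set y := a + k.+1%:R * d in kk *.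
  have yx : y - x = d by rewrite /y /x -addn1 natrD; ring.
  have /andP[b1 b2] := bound _ _ kk.
  have e1 := convex_increment_ge cvx kk; have e2 := convex_increment_le cvx kk.
  rewrite yx in b1 b2 e1 e2.
  rewrite (_ : _ - _ = (\int[leb]_(z in `[a, x]) s z - (eta x - eta a)) +
    (\int[leb]_(z in `[x, y]) s z - (eta y - eta x))); last by ring.
  apply: (le_trans (ler_normD _ _)).
  rewrite (_ : d * _ = d * (s x - s a) + d * (s y - s x)); last by ring.
  have gen (A B I E : R) : A * d <= I -> I <= B * d -> A * d <= E -> E <= B * d ->
      `|I - E| <= d * (B - A).
    by move=> *; rewrite ler_norml; lra.
  by apply: lerD => //; exact: gen.
apply/eqP; rewrite -subr_eq0 -normr_le0; apply/ler_addgt0Pr => e e0; rewrite add0r.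
pose n := (Num.truncn ((b - a) * (s b - s a) / e)).+1.
have n0 : 0 < n%:R :> R by rewrite ltr0n.
have := err n ((b - a) / n%:R) ltac:(by rewrite divr_ge0// subr_ge0).
have -> : a + n%:R * ((b - a) / n%:R) = b by field; rewrite gt_eqF.
move=> /le_trans; apply.
rewrite mulrAC ler_pdivrMr// [leRHS]mulrC -ler_pdivrMr// ltW//.
exact: truncnS_gt.
Qed.

(** In the application phi, F and q are the i-th components of f', f and the entropy
    flux, and c is a or - a. *)
Variables (phi F q : R -> R) (M c : R).
Hypothesis cphi : continuous phi.
Hypothesis Fphi : forall a b, a <= b -> F b - F a = \int[leb]_(x in `[a, b]) phi x.
Hypothesis qphi : forall a b, a <= b ->
  q b - q a = \int[leb]_(x in `[a, b]) (derive1 eta x * phi x).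
Hypothesis cphi1 : forall x, - M <= x <= M -> `|c * phi x| <= 1.

Lemma convex_continuous : continuous eta.
Proof.
apply: lipschitz_continuous => J; exists (Num.max `|s (- J)| `|s J|) => x y Jx xy yJ.
have e1 := convex_increment_ge cvx xy; have e2 := convex_increment_le cvx xy.
have := @right_slope_bound (- J) J x; rewrite Jx (le_trans xy yJ) => /(_ isT).
have := @right_slope_bound (- J) J y; rewrite yJ (le_trans Jx xy) => /(_ isT).
rewrite !ler_norml => /andP[a1 a2] /andP[b1 b2].
have yx : 0 <= y - x by rewrite subr_ge0.
have := ler_wpM2r yx a2; have := ler_wpM2r yx b1.
by rewrite mulNr => h1 h2; rewrite (le_trans h1 e1) (le_trans e2 h2).
Qed.

Let mphi : measurable_fun setT phi.
Proof. exact: continuous_measurable_fun. Qed.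

Let phi_integrable a b : leb.-integrable `[a, b] (EFin \o phi).
Proof.
have [C _ phiC] := continuous_itv_bounded a b cphi.
exact: itv_integrable phiC.
Qed.

Let sphi_bound a b : exists2 C, 0 <= C & forall x, a <= x <= b -> `|s x * phi x| <= C.
Proof.
have [C C0 phiC] := continuous_itv_bounded a b cphi.
exists (Num.max `|s a| `|s b| * C).
  by rewrite mulr_ge0// le_max normr_ge0.
by move=> x xab; rewrite normrM ler_pM// ?right_slope_bound// phiC.
Qed.

Let msphi : measurable_fun setT (fun x => s x * phi x).
Proof. by apply: measurable_funM => //; exact: measurable_right_slope. Qed.

Let sphi_integrable a b : leb.-integrable `[a, b] (EFin \o (fun x => s x * phi x)).
Proof. by have [C _ sC] := sphi_bound a b; exact: itv_integrable sC. Qed.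

Lemma entropy_flux_continuous : continuous q.
Proof.
apply: lipschitz_continuous => J; have [C C0 sC] := sphi_bound (- J) J.
exists C => x y Jx xy yJ; rewrite qphi// integral_derive1_convex//.
have xyC z : `[x, y]%classic z -> `|s z * phi z| <= C.
  move=> /=; rewrite in_itv/= => /andP[xz zy]; apply: sC.
  by rewrite (le_trans Jx xz) (le_trans zy yJ).
apply: (le_trans (le_normr_Rintegral _ (sphi_integrable x y))) => //.
rewrite -Rintegral_itv_cst//; apply: le_Rintegral => //; first exact: (integrable_norm (sphi_integrable x y)).
by apply: (@itv_integrable _ _ _ `|C|).
Qed.

(** The right-hand side minus the left-hand side is the integral from w to v of
    (s x - s w) (1 - c phi x). The slope s is nondecreasing and 1 - c phi is nonnegative,
    so this is nonnegative whichever of w and v is the larger one. *)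
Lemma entropy_dissipation w v : - M <= w <= M -> - M <= v <= M ->
  s w * ((v - c * F v) - (w - c * F w)) <=
  (eta v - c * q v) - (eta w - c * q w).
Proof.
move=> wM vM; pose p := s w.
have J k a b : a <= b -> \int[leb]_(x in `[a, b]) (k * ((s x - p) * (1 - c * phi x))) =
    k * ((eta b - eta a) - c * (q b - q a) - p * (b - a) + p * c * (F b - F a)).
  move=> ab; rewrite -Rintegral_right_slope// qphi// integral_derive1_convex// Fphi//.
  rewrite -[b - a]mul1r -Rintegral_itv_cst//.
  have mI : measurable `[a, b]%classic by exact: measurable_itv.
  have i1 : leb.-integrable `[a, b] (EFin \o (fun=> 1)) by apply: (@itv_integrable _ _ _ `|1|).
  have is_ := right_slope_integrable a b.
  have isp := sphi_integrable a b; have ip := phi_integrable a b.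
  have ics : leb.-integrable `[a, b] (EFin \o (fun x => c * (s x * phi x))).
    exact: integrable_scaler.
  have ip1 : leb.-integrable `[a, b] (EFin \o (fun=> p * 1)) by exact: integrable_scaler.
  have ipp : leb.-integrable `[a, b] (EFin \o (fun x => p * c * phi x)).
    exact: integrable_scaler.
  have ib1 : leb.-integrable `[a, b] (EFin \o (fun x => s x - c * (s x * phi x))).
    exact: integrable_subr.
  have ib2 : leb.-integrable `[a, b] (EFin \o (fun x => s x - c * (s x * phi x) - p * 1)).
    exact: integrable_subr.
  have ib3 : leb.-integrable `[a, b]
      (EFin \o (fun x => s x - c * (s x * phi x) - p * 1 + p * c * phi x)).
    exact: integrable_addr.
  rewrite -!RintegralZl// -RintegralB// -RintegralB// -RintegralD// -RintegralZl//.
  by apply: eq_Rintegral => x _; ring.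
have c1 x : - M <= x <= M -> 0 <= 1 - c * phi x.
  by move=> /cphi1; rewrite ler_norml subr_ge0 => /andP[].
have [wv|/ltW vw] := leP w v.
  have : 0 <= \int[leb]_(x in `[w, v]) (1 * ((s x - p) * (1 - c * phi x))).
    apply: Rintegral_ge0 => x /=; rewrite in_itv/= mul1r => /andP[wx xv].
    apply: mulr_ge0; first by rewrite subr_ge0; exact: (right_slope_nd cvx).
    by apply: c1; move: wM vM; lra.
  rewrite J// => H; rewrite -subr_ge0; apply: le_trans H _.
  by rewrite le_eqVlt; apply/orP; left; apply/eqP; rewrite /p; ring.
have : 0 <= \int[leb]_(x in `[v, w]) (-1 * ((s x - p) * (1 - c * phi x))).
  apply: Rintegral_ge0 => x /=; rewrite in_itv/= => /andP[vx xw].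
  rewrite mulrA mulN1r; apply: mulr_ge0.
    by rewrite opprB subr_ge0; exact: (right_slope_nd cvx).
  by apply: c1; move: wM vM; lra.
rewrite J// => H; rewrite -subr_ge0; apply: le_trans H _.
by rewrite le_eqVlt; apply/orP; left; apply/eqP; rewrite /p; ring.
Qed.

End convex_integral.

(** * The Lax-Friedrichs scheme for random fields *)

Section flux.
Context {R : realType} {d : nat} (f : R -> 'rV[R]_d).
Hypothesis hf : C1_flux f.
Local Notation leb := (@lebesgue_measure R).

Lemma C1_flux_coord i : [/\ continuous (fun x => derive1 f x ord0 i),
  continuous (fun x => f x ord0 i) &
  forall a b, a <= b ->
    f b ord0 i - f a ord0 i = \int[leb]_(x in `[a, b]) (derive1 f x ord0 i)].
Proof.
have [df cf] := hf.
have cfi : continuous (fun x => derive1 f x ord0 i).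
  move=> x; apply: (@cvg_comp _ _ _ (derive1 f) (fun v : 'rV[R]_d => v ord0 i)).
    exact: cf.
  exact: coord_continuous.
have dfi x : derivable (fun x => f x ord0 i) x 1.
  by have /derivable_mxP := df x; exact.
have dfiE x : derive1 (fun x => f x ord0 i) x = derive1 f x ord0 i.
  by rewrite !derive1E derive_mx// mxE.
have cont : continuous (fun x => f x ord0 i).
  by move=> x; apply: differentiable_continuous; apply/derivable1_diffP.
split => // a b; rewrite le_eqVlt => /predU1P[->|ab].
  by rewrite subrr set_itv1 Rintegral_set1.
rewrite /Rintegral (@continuous_FTC2 _ _ (fun x => f x ord0 i))//.
- exact: continuous_subspaceT.
- split => //.
  + by apply: cvg_at_right_filter; exact: cont.
  + by apply: cvg_at_left_filter; exact: cont.
Qed.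

(** The number a is the stability constant of the scheme: v -+ a f_i(v) is nondecreasing
    on [- M, M]. *)
Lemma flux_slope_bound (M : R) : exists2 a, 0 < a &
  forall i x, - M <= x <= M -> `|a * derive1 f x ord0 i| <= 1.
Proof.
have /choice[C CP] (i : 'I_d) : exists C, forall x, - M <= x <= M -> `|derive1 f x ord0 i| <= C.
  by have [c _ _] := C1_flux_coord i; have [C _] := continuous_itv_bounded (- M) M c; exists C.
pose S := 1 + \sum_i `|C i|.
have S0 : 0 < S by rewrite ltr_pwDl// sumr_ge0.
exists S^-1; first by rewrite invr_gt0.
move=> i x xM; rewrite normrM gtr0_norm ?invr_gt0// mulrC ler_pdivrMr// mul1r.
apply: (le_trans (CP i x xM)); apply: (le_trans (ler_norm _)).
by rewrite /S (bigD1 i)//= addrCA lerDl addr_ge0// sumr_ge0.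
Qed.

End flux.

Section lax_friedrichs.
Context {R : realType} {d : nat}.
Variables (F : 'I_d -> R -> R) (a h : R).

Definition dir (i : 'I_d) : 'rV[R]_d := delta_mx ord0 i.

(** The average over the 2d+1 points of the stencil. The pair (id, F) gives the scheme
    and an entropy pair gives the right-hand side of its entropy inequality. *)
Definition stencil_mean (G : R -> R) (H : 'I_d -> R -> R) (u : 'rV[R]_d -> R) x : R :=
  (2 * d + 1)%:R^-1 * (G (u x) + \sum_i
    ((G (u (x + h *: dir i)) - a * H i (u (x + h *: dir i))) +
     (G (u (x - h *: dir i)) + a * H i (u (x - h *: dir i))))).

Definition lax_friedrichs := stencil_mean id F.

Lemma stencil_mean_cst G H v x : stencil_mean G H (fun=> v) x = G v.
Proof.
rewrite /stencil_mean (eq_bigr (fun=> 2 * G v)); last by move=> i _; ring.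
rewrite sumr_const card_ord -mulr_natl natrD natrM.
by field; rewrite gt_eqF// ltr_wpDl// mulr_ge0.
Qed.

Variable M : R.
Hypothesis F_lip : forall i v w, - M <= w -> w <= v -> v <= M ->
  `|a * (F i v - F i w)| <= v - w.

(** The functions v -+ a F i v are nondecreasing on [- M, M], so the scheme lies between
    its values at the constants - M and M, which it fixes. *)
Lemma lax_friedrichs_bound u : (forall x, - M <= u x <= M) ->
  forall x, - M <= lax_friedrichs u x <= M.
Proof.
move=> uM x; have N0 : 0 < (2 * d + 1)%:R :> R by rewrite addn1 ltr0n.
have up v (i : 'I_d) : - M <= v <= M ->
    v - a * F i v <= M - a * F i M /\ v + a * F i v <= M + a * F i M.
  move=> /andP[v1 v2]; have := F_lip i v1 v2 (lexx _).
  by rewrite mulrBr ler_norml => /andP[]; lra.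
have lo v (i : 'I_d) : - M <= v <= M ->
    - M - a * F i (- M) <= v - a * F i v /\ - M + a * F i (- M) <= v + a * F i v.
  move=> /andP[v1 v2]; have := F_lip i (lexx _) v1 v2.
  by rewrite mulrBr ler_norml => /andP[]; lra.
rewrite -{1}(stencil_mean_cst id F (- M) x) -{2}(stencil_mean_cst id F M x).
rewrite /lax_friedrichs /stencil_mean !ler_pM2l ?invr_gt0//.
have /andP[u1 u2] := uM x.
apply/andP; split; apply: lerD => //; apply: ler_sum => i _; apply: lerD;
  by [have [] := lo _ i (uM (x + h *: dir i))|have [] := lo _ i (uM (x - h *: dir i))
     |have [] := up _ i (uM (x + h *: dir i))|have [] := up _ i (uM (x - h *: dir i))].
Qed.

(** Compare u with the constant field w, where w is the value produced by the scheme.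
    Each term of the entropy mean grows by at least s w times the growth of the
    corresponding term of the scheme, and the latter add up to zero by choice of w. *)
Lemma lax_friedrichs_entropy (eta : R -> R) (q : 'I_d -> R -> R) (s : R -> R) u :
  (forall x, - M <= u x <= M) ->
  (forall w v, - M <= w <= M -> - M <= v <= M -> s w * (v - w) <= eta v - eta w) ->
  (forall i w v, - M <= w <= M -> - M <= v <= M ->
     s w * ((v - a * F i v) - (w - a * F i w)) <=
     (eta v - a * q i v) - (eta w - a * q i w)) ->
  (forall i w v, - M <= w <= M -> - M <= v <= M ->
     s w * ((v + a * F i v) - (w + a * F i w)) <=
     (eta v + a * q i v) - (eta w + a * q i w)) ->
  forall x, eta (lax_friedrichs u x) <= stencil_mean eta q u x.
Proof.
move=> uM s0 sp sm x; set w := lax_friedrichs u x.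
have wM : - M <= w <= M by exact: lax_friedrichs_bound.
have N0 : 0 <= (2 * d + 1)%:R^-1 :> R by rewrite invr_ge0.
rewrite -(stencil_mean_cst eta q w x) -subr_ge0.
apply: (@le_trans _ _ (s w * (stencil_mean id F u x - stencil_mean id F (fun=> w) x))).
  by rewrite stencil_mean_cst /w/= subrr mulr0.
have E G H : stencil_mean G H u x - stencil_mean G H (fun=> w) x =
    (2 * d + 1)%:R^-1 * ((G (u x) - G w) + \sum_i
      (((G (u (x + h *: dir i)) - a * H i (u (x + h *: dir i))) - (G w - a * H i w)) +
       ((G (u (x - h *: dir i)) + a * H i (u (x - h *: dir i))) - (G w + a * H i w)))).
  rewrite /stencil_mean -mulrBr; congr (_ * _); rewrite opprD addrACA -sumrB.
  by congr (_ + _); apply: eq_bigr => i _; rewrite [in LHS]opprD [in LHS]addrACA.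
rewrite !E mulrCA ler_wpM2l// mulrDr mulr_sumr; apply: lerD; first exact: s0.
apply: ler_sum => i _; rewrite mulrDr; apply: lerD; [exact: sp|exact: sm].
Qed.

End lax_friedrichs.

Lemma measurable_fun_countable_index d1 d2 (T : measurableType d1)
    (T2 : measurableType d2) (k : T -> nat) (G : nat -> T -> T2) :
  (forall n, measurable [set x | k x = n]) ->
  (forall n, measurable_fun setT (G n)) -> measurable_fun setT (fun x => G (k x) x).
Proof.
move=> mk mG; have -> : [set: T] = \bigcup_n [set x | k x = n].
  by apply/seteqP; split => // x _; exists (k x).
apply/measurable_fun_bigcup => // n.
apply: (eq_measurable_fun (G n)); last exact: measurable_funTS.
by move=> x /[!inE]/= ->.
Qed.

Section evolution.
Context {R : realType} {d : nat} dO (Om : measurableType dO) (P : probability Om R).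
Variables (F : 'I_d -> R -> R) (a h M tau : R).
Hypothesis cF : forall i, continuous (F i).
Hypothesis F_lip : forall i v w, - M <= w -> w <= v -> v <= M ->
  `|a * (F i v - F i w)| <= v - w.
Hypothesis tau0 : 0 < tau.
Variable u0 : 'rV[R]_d * Om -> R.
Hypothesis mu0 : measurable_fun setT u0.
Hypothesis u0M : forall p, - M <= u0 p <= M.

Fixpoint evolve m (x : 'rV[R]_d) (w : Om) : R :=
  if m is m'.+1 then lax_friedrichs F a h (fun y => evolve m' y w) x
  else u0 (x, w).

Lemma evolve_bound m x w : - M <= evolve m x w <= M.
Proof.
elim: m x => [|m IH] x /=; first exact: u0M.
by apply: lax_friedrichs_bound => // y; exact: IH.
Qed.

Lemma measurable_evolve m : measurable_fun setT (fun p : 'rV[R]_d * Om => evolve m p.1 p.2).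
Proof.
elim: m => [|m IH] /=; first by apply: (eq_measurable_fun u0) => // -[].
have mshift v : measurable_fun setT (fun p : 'rV[R]_d * Om => evolve m (p.1 + v) p.2).
  have [ms _] := rV_shift v.
  pose sh (p : 'rV[R]_d * Om) := (p.1 + v, p.2).
  have msh : measurable_fun setT sh.
    by apply: measurable_fun_pair => //; exact: (measurableT_comp ms measurable_fst).
  exact: (measurableT_comp IH msh).
have mF i v : measurable_fun setT (fun p : 'rV[R]_d * Om => F i (evolve m (p.1 + v) p.2)).
  by apply: measurableT_comp (mshift v); exact: continuous_measurable_fun.
apply: measurable_funM => //; apply: measurable_funD; first exact: IH.
apply: measurable_sum => i; apply: measurable_funD.
  by apply: measurable_funB => //; exact: measurable_funM.
by apply: measurable_funD => //; exact: measurable_funM.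
Qed.

(** Piecewise constant in time; on t < tau it is the initial data. *)
Definition scheme_solution (z : 'rV[R]_d * R) (w : Om) : R :=
  evolve (Num.truncn (z.2 / tau)) z.1 w.

Lemma scheme_solution_bound z w : - M <= scheme_solution z w <= M.
Proof. exact: evolve_bound. Qed.

Lemma measurable_scheme_solution : measurable_fun setT
  (fun p : ('rV[R]_d * measurableTypeR R) * Om => scheme_solution p.1 p.2).
Proof.
apply: (measurable_fun_countable_index
  (k := fun p : ('rV[R]_d * measurableTypeR R) * Om => Num.truncn (p.1.2 / tau))
  (G := fun m p => evolve m p.1.1 p.2)) => m.
  pose g (p : ('rV[R]_d * measurableTypeR R) * Om) : R := p.1.2 / tau.
  have mg : measurable_fun setT g.
    apply: measurable_funM => //; exact: (measurableT_comp measurable_snd measurable_fst).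
  have mlt c : measurable [set p | g p < c].
    rewrite -[X in measurable X]setTI.
    exact: (measurable_fun_ltr mg (measurable_cst c) measurableT (Y := [set true])).
  case: m => [|m].
    rewrite (_ : [set p | _] = [set p | g p < 1%:R]); first exact: mlt.
    apply/seteqP; split => p /=.
      by move=> pE; rewrite -(truncn_le_nat _ 0) /g pE.
    by rewrite -(truncn_le_nat _ 0) leqn0 => /eqP.
  rewrite (_ : [set p | _] = [set p | g p < m.+2%:R] `\` [set p | g p < m.+1%:R]).
    by apply: measurableD; exact: mlt.
  apply/seteqP; split => p /=.
    by move=> pE; rewrite -!truncn_le_nat /g pE ltnn.
  rewrite -!truncn_le_nat /g => -[pm /negP]; rewrite -ltnNge => mp.
  by apply/eqP; rewrite eqn_leq pm.
pose pr (p : ('rV[R]_d * measurableTypeR R) * Om) := (p.1.1, p.2).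
have mpr : measurable_fun setT pr.
  by apply: measurable_fun_pair => //; exact: (measurableT_comp measurable_fst measurable_fst).
exact: (measurableT_comp (measurable_evolve m) mpr).
Qed.

Lemma scheme_solution_step x t w : 0 <= t ->
  scheme_solution (x, t + tau) w = lax_friedrichs F a h (fun y => scheme_solution (y, t) w) x.
Proof.
move=> t0; rewrite /scheme_solution/=; have -> : (t + tau) / tau = t / tau + 1.
  by field; rewrite gt_eqF.
have tt0 : 0 <= t / tau by rewrite divr_ge0// ltW.
rewrite (_ : Num.truncn (t / tau + 1) = (Num.truncn (t / tau)).+1)//.
apply: truncn_def; have /andP[t1 t2] := truncn_itv tt0.
by rewrite -!natr1 lerD2r ltrD2r t1 natr1.
Qed.

Lemma scheme_solution_init x t w : t < tau -> scheme_solution (x, t) w = u0 (x, w).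
Proof.
move=> tt; rewrite /scheme_solution (_ : Num.truncn _ = 0%N)//.
by apply/eqP; rewrite -leqn0 truncn_le_nat/= ltr_pdivrMr// mul1r.
Qed.

Definition mean (g : R -> R) (z : 'rV[R]_d * R) : R := \int[P]_w g (scheme_solution z w).

Variables (G : R -> R) (H : 'I_d -> R -> R).
Hypothesis cG : continuous G.
Hypothesis cH : forall i, continuous (H i).

Lemma mean_integrable g z : continuous g -> P.-integrable setT (EFin \o (fun w => g (scheme_solution z w))).
Proof.
move=> cg; have [C _ gC] := continuous_itv_bounded (- M) M cg.
have PT : (P setT < +oo)%E by rewrite probability_setT ltry.
apply: (@integrable_bounded _ _ _ _ _ _ C) => //.
  apply: measurableT_comp; first exact: continuous_measurable_fun.
  exact: (@measurable_fun_pair2 _ _ _ _ _ _ _ (z : 'rV[R]_d * measurableTypeR R) measurable_scheme_solution).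
by move=> w _; apply: gC; exact: scheme_solution_bound.
Qed.

Lemma measurable_mean g : continuous g ->
  measurable_fun setT (mean g : 'rV[R]_d * measurableTypeR R -> R).
Proof.
move=> cg; have [C _ gC] := continuous_itv_bounded (- M) M cg.
apply: (@measurable_Rintegral_param _ _ _ _ _ P (fun p => g (scheme_solution p.1 p.2)) C).
  by apply: measurableT_comp measurable_scheme_solution; exact: continuous_measurable_fun.
by move=> p; apply: gC; exact: scheme_solution_bound.
Qed.

Lemma mean_bound g C z : continuous g -> (forall y, - M <= y <= M -> `|g y| <= C) -> `|mean g z| <= C.
Proof.
move=> cg gC; apply: Rintegral_prob_bounded; first exact: mean_integrable.
by move=> w; apply: gC; exact: scheme_solution_bound.
Qed.

(** The expectation of stencil_mean along scheme_solution, by mean_stencilE. *)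
Definition mean_stencil (x : 'rV[R]_d) (t : R) : R :=
  (2 * d + 1)%:R^-1 * (mean G (x, t) + \sum_i
    ((mean G (x + h *: dir i, t) - a * mean (H i) (x + h *: dir i, t)) +
     (mean G (x - h *: dir i, t) + a * mean (H i) (x - h *: dir i, t)))).

Let stencil_integrand x t w := stencil_mean a h G H (fun y => scheme_solution (y, t) w) x.

Lemma mean_stencilE x t : P.-integrable setT (EFin \o stencil_integrand x t) /\
  mean_stencil x t = \int[P]_w stencil_integrand x t w.
Proof.
have mT : measurable [set: Om] by [].
have iG y : P.-integrable setT (EFin \o (fun w => G (scheme_solution (y, t) w))) by exact: mean_integrable.
have iH i y : P.-integrable setT (EFin \o (fun w => H i (scheme_solution (y, t) w))) by exact: mean_integrable.
have iaH i y : P.-integrable setT (EFin \o (fun w => a * H i (scheme_solution (y, t) w))) by exact: integrable_scaler.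
have ip i y : P.-integrable setT (EFin \o (fun w => G (scheme_solution (y, t) w) - a * H i (scheme_solution (y, t) w))).
  exact: integrable_subr.
have im i y : P.-integrable setT (EFin \o (fun w => G (scheme_solution (y, t) w) + a * H i (scheme_solution (y, t) w))).
  exact: integrable_addr.
pose S i w := (G (scheme_solution (x + h *: dir i, t) w) - a * H i (scheme_solution (x + h *: dir i, t) w)) +
  (G (scheme_solution (x - h *: dir i, t) w) + a * H i (scheme_solution (x - h *: dir i, t) w)).
have iS i : P.-integrable setT (EFin \o S i) by exact: integrable_addr.
have isum : P.-integrable setT (EFin \o (fun w => \sum_i S i w)) by exact: integrable_sumr.
have itot : P.-integrable setT (EFin \o (fun w => G (scheme_solution (x, t) w) + \sum_i S i w)).
  exact: integrable_addr.
split; first exact: integrable_scaler.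
rewrite /stencil_integrand /stencil_mean RintegralZl// RintegralD// Rintegral_sumr//.
congr (_ * (_ + _)); apply: eq_bigr => i _.
by rewrite RintegralD// RintegralB// RintegralD// !RintegralZl.
Qed.

Lemma mean_entropy x t : 0 <= t ->
  (forall u, (forall y, - M <= u y <= M) ->
     G (lax_friedrichs F a h u x) <= stencil_mean a h G H u x) ->
  mean G (x, t + tau) <= mean_stencil x t.
Proof.
move=> t0 GH; have [si ->] := mean_stencilE x t.
apply: le_Rintegral => //; first exact: mean_integrable.
move=> w _; rewrite scheme_solution_step//; apply: GH => y; exact: scheme_solution_bound.
Qed.

Lemma mean_conservation x t : 0 <= t ->
  (forall u, G (lax_friedrichs F a h u x) = stencil_mean a h G H u x) ->
  mean G (x, t + tau) = mean_stencil x t.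
Proof.
move=> t0 GH; have [_ ->] := mean_stencilE x t.
by apply: eq_Rintegral => w _; rewrite scheme_solution_step// GH.
Qed.

End evolution.

(** * Difference quotients of test functions *)

Section half_line.
Context {R : realType} (g g' : R -> R).
Hypothesis gg' : forall t, 0 <= t ->
  (s - t)^-1 * (g s - g t) @[s --> within [set s | 0 <= s] t^'] --> g' t.

Lemma half_line_quotient t e : 0 <= t -> 0 < e -> exists2 del, 0 < del &
  forall s, 0 <= s -> s != t -> `|t - s| < del -> `|g' t - (s - t)^-1 * (g s - g t)| <= e.
Proof.
move=> t0 e0; have /cvgrPdist_le/(_ _ e0) := gg' t0.
by move=> /nbhs_ballP[del /= del0 H]; exists del => // s s0 st ts; exact: H.
Qed.

Lemma half_line_continuous t e : 0 <= t -> 0 < e -> exists2 del, 0 < del &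
  forall s, 0 <= s -> `|t - s| < del -> `|g t - g s| <= e.
Proof.
move=> t0 e0; have [del del0 H] := half_line_quotient t0 ltr01.
have C0 : 0 < `|g' t| + 1 by rewrite ltr_wpDl.
exists (Num.min del (e / (`|g' t| + 1))); first by rewrite lt_min del0 divr_gt0.
move=> s s0; rewrite lt_min => /andP[s1 s2].
have [->|st] := eqVneq s t; first by rewrite subrr normr0 ltW.
have st0 : s - t != 0 by rewrite subr_eq0.
have -> : g t - g s = - ((s - t) * ((s - t)^-1 * (g s - g t))) by rewrite mulVKf// opprB.
rewrite normrN normrM; apply: (@le_trans _ _ (`|t - s| * (`|g' t| + 1))).
  rewrite distrC ler_wpM2l//; set Q := (_ ^-1 * _).
  rewrite (_ : Q = g' t - (g' t - Q)); last by ring.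
  by rewrite (le_trans (ler_normB _ _))// lerD2l; exact: H.
by rewrite -ler_pdivlMr// ltW.
Qed.

(** The hypothesis on quotients gives two-sided derivatives inside the half line and
    continuity up to its end point, as the mean value theorem requires. *)
Lemma half_line_lipschitz L s t : (forall r, 0 <= r -> `|g' r| <= L) ->
  0 <= s -> s <= t -> `|g t - g s| <= L * (t - s).
Proof.
move=> gL s0; rewrite le_eqVlt => /predU1P[->|st]; first by rewrite !subrr normr0 mulr0.
have [||c] := @MVT R g g' s t st.
- move=> x; rewrite in_itv/= => /andP[sx xt]; have x0 : 0 < x by exact: le_lt_trans sx.
  have lim : h^-1 *: (g (h *: 1 + x) - g x) @[h --> 0^'] --> g' x.
    apply/cvgrPdist_le => e e0; have [del del0 H] := half_line_quotient (ltW x0) e0.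
    have d0 : 0 < Num.min del x by rewrite lt_min del0.
    apply/nbhs_ballP; exists (Num.min del x) => //= h.
    rewrite /ball/= sub0r normrN lt_min => /andP[h1 h2] h0.
    have := H (h + x); rewrite addrK => H'.
    rewrite /GRing.scale/= mulr1; apply: H'.
    + by move: h2; rewrite ltr_norml => /andP[h2 _]; rewrite -lerBlDr sub0r ltW.
    + by rewrite -subr_eq0 addrK.
    + by rewrite opprD addrCA subrr addr0 normrN.
  by apply: DeriveDef; [exact: cvgP lim|exact: cvg_lim lim].
- apply/subspace_continuousP => x /=; rewrite in_itv/= => /andP[sx xt].
  apply/cvgrPdist_le => e e0.
  have [del del0 H] := half_line_continuous (le_trans s0 sx) e0.
  apply/nbhs_ballP; exists del => //= y xy; rewrite in_itv/= => /andP[sy _].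
  by apply: H => //; exact: le_trans sy.
rewrite in_itv/= => /andP[sc _] ->.
rewrite normrM [X in _ * X]ger0_norm ?subr_ge0 ?(ltW st)//.
by rewrite ler_wpM2r ?subr_ge0 ?(ltW st)// gL// (le_trans s0)// ltW.
Qed.

Lemma half_line_backward_quotient t (tau : nat -> R) : 0 < t ->
  (forall n, 0 < tau n) -> tau n @[n --> \oo] --> 0 ->
  (tau n)^-1 * (g t - g (t - tau n)) @[n --> \oo] --> g' t.
Proof.
move=> t0 tau0 tauc; apply/cvgrPdist_le => e e0.
have [del del0 H] := half_line_quotient (ltW t0) e0.
have d0 : 0 < Num.min del t by rewrite lt_min del0.
have /cvgrPdist_lt/(_ _ d0) := tauc; apply: filterS => n.
rewrite sub0r normrN gtr0_norm// lt_min => /andP[n1 n2].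
have tt : t - tau n - t = - tau n by ring.
have -> : (tau n)^-1 * (g t - g (t - tau n)) =
    (t - tau n - t)^-1 * (g (t - tau n) - g t).
  by rewrite tt invrN mulNr -mulrN opprB.
apply: H.
- by rewrite subr_ge0 ltW.
- by rewrite -subr_eq0 tt oppr_eq0 gt_eqF.
- by rewrite opprB addrCA subrr addr0 gtr0_norm.
Qed.

End half_line.

Section line.
Context {R : realType} {V : normedModType R} (g : V -> R) (g' : V -> R) (v : V).
Hypothesis gg' : forall x, is_derive x v g (g' x).

Let line_derive x (r : R) : is_derive r (1 : R) (fun r : R => g (x + r *: v)) (g' (x + r *: v)).
Proof.
have [gd gE] := gg' (x + r *: v).
have lim : h^-1 *: (g (x + (h *: 1 + r) *: v) - g (x + r *: v)) @[h --> 0^'] --> g' (x + r *: v).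
  rewrite -gE; apply: cvg_trans gd; apply: near_eq_cvg; apply: nearW => h.
  have -> : h *: (1 : R) + r = h + r by rewrite /GRing.scale/= mulr1.
  by rewrite /= scalerDl addrCA.
by apply: DeriveDef; [exact: cvgP lim|exact: cvg_lim lim].
Qed.

Lemma line_lipschitz L x h : (forall x, `|g' x| <= L) ->
  `|g (x + h *: v) - g x| <= L * `|h|.
Proof.
move=> gL.
have seg a b : a <= b -> `|g (x + b *: v) - g (x + a *: v)| <= L * (b - a).
  move=> ab; have [||c _ ->] := @MVT_segment R (fun r => g (x + r *: v)) (fun r => g' (x + r *: v)) a b ab.
  - by move=> r _; exact: line_derive.
  - apply: continuous_subspaceT => r; apply: differentiable_continuous.
    by apply/derivable1_diffP; have [] := line_derive x r.
  rewrite normrM [X in _ * X]ger0_norm ?subr_ge0//.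
  by rewrite ler_wpM2r ?subr_ge0.
have [h0|/ltW h0] := leP 0 h.
  by have := seg 0 h h0; rewrite scale0r addr0 subr0 (ger0_norm h0).
by have := seg h 0 h0; rewrite scale0r addr0 sub0r distrC (ler0_norm h0).
Qed.

Lemma line_quotient x (h : nat -> R) : (forall n, h n != 0) ->
  h n @[n --> \oo] --> 0 ->
  (h n)^-1 * (g (x + h n *: v) - g x) @[n --> \oo] --> g' x.
Proof.
move=> h0 hc; have [gd gE] := gg' x.
have lim : k^-1 *: (g (k *: v + x) - g x) @[k --> 0^'] --> g' x by rewrite -gE.
apply/cvgrPdist_le => e e0; have /cvgrPdist_le/(_ _ e0)/nbhs_ballP[del /= del0 H] := lim.
have /cvgrPdist_lt/(_ _ del0) := hc; apply: filterS => n hn.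
by have := H (h n) hn (h0 n); rewrite /= [h n *: v + x]addrC.
Qed.

End line.

Section L1_limit.
Context {R : realType} {d : nat}.
Local Notation lebZ := (lebesgue_rV d \x @lebesgue_measure R)%E.
Local Notation Z := ('rV[R]_d * measurableTypeR R)%type.

Lemma box_integrable (g : 'rV[R]_d * R -> R) C J :
  measurable_fun setT (g : Z -> R) -> (forall z, `|g z| <= C) ->
  (forall z, ~ box J z -> g z = 0) -> lebZ.-integrable setT (EFin \o g).
Proof.
move=> mg gC g0; have mB : measurable (box J : set Z) by exact: measurable_box.
have gi : lebZ.-integrable (box J) (EFin \o g).
  apply: (@integrable_bounded _ _ _ _ _ _ C) => //; first exact: box_finite.
  exact: measurable_funTS.
rewrite (_ : EFin \o g = (EFin \o g) \_ (box J)); first exact/(integrable_mkcond _ mB).1.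
apply/funext => z; rewrite patchE; case: ifPn => //; rewrite notin_setE /= => zJ.
by rewrite g0.
Qed.

(** Dominated convergence, with a multiple of the indicator of the box. *)
Lemma box_L1_limit (g_ : nat -> 'rV[R]_d * R -> R) (g : 'rV[R]_d * R -> R) C J :
  (forall n, measurable_fun setT (g_ n : Z -> R)) ->
  (forall z, g_ ^~ z @ \oo --> g z) ->
  (forall n z, `|g_ n z| <= C) -> (forall n z, ~ box J z -> g_ n z = 0) ->
  [/\ forall n, lebZ.-integrable setT (EFin \o g_ n),
    lebZ.-integrable setT (EFin \o g) &
    \int[lebZ]_z `|g_ n z - g z| @[n --> \oo] --> 0].
Proof.
move=> mg_ gg gC g0.
have mg : measurable_fun setT (g : Z -> R).
  by apply: (@measurable_fun_cvg _ _ _ _ (fun n => g_ n : Z -> R)) => // z _; exact: gg.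
have mB : measurable (box J : set Z) by exact: measurable_box.
have C0 : 0 <= C by exact: le_trans (normr_ge0 _) (gC 0%N (0, 0)).
pose G (z : Z) : R := C * \1_(box J) z.
have Gi : lebZ.-integrable setT (EFin \o G).
  apply: (@box_integrable _ C J).
  - by apply: measurable_funM => //; exact: measurable_indic.
  - move=> z; rewrite /G indicE; case: (z \in _); rewrite ?mulr1 ?mulr0 ?normr0//.
    by rewrite ger0_norm.
  - by move=> z zJ; rewrite /G indicE memNset// mulr0.
have [] := @Rintegral_dominated _ _ _ lebZ setT (fun n => g_ n : Z -> R) g G measurableT mg_ mg.
- by move=> z _; exact: gg.
- exact: Gi.
- move=> n z _; rewrite /G indicE; have [zJ|zJ] := pselect (box J z).
    by rewrite mem_set// mulr1.
  by rewrite memNset// mulr0 g0// normr0.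
move=> gi gL _; split => // n; exact: (box_integrable (mg_ n) (gC n) (g0 n)).
Qed.

Lemma box_notin J B (x v : 'rV[R]_d) t s : (forall j, `|v ord0 j| <= B) -> `|s| <= B ->
  ~ box (J + B) (x, t) -> ~ box J (x + v, t + s).
Proof.
move=> vB sB xt [/= xv]; rewrite in_itv/= -ler_norml => ts; apply: xt; split => /=.
  move=> j; have := xv j; rewrite mxE => xvj.
  rewrite (_ : x ord0 j = (x ord0 j + v ord0 j) - v ord0 j); last by rewrite addrK.
  exact: le_trans (ler_normB _ _) (lerD xvj (vB j)).
rewrite in_itv/= -ler_norml (_ : t = (t + s) - s); last by rewrite addrK.
exact: le_trans (ler_normB _ _) (lerD ts sB).
Qed.

Lemma dir_bound i (h : R) j : `|(h *: dir i : 'rV[R]_d) ord0 j| <= `|h|.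
Proof.
rewrite /dir !mxE eqxx/= normrM ler_piMr//.
by case: (j == i); rewrite ?normr1 ?normr0.
Qed.

End L1_limit.

Section test_function.
Context {R : realType} {d : nat}.
Local Notation lebZ := (lebesgue_rV d \x @lebesgue_measure R)%E.
Local Notation Z := ('rV[R]_d * measurableTypeR R)%type.
Variables (phi phi_t : 'rV[R]_d * R -> R) (phi_x : 'rV[R]_d * R -> 'rV[R]_d).
Hypothesis hphi : C1c_half_space phi phi_t phi_x.

Let half_spaceE (z : 'rV[R]_d * R) : half_space z <-> 0 <= z.2.
Proof. by rewrite /half_space; split => [[_]|z0]; [|split => //]; rewrite /= in_itv/= andbT. Qed.

Lemma test_support : exists2 J, 0 <= J & forall z, 0 <= z.2 -> ~ box J z -> phi z = 0.
Proof.
have [_ _ _ _ /compact_box[J J0 KJ]] := hphi; exists J => // z z0 zJ.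
apply: contrapT => pz; apply: zJ; apply: KJ; apply: subset_closure; split.
  exact/half_spaceE.
exact/eqP.
Qed.

Let dphi_t x t : 0 <= t ->
  (s - t)^-1 * (phi (x, s) - phi (x, t)) @[s --> within [set s | 0 <= s] t^'] --> phi_t (x, t).
Proof. by case: hphi => _ _ + _ _; exact. Qed.

Let dphi_x t i : 0 <= t ->
  forall x, is_derive x (dir i) (fun y => phi (y, t)) (phi_x (x, t) ord0 i).
Proof. by case: hphi => _ _ _ + _ t0 x; exact. Qed.

(** Increasing the time keeps a point of the half space outside of the box. *)
Lemma test_t_support J z : (forall z, 0 <= z.2 -> ~ box J z -> phi z = 0) ->
  0 <= z.2 -> ~ box J z -> phi_t z = 0.
Proof.
case: z => x t /= pJ t0 xt; apply/eqP; rewrite -normr_le0; apply/ler_addgt0Pr => e e0.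
rewrite add0r; have [del del0 H] := half_line_quotient (@dphi_t x) t0 e0.
have s0 : 0 <= t + del / 2 by rewrite addr_ge0// divr_ge0// ltW.
have := H (t + del / 2) s0; rewrite pJ// ?pJ//.
  rewrite subrr mulr0 subr0; apply.
    by rewrite -subr_eq0 addrAC subrr add0r gt_eqF// divr_gt0.
  rewrite opprD addNKr normrN gtr0_norm ?divr_gt0//.
  by rewrite ltr_pdivrMr// ltr_pMr// ltr1n.
move=> [/= xJ]; rewrite in_itv/= -ler_norml ger0_norm// => tJ; apply: xt.
split => //=; rewrite in_itv/= -ler_norml ger0_norm//; apply: le_trans tJ.
by rewrite lerDl divr_ge0// ltW.
Qed.

(** Moving x so that its i-th coordinate grows in absolute value keeps the point outside
    of the box. *)
Lemma test_x_support J z i : (forall z, 0 <= z.2 -> ~ box J z -> phi z = 0) ->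
  0 <= z.2 -> ~ box J z -> phi_x z ord0 i = 0.
Proof.
case: z => x t /= pJ t0 xt.
(* The sign of the i-th coordinate, so that the displacements h n increase its modulus. *)
pose sg : R := if 0 <= x ord0 i then 1 else -1.
pose h n : R := sg * n.+1%:R^-1.
have sg0 : sg != 0 by rewrite /sg; case: ifP; rewrite ?oppr_eq0 oner_eq0.
have h0 n : h n != 0 by rewrite mulf_neq0// invr_neq0.
have hc : h n @[n --> \oo] --> 0.
  by rewrite -[X in _ --> X](mulr0 sg); apply: cvgMr; exact: cvg_harmonic.
have := @line_quotient _ _ _ _ _ (@dphi_x t i t0) x h h0 hc.
rewrite (_ : (fun n => _) = cst 0); first by move=> /cvg_lim <- //; rewrite lim_cst.
apply/funext => n; rewrite !pJ//= ?subrr ?mulr0// => -[/= xJ tJ]; apply: xt.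
split => //= j; apply: le_trans (xJ j); rewrite !mxE eqxx/=.
have [->|ji] := eqVneq j i; last by rewrite mulr0 addr0.
rewrite mulr1 /h /sg; case: ifPn => [x0|]; last first.
  rewrite -ltNge => x0; rewrite mulN1r !ltr0_norm// ?lerN2 ?gerBl ?invr_ge0//.
  by rewrite subr_lt0 (lt_trans x0) ?invr_gt0.
by rewrite mul1r !ger0_norm ?lerDl ?invr_ge0// addr_ge0// invr_ge0.
Qed.

Lemma within_half_bounded (g : 'rV[R]_d * R -> R) J :
  {within half_space, continuous g} ->
  (forall z, 0 <= z.2 -> ~ box J z -> g z = 0) ->
  exists2 L, 0 <= L & forall z, 0 <= z.2 -> `|g z| <= L.
Proof.
move=> cg gJ; pose K : set ('rV[R]_d * R) := cube J `*` `[0, J]%classic.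
have cK : compact K.
  apply: compact_setX; last exact: segment_compact.
  rewrite (_ : cube J = [set v : 'rV[R]_d | forall i, `[- J, J]%classic (v ord0 i)]).
    by apply: (@rV_compact R d (fun=> `[- J, J]%classic)) => i; exact: segment_compact.
  by apply/seteqP; split => v vJ i /=; have := vJ i; rewrite /= in_itv/= -ler_norml.
have : compact (g @` K).
  apply: continuous_compact cK; apply: continuous_subspaceW cg => -[x t] [_ /=].
  by rewrite in_itv/= => /andP[t0 _]; exact/half_spaceE.
move=> /compact_bounded[L [_ LP]]; exists (`|L| + 1); first by rewrite addr_ge0.
move=> z z0; have [zJ|zJ] := pselect (box J z); last by rewrite gJ// normr0 addr_ge0.
apply: (LP (`|L| + 1)); first by rewrite ltr_pwDr// ler_norm.
exists z => //; case: zJ => z1 z2; split => //; move: z2 z0; rewrite /= !in_itv/=.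
by move=> /andP[_ ->] ->.
Qed.

(** Shifts in time leave the half space, outside of which a test function has arbitrary
    values; there it is replaced by zero. *)
Definition zero_ext (g : 'rV[R]_d * R -> R) (z : 'rV[R]_d * R) := if 0 <= z.2 then g z else 0.

Lemma measurable_zero_ext (g : 'rV[R]_d * R -> R) : {within half_space, continuous g} ->
  measurable_fun setT (zero_ext g : Z -> R).
Proof.
move=> cg.
have mH : measurable (half_space : set Z).
  by apply: measurableX => //; exact: measurable_itv.
have /(measurable_restrictT _ mH).1 := within_continuous_measurable mH cg.
apply: eq_measurable_fun => z _; rewrite patchE /zero_ext.
by case: ifPn => [/set_mem/half_spaceE ->//|/negP zH]; case: ifPn => // /half_spaceE/mem_set/zH.
Qed.

Lemma measurable_shift (g : 'rV[R]_d * R -> R) v s : measurable_fun setT (g : Z -> R) ->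
  measurable_fun setT (fun z : Z => g (z.1 + v, z.2 + s)).
Proof. by move=> mg; have [ms _] := space_time_shift v s; exact: (measurableT_comp mg ms). Qed.

Lemma measurable_time_le (s : R) : measurable_fun setT (fun z : Z => s <= z.2).
Proof.
apply: measurable_fun_ler => //; exact: (measurable_snd : measurable_fun setT (snd : Z -> _)).
Qed.

Lemma measurable_time_lt (s : R) : measurable_fun setT (fun z : Z => z.2 < s).
Proof.
apply: measurable_fun_ltr => //; exact: (measurable_snd : measurable_fun setT (snd : Z -> _)).
Qed.

Let cphi : {within half_space, continuous phi}. Proof. by case: hphi. Qed.
Let cphi_t : {within half_space, continuous phi_t}. Proof. by case: hphi => _ []. Qed.
Let cphi_x i : {within half_space, continuous (fun z => phi_x z ord0 i)}.
Proof.
case: hphi => _ [_ cx] _ _ _ z.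
apply: (@cvg_comp _ _ _ phi_x (fun v : 'rV[R]_d => v ord0 i)); first exact: cx.
exact: coord_continuous.
Qed.

Let bounds : exists J L, [/\ 0 <= J, 0 <= L,
  forall z, 0 <= z.2 -> ~ box J z -> phi z = 0,
  forall z, 0 <= z.2 -> `|phi_t z| <= L &
  forall i z, 0 <= z.2 -> `|phi_x z ord0 i| <= L].
Proof.
have [J J0 pJ] := test_support.
have [Lt Lt0 tL] := within_half_bounded cphi_t (fun z => @test_t_support J z pJ).
have /choice[Lx xL] (i : 'I_d) : exists L, 0 <= L /\ forall z, 0 <= z.2 -> `|phi_x z ord0 i| <= L.
  have [L L0 HL] := within_half_bounded (@cphi_x i) (fun z => @test_x_support J z i pJ).
  by exists L.
have S0 : 0 <= \sum_i Lx i by apply: sumr_ge0 => i _; case: (xL i).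
exists J, (Lt + \sum_i Lx i); split => //; first exact: addr_ge0.
  by move=> z z0; apply: (le_trans (tL z z0)); rewrite lerDl.
move=> i z z0; have [_ /(_ z z0) /le_trans] := xL i; apply.
rewrite (bigD1 i)//= addrCA lerDl addr_ge0// sumr_ge0// => j _.
by case: (xL j).
Qed.

(** The backward difference quotient of zero_ext phi is phi / tau on the layer
    0 <= t < tau, and therefore unbounded as tau decreases. This is its remaining part;
    the layer is treated by initial_layer and initial_term. *)
Definition time_quotient (tau : R) (z : 'rV[R]_d * R) : R :=
  if tau <= z.2 then tau^-1 * (phi z - phi (z.1, z.2 - tau)) else 0.

Definition space_quotient i (h : R) (z : 'rV[R]_d * R) : R :=
  h^-1 * (zero_ext phi (z.1 + h *: dir i, z.2) - zero_ext phi z).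

(** The difference to phi (x, 0) is at most tau times the bound of phi_t, so that this
    term is bounded, on a layer of vanishing width. *)
Definition initial_layer (tau : R) (z : 'rV[R]_d * R) : R :=
  if (0 <= z.2) && (z.2 < tau) then tau^-1 * (phi z - phi (z.1, 0)) else 0.

Variables (B : R) (tau : nat -> R).
Hypothesis tau0 : forall n, 0 < tau n.
Hypothesis tauB : forall n, tau n <= B.
Hypothesis tauc : tau n @[n --> \oo] --> 0.

Lemma time_quotient_L1 :
  [/\ forall n, lebZ.-integrable setT (EFin \o time_quotient (tau n)),
    lebZ.-integrable setT (EFin \o (fun z => if 0 < z.2 then phi_t z else 0)) &
    \int[lebZ]_z `|time_quotient (tau n) z - (if 0 < z.2 then phi_t z else 0)| @[n --> \oo] --> 0].
Proof.
have [J [L [J0 L0 pJ tL _]]] := bounds.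
apply: (@box_L1_limit _ _ _ _ L (J + B)).
- move=> n; apply: (eq_measurable_fun (fun z : Z => if tau n <= z.2 then
      (tau n)^-1 * (zero_ext phi z - zero_ext phi (z.1 + 0, z.2 + - tau n)) else 0)).
    move=> z _; rewrite /time_quotient /zero_ext/= addr0; case: ifPn => // tz.
    by rewrite (le_trans (ltW (tau0 n)) tz) subr_ge0 tz.
  apply: measurable_fun_ifT => //; first exact: measurable_time_le.
  apply: measurable_funM => //; apply: measurable_funB.
    exact: measurable_zero_ext.
  by apply: measurable_shift; exact: measurable_zero_ext.
- move=> -[x t]; rewrite /time_quotient/=; have [t0|t0] := ltP 0 t; last first.
    apply: cvg_near_cst; apply: nearW => n; rewrite leNgt.
    by rewrite (le_lt_trans t0 (tau0 n)).
  have := @half_line_backward_quotient _ _ _ (@dphi_t x) t tau t0 tau0 tauc.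
  apply: cvg_trans; apply: near_eq_cvg.
  have /cvgrPdist_lt/(_ _ t0) := tauc; apply: filterS => n.
  by rewrite sub0r normrN gtr0_norm// => /ltW ->.
- move=> n [x t]; rewrite /time_quotient/=; case: ifPn => [tt|]; last by rewrite normr0.
  rewrite normrM gtr0_norm ?invr_gt0// ler_pdivrMl// mulrC.
  have tt0 : 0 <= t - tau n by rewrite subr_ge0.
  have := @half_line_lipschitz _ _ _ (@dphi_t x) L _ t (fun r r0 => tL (x, r) r0) tt0.
  by rewrite gerBl opprB addrCA subrr addr0; apply; exact: ltW.
- move=> n [x t] xt; rewrite /time_quotient/=; case: ifPn => // tt.
  have t0 : 0 <= t by exact: le_trans (ltW (tau0 n)) tt.
  have B0 : 0 <= B by exact: le_trans (ltW (tau0 n)) (tauB n).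
  rewrite !pJ ?subrr ?mulr0//= ?subr_ge0//.
    rewrite -[x]addr0; apply: (box_notin (B := B)) => //.
      by move=> j; rewrite mxE normr0.
    by rewrite normrN gtr0_norm.
  rewrite -[x]addr0 -[t]addr0; apply: (box_notin (B := B)) => //.
    by move=> j; rewrite mxE normr0.
  by rewrite normr0.
Qed.

Lemma initial_layer_L1 :
  [/\ forall n, lebZ.-integrable setT (EFin \o initial_layer (tau n)),
    lebZ.-integrable setT (EFin \o cst 0) &
    \int[lebZ]_z `|initial_layer (tau n) z - cst 0 z| @[n --> \oo] --> 0].
Proof.
have [J [L [J0 L0 pJ tL _]]] := bounds.
apply: (@box_L1_limit _ _ _ _ L (J + B)).
- move=> n; apply: (eq_measurable_fun (fun z : Z => if (0 <= z.2) && (z.2 < tau n) then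
      (tau n)^-1 * (zero_ext phi z - zero_ext phi (z.1, 0)) else 0)).
    by move=> z _; rewrite /initial_layer /zero_ext/= lexx; case: ifPn => // /andP[-> _].
  apply: measurable_fun_ifT => //.
    by apply: measurable_and; [exact: measurable_time_le|exact: measurable_time_lt].
  apply: measurable_funM => //; apply: measurable_funB.
    exact: measurable_zero_ext.
  have m0 : measurable_fun setT (fun z : Z => (z.1, 0 : measurableTypeR R)).
    exact: measurable_fun_pair.
  exact: (measurableT_comp (measurable_zero_ext cphi) m0).
- move=> -[x t]; rewrite /initial_layer/=; have [t0|t0] := ltP t 0.
    by apply: cvg_near_cst; apply: nearW.
  have [->|tn0] := eqVneq t 0.
    by apply: cvg_near_cst; apply: nearW => n; rewrite subrr mulr0; case: ifP.
  have {tn0}t0 : 0 < t by rewrite lt_neqAle eq_sym tn0.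
  apply: cvg_near_cst; have /cvgrPdist_lt/(_ _ t0) := tauc; apply: filterS => n.
  by rewrite sub0r normrN gtr0_norm// => tt; rewrite [X in _ && X]ltNge (ltW tt) andbF.
- move=> n [x t]; rewrite /initial_layer/=; case: ifPn => [/andP[t0 tt]|]; last by rewrite normr0.
  rewrite normrM gtr0_norm ?invr_gt0// ler_pdivrMl// mulrC.
  have := @half_line_lipschitz _ _ _ (@dphi_t x) L 0 t (fun r r0 => tL (x, r) r0) (lexx _) t0.
  by move=> /le_trans; apply; rewrite subr0 ler_wpM2l// ltW.
- move=> n [x t] xt; rewrite /initial_layer/=; case: ifPn => // /andP[t0 tt].
  have B0 : 0 <= B by exact: le_trans (ltW (tau0 n)) (tauB n).
  rewrite !pJ ?subrr ?mulr0//=.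
    have := @box_notin R d J B x 0 t (- t); rewrite addr0 subrr; apply => //.
      by move=> j; rewrite mxE normr0.
    by rewrite normrN ger0_norm// (le_trans (ltW tt)).
  rewrite -[x]addr0 -[t]addr0; apply: (box_notin (B := B)) => //.
    by move=> j; rewrite mxE normr0.
  by rewrite normr0.
Qed.

Lemma space_quotient_L1 i (h : nat -> R) : (forall n, h n != 0) ->
  (forall n, `|h n| <= B) -> h n @[n --> \oo] --> 0 ->
  [/\ forall n, lebZ.-integrable setT (EFin \o space_quotient i (h n)),
    lebZ.-integrable setT (EFin \o zero_ext (fun z => phi_x z ord0 i)) &
    \int[lebZ]_z `|space_quotient i (h n) z - zero_ext (fun z => phi_x z ord0 i) z|
      @[n --> \oo] --> 0].
Proof.
move=> h0 hB hc; have [J [L [J0 L0 pJ _ xL]]] := bounds.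
apply: (@box_L1_limit _ _ _ _ L (J + B)).
- move=> n; apply: measurable_funM => //; apply: measurable_funB; last exact: measurable_zero_ext.
  have := measurable_shift (h n *: dir i) 0 (measurable_zero_ext cphi).
  by apply: eq_measurable_fun => z _; rewrite addr0.
- move=> -[x t]; rewrite /space_quotient /zero_ext/=; case: ifPn => t0.
    exact: (@line_quotient _ _ _ _ _ (@dphi_x t i t0) x h h0 hc).
  by apply: cvg_near_cst; apply: nearW => n; rewrite subrr mulr0.
- move=> n [x t]; rewrite /space_quotient /zero_ext/=; case: ifPn => t0; last first.
    by rewrite subrr mulr0 normr0.
  rewrite normrM normfV ler_pdivrMl ?normr_gt0// mulrC.
  by apply: (line_lipschitz (@dphi_x t i t0)) => y; exact: xL.
- move=> n [x t] xt; rewrite /space_quotient /zero_ext/=; case: ifPn => t0; last first.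
    by rewrite subrr mulr0.
  have B0 : 0 <= B by exact: le_trans (normr_ge0 _) (hB n).
  rewrite !pJ ?subrr ?mulr0//=.
    rewrite -[x]addr0 -[t]addr0; apply: (box_notin (B := B)) => //.
      by move=> j; rewrite mxE normr0.
    by rewrite normr0.
  rewrite -[t]addr0; apply: (box_notin (B := B)) => //.
    by move=> j; exact: le_trans (dir_bound _ _ _) (hB n).
  by rewrite normr0.
Qed.

End test_function.

(** * Compactness of Young measures *)

Lemma fine_probability d (T : measurableType d) (R : realType) (P : probability T R)
    (b : pred T) : measurable [set t | b t] ->
  fine (P [set t | b t]) = \int[P]_t (b t)%:R.
Proof.
move=> mb; rewrite /Rintegral -[in LHS](setIT [set t | _]) -integral_indic//.
by congr fine; apply: eq_integral => t _; rewrite indicE mem_setb.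
Qed.

Lemma probability_fine01 d (T : measurableType d) (R : realType) (P : probability T R) A :
  measurable A -> 0 <= fine (P A) <= 1.
Proof.
move=> mA; have Pfin : P A \is a fin_num by exact: fin_num_measure.
by rewrite fine_ge0//= -lee_fin fineK//; exact: probability_le1.
Qed.

Section monotone_cluster.
Context d (T : measurableType d) (R : realType).
Variables (mu : {sigma_finite_measure set T -> \bar R}).
Variables (U : set_system nat) (UU : UltraFilter U).
Variables (H : nat -> rat -> T -> R).
Hypothesis mH : forall n r, measurable_fun setT (H n r).
Hypothesis H01 : forall n r x, 0 <= H n r x <= 1.
Hypothesis H_ni : forall n r s x, r <= s -> H n s x <= H n r x.

(** For each pair of levels monotonicity holds outside of a null set. There are countably
    many rational pairs, and all limits are set to zero on the union of these null sets. *)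
Lemma weak_cluster_monotone : exists g : rat -> T -> R,
  [/\ forall r, measurable_fun setT (g r), forall r x, 0 <= g r x <= 1,
    forall r s x, r <= s -> g s x <= g r x &
    forall r psi, mu.-integrable setT (EFin \o psi) ->
     (\int[mu]_x (psi x * H n r x)) @[n --> U] --> \int[mu]_x (psi x * g r x)].
Proof.
have /choice[g gP] r := weak_cluster mu UU (fun n => mH n r) (fun n => H01 n r).
pose bad (p : rat * rat) := [set x | p.1 <= p.2 /\ g p.1 x < g p.2 x].
have [N [mN N0 badN]] : mu.-negligible (\bigcup_n bad (odflt (0, 0) (choice.unpickle n))).
  apply: negligible_bigcup => n; set p := odflt _ _.
  have [p12|p12] := boolP (p.1 <= p.2); last first.
    by apply: (@negligibleS _ _ _ _ set0); [move=> x []; rewrite (negbTE p12)|exact: negligible_set0].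
  have [m1 b1 l1] := gP p.1; have [m2 b2 l2] := gP p.2.
  have := @weak_limit_le _ _ _ mu U (@ultra_proper _ _ UU) (H ^~ p.2) (H ^~ p.1) (g p.2) (g p.1)
    (mH ^~ p.2) (H01 ^~ p.2) (mH ^~ p.1) (H01 ^~ p.1) m2 b2 m1 b1 l2 l1
    (fun n x => H_ni n x p12).
  by apply: negligibleS => x [].
pose g' r x := if x \in N then 0 else g r x.
have mg' r : measurable_fun setT (g' r).
  have [mg _ _] := gP r; apply: measurable_fun_ifT => //.
  apply: (measurable_fun_bool true); rewrite setTI.
  rewrite (_ : _ @^-1` _ = N)//; apply/seteqP; split => x /=; first by move/set_mem.
  by move/mem_set.
exists g'; split => //.
- by move=> r x; rewrite /g'; case: ifP => _; [rewrite lexx ler01|have [_ + _] := gP r; exact].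
- move=> r s x rs; rewrite /g'; case: ifPn => // /negP xN.
  rewrite leNgt; apply/negP => gg; apply: xN; rewrite inE; apply: badN.
  by exists (choice.pickle (r, s)) => //; rewrite choice.pickleK.
- move=> r psi psii; have [mg _ /(_ psi psii)] := gP r.
  rewrite (_ : \int[mu]_x (psi x * g r x) = \int[mu]_x (psi x * g' r x))//.
  have mpsi : measurable_fun setT psi by apply/measurable_EFinP; case/integrableP : psii.
  rewrite /Rintegral; congr fine; apply: ae_eq_integral => //.
  + by apply/measurable_EFinP; exact: measurable_funM.
  + by apply/measurable_EFinP; exact: measurable_funM.
  + exists N; split => // x /= K; apply: contrapT => xN; apply: K => _.
    by rewrite /g' memNset.
Qed.

End monotone_cluster.

Section pairing.
Context {R : realType}.
Local Notation prob := (probability (measurableTypeR R) R).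
Variable M : R.
Hypothesis M0 : 0 <= M.

Lemma pairing_integrable (mu : prob) (g : R -> R) :
  mu (~` `[- M, M]%classic) = 0%E -> continuous g -> mu.-integrable setT (EFin \o g).
Proof.
move=> mu0 cg; have [C _ gC] := continuous_itv_bounded (- M) M cg.
have mg : measurable_fun setT g by exact: continuous_measurable_fun.
have mI : measurable `[- M, M]%classic by exact: measurable_itv.
have gi : mu.-integrable `[- M, M]%classic (EFin \o g).
  apply: (@integrable_bounded _ _ _ _ _ _ C) => //.
  - by rewrite (le_lt_trans (probability_le1 mu mI))// ltry.
  - exact: measurable_funTS.
have mC : measurable (~` `[- M, M]%classic) by exact: measurableC.
have mgE : measurable_fun setT (EFin \o g) by exact/measurable_EFinP.
apply: (@negligible_integrable _ _ _ mu setT _ _ mC measurableT mgE mu0).2.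
by rewrite setDE setCK setTI.
Qed.

Lemma pairing_bound (mu : prob) (g : R -> R) C :
  mu (~` `[- M, M]%classic) = 0%E -> continuous g ->
  (forall y, - M <= y <= M -> `|g y| <= C) -> `|pairing mu g| <= C.
Proof.
move=> mu0 cg gC; pose X (y : R) : R := Num.max (- M) (Num.min M y).
have MM : - M <= M by rewrite ge0_cp.
have mX : measurable_fun setT X by apply: measurable_maxr => //; exact: measurable_minr.
have Xb y : - M <= X y <= M by rewrite /X le_max lexx/= ge_max MM/= ge_min lexx.
have mg : measurable_fun setT g by exact: continuous_measurable_fun.
have mgX : measurable_fun setT (g \o X) by exact: measurableT_comp.
have muT : (mu setT < +oo)%E by rewrite probability_setT ltry.
have gXi : mu.-integrable setT (EFin \o (g \o X)).
  by apply: (@integrable_bounded _ _ _ _ _ _ C) => // y _; exact: gC.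
rewrite /pairing (Rintegral_concentrated mu0 (g := g \o X))//; last first.
  by move=> y /=; rewrite in_itv/= => /andP[y1 y2]; rewrite /X min_r// max_r.
by apply: Rintegral_prob_bounded => // y; exact: gC.
Qed.

End pairing.

Section quantile_law.
Context {R : realType}.
Variable M : nat.
Hypothesis M0 : (0 < M)%N.
Local Notation prob := (probability (measurableTypeR R) R).
Local Notation P := (uniform_prob (@ltr01 R)).

Let measurable_quantile1' (h : rat -> R) :
  @measurable_fun _ _ (measurableTypeR R) (measurableTypeR R) setT (quantile M h).
Proof. exact: measurable_quantile1. Qed.

Definition quantile_rv (h : rat -> R) : {mfun measurableTypeR R >-> measurableTypeR R} :=
  HB.pack (quantile M h : measurableTypeR R -> measurableTypeR R)
    (isMeasurableFun.Build _ _ (measurableTypeR R) (measurableTypeR R) _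
      (measurable_quantile1' h)).

Definition quantile_law (h : rat -> R) : prob := distribution P (quantile_rv h).

Lemma quantile_law_null h : quantile_law h (~` `[- M%:R, M%:R]%classic) = 0%E.
Proof.
have pre : quantile M h @^-1` (~` `[- M%:R, M%:R]%classic) = set0.
  apply/seteqP; split => // w /=; apply; rewrite in_itv/=; exact: quantile_bound.
by change (P (quantile M h @^-1` (~` `[- M%:R, M%:R]%classic)) = 0%E); rewrite pre measure0.
Qed.

Lemma pairing_quantile_law h g : continuous g ->
  pairing (quantile_law h) g = \int[P]_w g (quantile M h w).
Proof.
move=> cg; have [C _ gC] := continuous_itv_bounded (- M%:R) M%:R cg.
have mg : measurable_fun setT g by exact: continuous_measurable_fun.
have PT : (P setT < +oo)%E by rewrite probability_setT ltry.
have mgq : measurable_fun setT (g \o quantile M h).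
  exact: (measurableT_comp mg (measurable_quantile1 M h)).
rewrite /pairing /Rintegral /quantile_law integral_distribution//.
  exact/measurable_EFinP.
apply: (@integrable_bounded _ _ _ _ _ _ C) => //.
by move=> w _; apply: gC; exact: quantile_bound.
Qed.

Lemma measurable_pairing_quantile_law d (T : measurableType d) (h : rat -> T -> R) g :
  (forall q, measurable_fun setT (h q)) -> continuous g ->
  measurable_fun setT (fun z => pairing (quantile_law (h ^~ z)) g).
Proof.
move=> mh cg; have [C _ gC] := continuous_itv_bounded (- M%:R) M%:R cg.
under eq_fun do rewrite pairing_quantile_law//.
apply: (@measurable_Rintegral_param _ _ _ _ _ P (fun p => g (quantile M (h ^~ p.1) p.2)) C).
  apply: (measurableT_comp _ (measurable_quantile M mh)).
  exact: continuous_measurable_fun.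
by move=> z; apply: gC; exact: quantile_bound.
Qed.

End quantile_law.

Section young_limit.
Context d (T : measurableType d) (R : realType).
Variables (mu : {sigma_finite_measure set T -> \bar R}).
Variables (U : set_system nat) (UU : UltraFilter U).
Context dO (Om : measurableType dO) (P : probability Om R).
Local Notation prob := (probability (measurableTypeR R) R).
Variable M : nat.
Hypothesis M0 : (0 < M)%N.
Variable X : nat -> T -> Om -> R.
Hypothesis mX : forall n, measurable_fun setT (fun p : T * Om => X n p.1 p.2).
Hypothesis XM : forall n z w, - M%:R <= X n z w <= M%:R.

(** Compactness for Young measures. The weak limits h of the tails of X n along U are,
    up to jumps, the tails of nu z by construction. The expectations of g (X n z) and the
    pairings with nu z are approximated by one and the same finite combination of tails,
    uniformly in n and z, and each tail in it converges weakly. *)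
Lemma young_limit : exists nu : T -> prob,
  [/\ forall z, nu z (~` `[- M%:R, M%:R]%classic) = 0%E,
    forall g, continuous g -> measurable_fun setT (fun z => pairing (nu z) g) &
    forall g psi, continuous g -> mu.-integrable setT (EFin \o psi) ->
      \int[mu]_z (psi z * \int[P]_w g (X n z w)) @[n --> U] -->
      \int[mu]_z (psi z * pairing (nu z) g)].
Proof.
pose H n r z := fine (P [set w | ratr r < X n z w]).
have mXz n z : measurable_fun setT (X n z).
  exact: (@measurable_fun_pair2 _ _ _ _ _ _ (fun p => X n p.1 p.2) z (mX n)).
have mA n r z : measurable [set w | ratr r < X n z w] by exact: measurable_superlevel.
have mH n r : measurable_fun setT (H n r).
  rewrite (_ : H n r = fun z => \int[P]_w (ratr r < X n z w)%R%:R); last first.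
    by apply/funext => z; rewrite /H fine_probability.
  apply: (@measurable_Rintegral_param _ _ _ _ _ P (fun p => (ratr r < X n p.1 p.2)%R%:R) 1).
    have mb : measurable_fun setT (fun p : T * Om => ratr r < X n p.1 p.2).
      exact: measurable_fun_ltr.
    rewrite (_ : (fun p => _) = (fun p => if ratr r < X n p.1 p.2 then 1 else 0)).
      exact: measurable_fun_ifT.
    by apply/funext => p; case: ifP.
  by move=> p; case: (_ < _); rewrite ?normr1 ?normr0.
have H01 n r z : 0 <= H n r z <= 1 by exact: probability_fine01.
have H_ni n r s z : r <= s -> H n s z <= H n r z.
  move=> rs; rewrite fine_le ?fin_num_measure//; apply: le_measure; rewrite ?inE//.
  by move=> w /=; apply: le_lt_trans; rewrite ler_rat.
have [h [mh h01 h_ni hlim]] := weak_cluster_monotone mu UU mH H01 H_ni.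
exists (fun z => quantile_law M (h ^~ z)); split.
- by move=> z; exact: quantile_law_null.
- by move=> g cg; exact: measurable_pairing_quantile_law.
move=> g psi cg psii; have [C C0 gC] := continuous_itv_bounded (- M%:R) M%:R cg.
pose I := \int[mu]_z `|psi z|.
have I0 : 0 <= I by exact: Rintegral_ge0.
apply: cvg_uniform_approx => e e0.
(* Both approximation errors are at most e' + e' pointwise, hence e after integration
   against psi. *)
pose e' := e / (2 * (I + 1)).
have I1 : 0 < 2 * (I + 1) by rewrite mulr_gt0// ltr_wpDl.
have e'0 : 0 < e' by rewrite divr_gt0.
have e'e : (e' + e') * I <= e.
  have I1' : 0 < I + 1 by rewrite ltr_wpDl.
  have -> : (e' + e') * I = e * (I / (I + 1)) by rewrite /e'; field; rewrite gt_eqF.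
  by rewrite ler_piMr ?(ltW e0)// ler_pdivrMr// mul1r lerDl.
have [K K0 gK] := grid_fine M cg e'0.
pose r j : R := ratr (grid M K j).
pose S (k : rat -> T -> R) z := g (- M%:R) + \sum_(0 <= j < K)
  (g (r j.+1) - g (r j)) * k (grid M K j) z.
have mS (k : rat -> T -> R) : (forall q, measurable_fun setT (k q)) -> measurable_fun setT (S k).
  move=> mk; apply: measurable_funD => //; apply: measurable_sum => j.
  exact: measurable_funM.
have psiki (k : rat -> T -> R) j : (forall q, measurable_fun setT (k q)) ->
    (forall q z, 0 <= k q z <= 1) ->
    mu.-integrable setT (EFin \o (fun z => psi z * k (grid M K j) z)).
  move=> mk k01; apply: (@integrable_mul_bounded _ _ _ _ _ _ _ 1) => //.
  by move=> z _; have /andP[? ?] := k01 (grid M K j) z; rewrite ger0_norm.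
have SE (k : rat -> T -> R) : (forall q, measurable_fun setT (k q)) ->
    (forall q z, 0 <= k q z <= 1) ->
    mu.-integrable setT (EFin \o (fun z => psi z * S k z)) /\
    \int[mu]_z (psi z * S k z) = g (- M%:R) * \int[mu]_z psi z +
      \sum_(0 <= j < K) (g (r j.+1) - g (r j)) * \int[mu]_z (psi z * k (grid M K j) z).
  move=> mk k01.
  have E : (fun z => psi z * S k z) = (fun z => g (- M%:R) * psi z + \sum_(0 <= j < K)
      (g (r j.+1) - g (r j)) * (psi z * k (grid M K j) z)).
    apply/funext => z; rewrite /S mulrDr mulrC mulr_sumr; congr (_ + _).
    by apply: eq_bigr => j _; rewrite mulrCA.
  have i1 : mu.-integrable setT (EFin \o (fun z => g (- M%:R) * psi z)) by exact: integrable_scaler.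
  have ij j : mu.-integrable setT (EFin \o (fun z => (g (r j.+1) - g (r j)) * (psi z * k (grid M K j) z))).
    by apply: integrable_scaler => //; exact: psiki.
  have i2 : mu.-integrable setT (EFin \o (fun z => \sum_(0 <= j < K)
      (g (r j.+1) - g (r j)) * (psi z * k (grid M K j) z))) by exact: integrable_sumr.
  rewrite E; split; first exact: integrable_addr.
  rewrite RintegralD// RintegralZl// Rintegral_sumr//; congr (_ + _).
  by apply: eq_bigr => j _; rewrite RintegralZl//; exact: psiki.
have close (Q : T -> R) (k : rat -> T -> R) : measurable_fun setT Q ->
    (forall z, `|Q z| <= C) -> (forall q, measurable_fun setT (k q)) ->
    (forall q z, 0 <= k q z <= 1) -> (forall z, `|Q z - S k z| <= e' + e') ->
    `|\int[mu]_z (psi z * Q z) - \int[mu]_z (psi z * S k z)| <= e.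
  move=> mQ QC mk k01 QS; have [Si _] := SE k mk k01.
  have Qi : mu.-integrable setT (EFin \o (fun z => psi z * Q z)).
    exact: (@integrable_mul_bounded _ _ _ _ _ _ _ C).
  rewrite -RintegralB//; apply: le_trans e'e.
  rewrite (@eq_Rintegral _ _ _ _ _ (fun z => psi z * (Q z - S k z))); last first.
    by move=> z _; rewrite mulrBr.
  apply: Rintegral_mul_bounded => //; apply: measurable_funB => //; exact: mS.
have gXi n z : P.-integrable setT (EFin \o (fun w => g (X n z w))).
  have PT : (P setT < +oo)%E by rewrite probability_setT ltry.
  apply: (@integrable_bounded _ _ _ _ _ _ C) => //; last by move=> w _; exact: gC.
  by apply: measurableT_comp => //; exact: continuous_measurable_fun.
exists (fun n => \int[mu]_z (psi z * S (H n) z)), (\int[mu]_z (psi z * S h z)); split.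
- move=> n; apply: close => //.
  + apply: (@measurable_Rintegral_param _ _ _ _ _ P (fun p => g (X n p.1 p.2)) C).
      by apply: (measurableT_comp _ (mX n)); exact: continuous_measurable_fun.
    by move=> p; exact: gC.
  + by move=> z; apply: Rintegral_prob_bounded => // w; exact: gC.
  + by move=> z; exact: tail_approx.
- apply: close => //.
  + by apply: measurable_pairing_quantile_law.
  + move=> z.
    exact: (@pairing_bound R M%:R (ler0n _ _) (quantile_law M (h ^~ z)) g C (quantile_law_null M (h ^~ z)) cg gC).
  + move=> z; rewrite pairing_quantile_law//.
    exact: (quantile_approx M0 (h01 ^~ z) (fun p q pq => h_ni p q z pq) cg e'0 K0 gK).
- have [_ ->] := SE h mh h01.
  under eq_cvg => n. have [_ ->] := SE (H n) (mH n) (H01 n). over.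
  apply: cvgD; first exact: cvg_cst.
  by apply: cvg_sumr => j; apply: cvgMr; exact: hlim.
Qed.

End young_limit.

(** * Passage to the limit in the scheme *)

Section summation_by_parts.
Context {R : realType} {d : nat}.
Local Notation lebZ := (lebesgue_rV d \x @lebesgue_measure R)%E.
Local Notation Z := ('rV[R]_d * measurableTypeR R)%type.
Variables (p E : 'rV[R]_d * R -> R) (H : 'I_d -> 'rV[R]_d * R -> R) (C : R).
Hypothesis pi : lebZ.-integrable setT (EFin \o p).
Hypothesis mE : measurable_fun setT (E : Z -> R).
Hypothesis EC : forall z, `|E z| <= C.
Hypothesis mH : forall i, measurable_fun setT (H i : Z -> R).
Hypothesis HC : forall i z, `|H i z| <= C.

Let mul_i (g : 'rV[R]_d * R -> R) (q : 'rV[R]_d * R -> R) :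
  lebZ.-integrable setT (EFin \o q) -> measurable_fun setT (g : Z -> R) ->
  (forall z, `|g z| <= C) -> lebZ.-integrable setT (EFin \o (fun z => q z * g z)).
Proof. by move=> qi mg gC; apply: (@integrable_mul_bounded _ _ _ _ _ _ _ C). Qed.

Lemma shift_integrable v s : lebZ.-integrable setT (EFin \o (fun z => p (z.1 + v, z.2 + s))).
Proof. exact: (preserving_integrable (space_time_shift v s) pi). Qed.

Lemma integral_mul_shift (g : 'rV[R]_d * R -> R) v s :
  measurable_fun setT (g : Z -> R) -> (forall z, `|g z| <= C) ->
  lebZ.-integrable setT (EFin \o (fun z => p z * g (z.1 + v, z.2 + s))) /\
  \int[lebZ]_z (p z * g (z.1 + v, z.2 + s)) = \int[lebZ]_z (p (z.1 - v, z.2 - s) * g z).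
Proof.
move=> mg gC; split; first by apply: mul_i => //; exact: measurable_shift.
have i := mul_i (shift_integrable (- v) (- s)) mg gC.
rewrite -(preserving_Rintegral (space_time_shift v s) i)/=.
by apply: eq_Rintegral => -[x t] _ /=; rewrite !addrK.
Qed.

Variables (a h : R).
Hypotheses (a0 : 0 < a) (h0 : 0 < h).

(** Translations of space-time preserve Lebesgue measure, so that every shift of E and H
    can be moved to p. The ratio of tau to h is the one for which the coefficient of
    each flux H i becomes the average of the two one-sided quotients of p; their
    difference, which multiplies E, is the diffusion of the scheme. *)
Lemma summation_by_parts : let tau := 2 * a * h / (2 * d + 1)%:R in
  \int[lebZ]_z (p z * ((2 * d + 1)%:R^-1 * (E z + \sum_i
    ((E (z.1 + h *: dir i, z.2) - a * H i (z.1 + h *: dir i, z.2)) +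
     (E (z.1 - h *: dir i, z.2) + a * H i (z.1 - h *: dir i, z.2)))) - E (z.1, z.2 + tau))) =
  tau * (\int[lebZ]_z ((tau^-1 * (p z - p (z.1, z.2 - tau))) * E z) +
    \sum_i ((2 * a)^-1 * (\int[lebZ]_z ((h^-1 * (p (z.1 + h *: dir i, z.2) - p z)) * E z)
                 - \int[lebZ]_z (((- h)^-1 * (p (z.1 - h *: dir i, z.2) - p z)) * E z)) +
      2^-1 * (\int[lebZ]_z ((h^-1 * (p (z.1 + h *: dir i, z.2) - p z)) * H i z)
            + \int[lebZ]_z (((- h)^-1 * (p (z.1 - h *: dir i, z.2) - p z)) * H i z)))).
Proof.
move=> tau; set N := (2 * d + 1)%:R.
have N0 : 0 < N by rewrite ltr0n addn1.
have tau0 : 0 < tau by rewrite divr_gt0// !mulr_gt0.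
have mT : measurable [set: Z] by [].
pose I (g : 'rV[R]_d * R -> R) v s := \int[lebZ]_z (p (z.1 + v, z.2 + s) * g z).
have Ii g v s : measurable_fun setT (g : Z -> R) -> (forall z, `|g z| <= C) ->
    lebZ.-integrable setT (EFin \o (fun z => p (z.1 + v, z.2 + s) * g z)).
  by move=> mg gC; apply: mul_i => //; exact: shift_integrable.
have quot g v s c : measurable_fun setT (g : Z -> R) -> (forall z, `|g z| <= C) ->
    \int[lebZ]_z ((c * (p (z.1 + v, z.2 + s) - p z)) * g z) = c * (I g v s - I g 0 0).
  move=> mg gC; rewrite -RintegralB//; [|exact: Ii..].
  rewrite -RintegralZl//; last by apply: integrable_subr => //; exact: Ii.
  by apply: eq_Rintegral => -[x t] _ /=; rewrite !addr0; ring.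
pose D (g : 'rV[R]_d * R -> R) v s (z : 'rV[R]_d * R) := p z * g (z.1 + v, z.2 + s).
have Di g v s : measurable_fun setT (g : Z -> R) -> (forall z, `|g z| <= C) ->
    lebZ.-integrable setT (EFin \o D g v s).
  by move=> mg gC; case: (integral_mul_shift v s mg gC).
have DI g v s : measurable_fun setT (g : Z -> R) -> (forall z, `|g z| <= C) ->
    \int[lebZ]_z D g v s z = I g (- v) (- s).
  by move=> mg gC; case: (integral_mul_shift v s mg gC).
have iS i : lebZ.-integrable setT (EFin \o (fun z =>
    (D E (h *: dir i) 0 z - a * D (H i) (h *: dir i) 0 z) +
    (D E (- (h *: dir i)) 0 z + a * D (H i) (- (h *: dir i)) 0 z))).
  apply: integrable_addr => //.
    by apply: integrable_subr => //; [exact: Di|apply: integrable_scaler => //; exact: Di].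
  by apply: integrable_addr => //; [exact: Di|apply: integrable_scaler => //; exact: Di].
have LHSE : \int[lebZ]_z (p z * (N^-1 * (E z + \sum_i
    ((E (z.1 + h *: dir i, z.2) - a * H i (z.1 + h *: dir i, z.2)) +
     (E (z.1 - h *: dir i, z.2) + a * H i (z.1 - h *: dir i, z.2)))) - E (z.1, z.2 + tau))) =
  N^-1 * (I E 0 0 + \sum_i ((I E (- (h *: dir i)) 0 - a * I (H i) (- (h *: dir i)) 0) +
    (I E (h *: dir i) 0 + a * I (H i) (h *: dir i) 0))) - I E 0 (- tau).
  transitivity (\int[lebZ]_z (N^-1 * (D E 0 0 z + \sum_i
    ((D E (h *: dir i) 0 z - a * D (H i) (h *: dir i) 0 z) +
    (D E (- (h *: dir i)) 0 z + a * D (H i) (- (h *: dir i)) 0 z))) - D E 0 tau z)).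
    apply: eq_Rintegral => -[x t] _; rewrite /D/= !addr0 mulrBr; congr (_ - _).
    rewrite mulrCA mulrDr; congr (_ * (_ + _)); rewrite mulr_sumr.
    by apply: eq_bigr => i _; ring.
  have isum : lebZ.-integrable setT (EFin \o (fun z => \sum_i
    ((D E (h *: dir i) 0 z - a * D (H i) (h *: dir i) 0 z) +
    (D E (- (h *: dir i)) 0 z + a * D (H i) (- (h *: dir i)) 0 z)))).
    by apply: integrable_sumr.
  have iE v s := Di E v s mE EC.
  have iH i v s := Di (H i) v s (mH i) (HC i).
  have iaH i v s : lebZ.-integrable setT (EFin \o (fun z => a * D (H i) v s z)).
    exact: integrable_scaler.
  rewrite RintegralB//; last by apply: integrable_scaler => //; exact: integrable_addr.
  rewrite RintegralZl//; last exact: integrable_addr.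
  rewrite RintegralD// Rintegral_sumr// !DI// !oppr0; congr (_ * (_ + _) - _).
  apply: eq_bigr => i _; rewrite RintegralD//; last 2 first.
    exact: integrable_subr.
    exact: integrable_addr.
  by rewrite RintegralB// RintegralD// !RintegralZl// !DI// !opprK !oppr0.
rewrite LHSE.
have qE v c : \int[lebZ]_z ((c * (p (z.1 + v, z.2) - p z)) * E z) = c * (I E v 0 - I E 0 0).
  by rewrite -quot//; apply: eq_Rintegral => z _; rewrite addr0.
have qH i v c : \int[lebZ]_z ((c * (p (z.1 + v, z.2) - p z)) * H i z) = c * (I (H i) v 0 - I (H i) 0 0).
  by rewrite -quot//; apply: eq_Rintegral => z _; rewrite addr0.
have qt : \int[lebZ]_z ((tau^-1 * (p z - p (z.1, z.2 - tau))) * E z) =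
    - tau^-1 * (I E 0 (- tau) - I E 0 0).
  by rewrite -quot//; apply: eq_Rintegral => z _; rewrite addr0; ring.
rewrite qt; under [X in _ = _ * (_ + X)]eq_bigr => i _ do rewrite !qE !qH.
rewrite [X in _ = _ * (_ + X)](eq_bigr (fun i => (tau^-1 * N^-1) *
   (((I E (- (h *: dir i)) 0 - a * I (H i) (- (h *: dir i)) 0) +
    (I E (h *: dir i) 0 + a * I (H i) (h *: dir i) 0)) - 2 * I E 0 0))); last first.
  by move=> i _; rewrite /tau; field; rewrite !gt_eqF// ltr0n.
rewrite -mulr_sumr sumrB sumr_const card_ord -[_ *+ d]mulr_natl.
rewrite -/N (_ : d%:R = (N - 1) / 2); last first.
  by rewrite /N natrD natrM; field.
by field; rewrite !gt_eqF.
Qed.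

End summation_by_parts.

Section weak_form_limit.
Context {R : realType} {d : nat}.
Local Notation leb := (@lebesgue_measure R).
Local Notation lebZ := (lebesgue_rV d \x @lebesgue_measure R)%E.
Local Notation Z := ('rV[R]_d * measurableTypeR R)%type.
Local Notation prob := (probability (measurableTypeR R) R).
Variables (phi phi_t : 'rV[R]_d * R -> R) (phi_x : 'rV[R]_d * R -> 'rV[R]_d).
Hypothesis hphi : C1c_half_space phi phi_t phi_x.

Lemma zero_ext_integrable : lebZ.-integrable setT (EFin \o zero_ext phi).
Proof.
have [J J0 pJ] := test_support hphi.
have cphi : {within half_space, continuous phi} by case: hphi.
have [L L0 pL] := within_half_bounded cphi pJ.
apply: (@box_integrable _ _ _ L J).
- exact: measurable_zero_ext.
- by move=> z; rewrite /zero_ext; case: ifPn => [/pL//|]; rewrite normr0.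
- by move=> z zJ; rewrite /zero_ext; case: ifPn => // z0; exact: pJ.
Qed.

(** The part of the backward difference quotient that carries the initial data. *)
Definition initial_term (tau : R) (z : 'rV[R]_d * R) : R :=
  if (0 <= z.2) && (z.2 < tau) then tau^-1 * phi (z.1, 0) else 0.

Lemma backward_difference tau z : 0 < tau ->
  tau^-1 * (zero_ext phi z - zero_ext phi (z.1, z.2 - tau)) =
  time_quotient phi tau z + initial_layer phi tau z + initial_term tau z.
Proof.
case: z => x t tau0; rewrite /zero_ext /time_quotient /initial_layer /initial_term/= subr_ge0.
have [t0|t0] := leP 0 t; have [tt|tt] := leP tau t => /=.
- by rewrite !addr0.
- by rewrite subr0 add0r mulrBr subrK.
- by have := lt_le_trans tau0 tt; rewrite ltNge (ltW t0).
- by rewrite subrr mulr0 !addr0.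
Qed.

(** E does not depend on time during the first step, and the factor 1 / tau cancels the
    length of the layer. *)
Lemma integral_initial_term tau (E : 'rV[R]_d * R -> R) (e : 'rV[R]_d -> R) : 0 < tau ->
  lebZ.-integrable setT (EFin \o (fun z => initial_term tau z * E z)) ->
  (forall x t, 0 <= t -> t < tau -> E (x, t) = e x) ->
  \int[lebZ]_z (initial_term tau z * E z) = \int[lebesgue_rV d]_x (phi (x, 0) * e x).
Proof.
move=> tau0 ii Ee; rewrite Rintegral_prod12//; apply: eq_Rintegral => x _.
rewrite (_ : (fun y => _) = (fun t => tau^-1 * (phi (x, 0) * e x)) \_ `[0, tau[%classic); last first.
  apply/funext => t; rewrite patchE mem_setb /initial_term/= in_itv/=.
  by case: ifPn => [/andP[t0 tt]|]; rewrite ?mul0r// Ee// mulrA.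
rewrite -Rintegral_mkcond Rintegral_cst//.
have leb_tau : fine (leb `[0, tau[%classic) = tau.
  by rewrite lebesgue_measure_itv/= lte_fin tau0 oppr0 addr0.
transitivity (tau^-1 * (phi (x, 0) * e x) * fine (leb `[0, tau[%classic)); first by [].
by rewrite leb_tau mulrAC mulVf ?mul1r// gt_eqF.
Qed.

Variables (nu : 'rV[R]_d * R -> prob) (g : R -> R) (q : R -> 'rV[R]_d) (C : R).
Hypothesis mg : measurable_fun setT (fun z : Z => pairing (nu z) g).
Hypothesis gC : forall z, `|pairing (nu z) g| <= C.
Hypothesis mq : forall i, measurable_fun setT (fun z : Z => pairing (nu z) (fun xi => q xi ord0 i)).
Hypothesis qC : forall i z, `|pairing (nu z) (fun xi => q xi ord0 i)| <= C.
Hypothesis phi_ti : lebZ.-integrable setT (EFin \o (fun z => if 0 < z.2 then phi_t z else 0)).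
Hypothesis phi_xi : forall i, lebZ.-integrable setT (EFin \o zero_ext (fun z => phi_x z ord0 i)).

(** Fubini's theorem; the slice t = 0 on which the integrands differ is null. *)
Lemma weak_form_space_time (sigma : 'rV[R]_d -> prob) :
  weak_form nu sigma g q phi phi_t phi_x =
  \int[lebZ]_z ((if 0 < z.2 then phi_t z else 0) * pairing (nu z) g) +
  \sum_i \int[lebZ]_z (zero_ext (fun z => phi_x z ord0 i) z *
                       pairing (nu z) (fun xi => q xi ord0 i)) +
  \int[lebesgue_rV d]_x (phi (x, 0) * pairing (sigma x) g).
Proof.
have ig : lebZ.-integrable setT (EFin \o (fun z => (if 0 < z.2 then phi_t z else 0) * pairing (nu z) g)).
  exact: (@integrable_mul_bounded _ _ _ lebZ setT _ _ C measurableT phi_ti mg (fun z _ => gC z)).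
have iq i : lebZ.-integrable setT (EFin \o (fun z => zero_ext (fun z => phi_x z ord0 i) z *
    pairing (nu z) (fun xi => q xi ord0 i))).
  exact: (@integrable_mul_bounded _ _ _ lebZ setT _ _ C measurableT (phi_xi i) (mq i)
    (fun z _ => qC i z)).
have isum : lebZ.-integrable setT (EFin \o (fun z => \sum_i zero_ext (fun z => phi_x z ord0 i) z *
    pairing (nu z) (fun xi => q xi ord0 i))).
  exact: integrable_sumr.
rewrite -Rintegral_sumr// -RintegralD//; congr (_ + _).
set W := (fun z : Z => _ + _).
have iW : lebZ.-integrable setT (EFin \o W) by exact: integrable_addr.
rewrite (Rintegral_prod21 iW) Rintegral_mkcond.
(* w is the inner integral of the weak form and v that of W, which vanishes for t < 0. *)
pose w (t : R) := \int[lebesgue_rV d]_x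
    (phi_t (x, t) * pairing (nu (x, t)) g +
     \sum_i phi_x (x, t) ord0 i * pairing_rV (nu (x, t)) q ord0 i).
pose v (t : R) := \int[lebesgue_rV d]_x W (x, t).
have mv : measurable_fun setT (v : measurableTypeR R -> R).
  by apply: (measurableT_comp _ (measurable_fubini_G iW)).
have vw : w \_ `[0, +oo[ = fun t => if 0 < `|t| then v t else w 0.
  apply/funext => t; rewrite patchE mem_setb/= in_itv/= andbT normr_gt0.
  have [->|t0] := eqVneq t 0; first by rewrite lexx.
  rewrite /= /w /v; case: ifPn => tp.
    apply: eq_Rintegral => x _; rewrite /W /zero_ext/= tp lt_neqAle eq_sym t0 tp/=.
    by congr (_ + _); apply: eq_bigr => i _; rewrite mxE.
  rewrite [RHS](@eq_Rintegral _ _ _ _ _ (cst 0)).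
    by rewrite Rintegral_cst// mul0r.
  move=> x _; rewrite /W /zero_ext/= (negbTE tp).
  by rewrite ltNge ltW/= ?ltNge// mul0r add0r big1// => i _; rewrite mul0r.
change (\int[leb]_t (w \_ `[0, +oo[) t = \int[leb]_t v t).
rewrite /Rintegral; congr fine; apply: ae_eq_integral => //.
- apply/measurable_EFinP; rewrite vw; apply: measurable_fun_ifT => //.
  by apply: measurable_fun_ltr => //; exact: measurableT_comp.
- exact/measurable_EFinP.
- exists [set 0]; split => //; first exact: lebesgue_measure_set1.
  move=> t /= K; apply: contrapT => /eqP t0; apply: K => _.
  by rewrite vw normr_gt0 t0.
Qed.

End weak_form_limit.

Section scheme_limit.
Context {R : realType} {d : nat} dO (Om : measurableType dO) (P : probability Om R).
Local Notation lebZ := (lebesgue_rV d \x @lebesgue_measure R)%E.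
Local Notation Z := ('rV[R]_d * measurableTypeR R)%type.
Local Notation prob := (probability (measurableTypeR R) R).
Variables (F : 'I_d -> R -> R) (a M : R) (u0 : 'rV[R]_d * Om -> R).
Hypothesis cF : forall i, continuous (F i).
Hypothesis a0 : 0 < a.
Hypothesis M0 : 0 <= M.
Hypothesis F_lip : forall i v w, - M <= w -> w <= v -> v <= M ->
  `|a * (F i v - F i w)| <= v - w.
Hypothesis mu0 : measurable_fun setT u0.
Hypothesis u0M : forall p, - M <= u0 p <= M.

Definition space_step (n : nat) : R := n.+1%:R^-1.
Definition time_step n : R := 2 * a * space_step n / (2 * d + 1)%:R.

Lemma space_step_gt0 n : 0 < space_step n. Proof. by rewrite invr_gt0. Qed.
Lemma space_step_le1 n : space_step n <= 1.
Proof. by rewrite invf_le1 ?ler1n. Qed.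
Lemma time_step_gt0 n : 0 < time_step n.
Proof. by rewrite divr_gt0 ?mulr_gt0 ?space_step_gt0// addn1. Qed.
Lemma time_step_le n : time_step n <= 2 * a.
Proof.
rewrite /time_step ler_pdivrMr ?addn1// ler_pM2l ?mulr_gt0//.
by rewrite (le_trans (space_step_le1 n))// ler1n.
Qed.
Lemma space_step_cvg : space_step n @[n --> \oo] --> 0.
Proof. exact: cvg_harmonic. Qed.
Lemma time_step_cvg : time_step n @[n --> \oo] --> 0.
Proof.
rewrite -[X in _ --> X](mul0r (2 * d + 1)%:R^-1) -[X in X * _](mulr0 (2 * a)).
by apply: cvgMl; apply: cvgMr; exact: space_step_cvg.
Qed.

Definition level_mean n := mean P F a (space_step n) (time_step n) u0.

(** What the entropy pair (G, H) loses in one step of the scheme. *)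
Definition residual G H n (z : 'rV[R]_d * R) :=
  mean_stencil P F a (space_step n) (time_step n) u0 G H z.1 z.2
  - level_mean n G (z.1, z.2 + time_step n).

Variables (U : set_system nat) (UU : UltraFilter U).
Hypothesis ooU : \oo `<=` U.
Variables (nu : 'rV[R]_d * R -> prob) (sigma : 'rV[R]_d -> prob).
Hypothesis nu_null : forall z, nu z (~` `[- M, M]%classic) = 0%E.
Hypothesis mnu : forall g, continuous g -> measurable_fun setT (fun z : Z => pairing (nu z) g).
Hypothesis nu_lim : forall g psi, continuous g -> lebZ.-integrable setT (EFin \o psi) ->
  \int[lebZ]_z (psi z * level_mean n g z) @[n --> U] --> \int[lebZ]_z (psi z * pairing (nu z) g).
Hypothesis sigmaE : forall g x, continuous g -> pairing (sigma x) g = \int[P]_w g (u0 (x, w)).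

Variables (phi phi_t : 'rV[R]_d * R -> R) (phi_x : 'rV[R]_d * R -> 'rV[R]_d).
Hypothesis hphi : C1c_half_space phi phi_t phi_x.
Variables (g : R -> R) (q : R -> 'rV[R]_d).
Hypothesis cg : continuous g.
Hypothesis cq : forall i, continuous (fun xi => q xi ord0 i).
Let H i xi := q xi ord0 i.

(** After summation by parts every term is a quotient of phi that converges in L^1 times
    a mean that converges weakly. The forward and backward quotients in space have the
    same limit: their difference, multiplied by the mean of g, disappears, and their
    average, multiplied by the mean of q i, gives the flux term. *)
Lemma residual_limit :
  (time_step n)^-1 * \int[lebZ]_z (zero_ext phi z * residual g H n z) @[n --> U]
    --> weak_form nu sigma g q phi phi_t phi_x.
Proof.
have FU : Filter U := @filter_filter _ U (@ultra_proper _ _ UU).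
have [C0 _ gC0] := continuous_itv_bounded (- M) M cg.
have /choice[C_ C_P] i : exists C, 0 <= C /\ forall y, - M <= y <= M -> `|H i y| <= C.
  by have [C C0' CP] := continuous_itv_bounded (- M) M (@cq i); exists C.
pose C := C0 + \sum_i C_ i.
have S0 : 0 <= \sum_i C_ i by apply: sumr_ge0 => i _; case: (C_P i).
have C00 : 0 <= C0.
  by apply: le_trans (gC0 0 _); rewrite // oppr_le0 M0.
have gC y : - M <= y <= M -> `|g y| <= C.
  by move=> /gC0/le_trans; apply; rewrite lerDl.
have HC i y : - M <= y <= M -> `|H i y| <= C.
  move=> yM; have [_ /(_ y yM)/le_trans] := C_P i; apply.
  rewrite /C (bigD1 i)//= addrCA lerDl addr_ge0// sumr_ge0// => j _.
  by case: (C_P j).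
have mE n k : continuous k -> measurable_fun setT (level_mean n k : Z -> R).
  by move=> ck; exact: (measurable_mean P (space_step n) (time_step n) cF F_lip mu0 u0M ck).
have EC n k z : continuous k -> (forall y, - M <= y <= M -> `|k y| <= C) -> `|level_mean n k z| <= C.
  by move=> ck kC; exact: (mean_bound P (space_step n) (time_step n) cF F_lip mu0 u0M z ck kC).
have [Ti ti Tl] := time_quotient_L1 hphi time_step_gt0 time_step_le time_step_cvg.
have [Li li Ll] := initial_layer_L1 hphi time_step_gt0 time_step_le time_step_cvg.
have Sx i := space_quotient_L1 hphi (B := 1) i (h := space_step) (fun n => lt0r_neq0 (space_step_gt0 n))
  (fun n => ltac:(by rewrite gtr0_norm ?space_step_gt0 ?space_step_le1)) space_step_cvg.
have SNx i := space_quotient_L1 hphi (B := 1) i (h := fun n => - space_step n)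
  (fun n => ltac:(by rewrite oppr_eq0 lt0r_neq0 ?space_step_gt0))
  (fun n => ltac:(by rewrite normrN gtr0_norm ?space_step_gt0 ?space_step_le1))
  ltac:(by rewrite -[X in _ --> X]oppr0; apply: cvgN; exact: space_step_cvg).
have xi i : lebZ.-integrable setT (EFin \o zero_ext (fun z => phi_x z ord0 i)) by case: (Sx i).
have lim (k : R -> R) psi_ psi : continuous k -> (forall y, - M <= y <= M -> `|k y| <= C) ->
    (forall n, lebZ.-integrable setT (EFin \o psi_ n)) -> lebZ.-integrable setT (EFin \o psi) ->
    \int[lebZ]_z `|psi_ n z - psi z| @[n --> \oo] --> 0 ->
    \int[lebZ]_z (psi_ n z * level_mean n k z) @[n --> U] --> \int[lebZ]_z (psi z * pairing (nu z) k).
  move=> ck kC i1 i2 i3.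
  apply: (@cvg_Rintegral_mul _ _ _ lebZ U FU psi_ (fun n => level_mean n k) psi C _ ooU i1 i2 i3).
  - by move=> n; exact: mE.
  - by move=> n z; exact: EC.
  - exact: nu_lim.
rewrite (@weak_form_space_time _ _ _ _ _ nu g q C)//; first last.
- by move=> i z; apply: (@pairing_bound R M M0 (nu z) _ C (nu_null z) (@cq i)); exact: HC.
- by move=> i; apply: mnu; exact: cq.
- by move=> z; apply: (@pairing_bound R M M0 (nu z) _ C (nu_null z) cg); exact: gC.
- exact: mnu.
pose TQ n := \int[lebZ]_z (time_quotient phi (time_step n) z * level_mean n g z).
pose IL n := \int[lebZ]_z (initial_layer phi (time_step n) z * level_mean n g z).
pose S k s i n := \int[lebZ]_z (space_quotient phi i (s * space_step n) z * level_mean n k z).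
pose I0 := \int[lebesgue_rV d]_x (phi (x, 0) * pairing (sigma x) g).
have E n : (time_step n)^-1 * \int[lebZ]_z (zero_ext phi z * residual g H n z) =
    (TQ n + IL n + I0) +
    \sum_i ((2 * a)^-1 * (S g 1 i n - S g (-1) i n) + 2^-1 * (S (H i) 1 i n + S (H i) (-1) i n)).
  have t0 := time_step_gt0 n.
  have := @summation_by_parts R d (zero_ext phi) (level_mean n g) (fun i => level_mean n (H i)) C
    (zero_ext_integrable hphi) (mE n g cg) (fun z => EC n g z cg gC) (fun i => mE n (H i) (@cq i))
    (fun i z => EC n (H i) z (@cq i) (HC i)) a (space_step n) a0 (space_step_gt0 n).
  rewrite /= -/(time_step n) => sbp.
  rewrite /residual /mean_stencil -/level_mean sbp mulKf ?gt_eqF//; congr (_ + _); last first.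
    by apply: eq_bigr => i _; rewrite /S /space_quotient !mulN1r !mul1r scaleNr.
  have iE psi : lebZ.-integrable setT (EFin \o psi) ->
      lebZ.-integrable setT (EFin \o (fun z => psi z * level_mean n g z)).
    move=> ip; exact: (@integrable_mul_bounded _ _ _ lebZ setT _ _ C measurableT ip (mE n g cg)
      (fun z _ => EC n g z cg gC)).
  have iB : lebZ.-integrable setT (EFin \o (fun z => (time_step n)^-1 *
      (zero_ext phi z - zero_ext phi (z.1, z.2 - time_step n)))).
    apply: integrable_scaler => //; apply: integrable_subr => //.
      exact: (zero_ext_integrable hphi).
    have := shift_integrable (zero_ext_integrable hphi) 0 (- time_step n).
    by under eq_fun do rewrite addr0.
  have iI : lebZ.-integrable setT (EFin \o initial_term phi (time_step n)).
    have := integrable_subr measurableT iB (integrable_addr measurableT (Ti n) (Li n)).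
    apply: eq_integrable => // z _ /=; rewrite backward_difference//; congr EFin; ring.
  rewrite (_ : I0 = \int[lebZ]_z (initial_term phi (time_step n) z * level_mean n g z)); last first.
    rewrite (integral_initial_term t0 (e := fun x => pairing (sigma x) g))//; first exact: iE.
    move=> x t t1 t2; rewrite sigmaE//; apply: eq_Rintegral => w _.
    by rewrite scheme_solution_init.
  rewrite -RintegralD//; [|exact: iE|exact: iE].
  rewrite -RintegralD//; [|apply: integrable_addr => //; exact: iE|exact: iE].
  by apply: eq_Rintegral => z _; rewrite backward_difference// !mulrDl.
have halve (x : R) : 2^-1 * (x + x) = x by field.
pose LX k i := \int[lebZ]_z (zero_ext (fun z => phi_x z ord0 i) z * pairing (nu z) k).
pose LT := \int[lebZ]_z ((if 0 < z.2 then phi_t z else 0) * pairing (nu z) g).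
rewrite -/LT -/I0.
rewrite (_ : \sum_i _ =
  \sum_i ((2 * a)^-1 * (LX g i - LX g i) + 2^-1 * (LX (H i) i + LX (H i) i))); last first.
  by apply: eq_bigr => i _; rewrite subrr mulr0 add0r halve.
rewrite addrAC -[LT]addr0.
under eq_cvg => n do rewrite E.
apply: cvgD.
  apply: cvgD; last exact: cvg_cst.
  apply: cvgD; first exact: lim.
  have := lim g _ _ cg gC Li li Ll; rewrite /cst/=.
  rewrite [X in _ --> X](_ : _ = 0)//.
  by under eq_Rintegral do rewrite mul0r; rewrite Rintegral_cst// mul0r.
have limS k i : continuous k -> (forall y, - M <= y <= M -> `|k y| <= C) ->
    S k 1 i n @[n --> U] --> LX k i /\ S k (-1) i n @[n --> U] --> LX k i.
  move=> ck kC; have [i1 _ l1] := Sx i; have [i2 _ l2] := SNx i; rewrite /S /LX.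
  split; under eq_cvg do rewrite ?mulN1r ?mul1r.
    exact: (lim k _ _ ck kC i1 (xi i) l1).
  exact: (lim k _ _ ck kC i2 (xi i) l2).
apply: cvg_sumr => i; have [g1 g2] := limS g i cg gC; have [h1 h2] := limS (H i) i (@cq i) (HC i).
apply: cvgD; apply: cvgMr; [exact: (cvgB g1 g2)|exact: (cvgD h1 h2)].
Qed.

End scheme_limit.

(** * Existence of the solution *)

Section well_defined.
Context {R : realType} {d : nat}.
Local Notation lebZ := (lebesgue_rV d \x @lebesgue_measure R)%E.
Local Notation Z := ('rV[R]_d * measurableTypeR R)%type.
Local Notation prob := (probability (measurableTypeR R) R).
Variable M : R.
Hypothesis M0 : 0 <= M.

Lemma wd_pairing_concentrated (nu : 'rV[R]_d * R -> prob) g :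
  (forall z, nu z (~` `[- M, M]%classic) = 0%E) ->
  measurable_fun setT (fun z : Z => pairing (nu z) g) -> continuous g -> wd_pairing nu g.
Proof.
move=> nu0 mg cg; split=> [z _|K cK _]; first exact: (pairing_integrable (nu0 z)).
have [C _ gC] := continuous_itv_bounded (- M) M cg.
have mK : measurable (K : set Z).
  apply: closed_measurable_space_time; apply: compact_closed => //; exact: norm_hausdorff.
have [J _ KJ] := compact_box cK.
apply: (@integrable_bounded _ _ _ _ _ _ C) => //.
- apply: le_lt_trans (box_finite d J); apply: le_measure => //; rewrite inE//.
  exact: measurable_box.
- exact: measurable_funTS.
- by move=> z _; apply: (@pairing_bound R M M0 (nu z) g C (nu0 z) cg gC).
Qed.

Lemma compact_cube (K : set 'rV[R]_d) : compact K -> exists J, K `<=` cube J.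
Proof.
move=> /compact_bounded[J [_ KJ]]; exists (`|J| + 1) => x Kx j.
have : `|x| <= `|J| + 1 by apply: KJ => //; rewrite ltr_pwDr// ler_norm.
apply: le_trans; rewrite (_ : `|x| = mx_norm x)// mx_normrE.
exact: (le_bigmax _ (fun ij : 'I_1 * 'I_d => `|x ij.1 ij.2|) (ord0, j)).
Qed.

Lemma wd_pairing0_concentrated (sigma : 'rV[R]_d -> prob) g :
  (forall x, sigma x (~` `[- M, M]%classic) = 0%E) ->
  measurable_fun setT (fun x => pairing (sigma x) g) -> continuous g -> wd_pairing0 sigma g.
Proof.
move=> s0 mg cg; split=> [x|K cK]; first exact: (pairing_integrable (s0 x)).
have [C _ gC] := continuous_itv_bounded (- M) M cg.
have mK : measurable K.
  rewrite -(setCK K); apply: measurableC; apply: sub_sigma_algebra.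
  by apply: closed_openC; apply: compact_closed => //; exact: norm_hausdorff.
have [J KJ] := compact_cube cK.
apply: (@integrable_bounded _ _ _ _ _ _ C) => //.
- apply: le_lt_trans (cube_finite d J); apply: le_measure => //; rewrite inE//.
  exact: measurable_cube.
- exact: measurable_funTS.
- by move=> x _; apply: (@pairing_bound R M M0 (sigma x) g C (s0 x) cg gC).
Qed.

End well_defined.

Section space_time_measure.
Context {R : realType} {d : nat}.
Local Notation lebZ := (lebesgue_rV d \x @lebesgue_measure R)%E.
Local Notation Z := ('rV[R]_d * measurableTypeR R)%type.
Lemma space_time_sigma_finite : sigma_finite [set: Z] lebZ.
Proof.
exists (fun n => box n%:R) => [|n]; last by split; [exact: measurable_box|exact: box_finite].
apply/seteqP; split => // z _.
have [J J0 zJ] := compact_box (@compact_set1 _ (z : 'rV[R]_d * R)).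
exists (Num.truncn J).+1 => //; have [zc] := zJ z erefl; rewrite /= in_itv/= -ler_norml => zt.
have JJ : J <= (Num.truncn J).+1%:R by rewrite ltW// truncnS_gt.
split => [j|]; first exact: le_trans (zc j) JJ.
by rewrite /= in_itv/= -ler_norml (le_trans zt).
Qed.

(** Lebesgue measure on space-time, as a constant that carries its sigma-finite structure. *)
Definition space_time_measure : set Z -> \bar R := lebZ.
HB.instance Definition _ := Measure.on space_time_measure.
HB.instance Definition _ := Measure_isSigmaFinite.Build _ _ _ space_time_measure space_time_sigma_finite.
End space_time_measure.

Lemma primitive_lipschitz (R : realType) (F phi : R -> R) (a M : R) :
  continuous phi ->
  (forall v w, v <= w -> F w - F v = \int[@lebesgue_measure R]_(x in `[v, w]) phi x) ->
  (forall x, - M <= x <= M -> `|a * phi x| <= 1) ->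
  forall v w, - M <= w -> w <= v -> v <= M -> `|a * (F v - F w)| <= v - w.
Proof.
move=> cphi Fphi phi1 v w Mw wv vM.
have mI : measurable (`[w, v]%classic : set (measurableTypeR R)) by exact: measurable_itv.
have wvM x : `[w, v]%classic x -> - M <= x <= M.
  by rewrite /= in_itv/= => /andP[x1 x2]; rewrite (le_trans Mw x1) (le_trans x2 vM).
have maphi : measurable_fun (`[w, v]%classic : set (measurableTypeR R)) (fun x => a * phi x).
  apply: measurable_funTS; apply: measurable_funM => //; exact: continuous_measurable_fun.
have [C _ phiC] := continuous_itv_bounded w v cphi.
have phii : (@lebesgue_measure R).-integrable `[w, v] (EFin \o phi).
  by apply: itv_integrable phiC; exact: continuous_measurable_fun.
rewrite Fphi// -RintegralZl//.
have one_i : (@lebesgue_measure R).-integrable `[w, v] (EFin \o cst 1).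
  by apply: (@itv_integrable _ _ _ _ 1) => // x _; rewrite normr1.
have := Rintegral_mul_bounded mI one_i maphi (fun x xI => phi1 x (wvM x xI)).
rewrite mul1r /cst/= normr1 Rintegral_itv_cst// mul1r.
by under eq_Rintegral do rewrite mul1r.
Qed.

Theorem theorem3p1 (R : realType) (d : nat) (f : R -> 'rV[R]_d)
    (sigma : 'rV[R]_d -> probability (measurableTypeR R) R)
    (hf : C1_flux f)
    (hsigma : young_measure setT sigma)
    (hbound : uniformly_bounded setT sigma) :
  exists nu : 'rV[R]_d * R -> probability (measurableTypeR R) R,
    EMV_solution f sigma nu.
Proof.
have [M M0 sigma_null] : exists2 M : nat, (0 < M)%N &
    forall x, sigma x (~` `[- M%:R, M%:R]%classic) = 0%E.
  have [K /compact_bounded[J [_ KJ]] sK] := hbound.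
  exists (Num.truncn `|J|).+1 => // x; apply: msupport_null => y /(sK x I) Ky.
  rewrite /= in_itv/= -ler_norml; apply: KJ => //.
  by rewrite (le_lt_trans (ler_norm J))// truncnS_gt.
have [_ msigma0] := hsigma.
have M0' : 0 <= M%:R :> R by [].
pose phi i xi := derive1 f xi ord0 i.
pose F i xi := f xi ord0 i.
have cphi i : continuous (phi i) by case: (C1_flux_coord hf i).
have cF i : continuous (F i) by case: (C1_flux_coord hf i).
have Fphi i : forall v w, v <= w -> F i w - F i v = \int[@lebesgue_measure R]_(x in `[v, w]) phi i x.
  by case: (C1_flux_coord hf i).
have [a a0 phi1] := flux_slope_bound hf M%:R.
have F_lip i v w : - M%:R <= w -> w <= v -> v <= M%:R -> `|a * (F i v - F i w)| <= v - w.
  exact: (primitive_lipschitz (cphi i) (@Fphi i) (phi1 i)).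
pose P : probability (measurableTypeR R) R := uniform_prob (@ltr01 R).
pose tails (r : rat) (x : 'rV[R]_d) := fine (sigma x `]ratr r, +oo[%classic).
have mtails r : measurable_fun setT (tails r) by exact: (measurable_tail (ratr r) sigma_null msigma0).
pose u0 (p : 'rV[R]_d * measurableTypeR R) := quantile M (tails ^~ p.1) p.2.
have mu0 : measurable_fun setT u0 by exact: measurable_quantile.
have u0M p : - M%:R <= u0 p <= M%:R by exact: quantile_bound.
have sigmaE g x : continuous g -> pairing (sigma x) g = \int[P]_w g (u0 (x, w)).
  by move=> cg; exact: (pairing_quantile M0 (sigma_null x) cg).
have msigma g : continuous g -> measurable_fun setT (fun x => pairing (sigma x) g).
  move=> cg; have [C _ gC] := continuous_itv_bounded (- M%:R) M%:R cg.
  under eq_fun do rewrite sigmaE//.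
  apply: (@measurable_Rintegral_param _ _ _ _ _ P (g \o u0) C).
    by apply: measurableT_comp mu0; exact: continuous_measurable_fun.
  by move=> p; exact: gC.
(* All weak limits are taken along one ultrafilter U finer than that of n to infinity. *)
have [U [UU ooU]] := ultraFilterLemma (@eventually_filter).
have mX n := measurable_scheme_solution a (@space_step R n) (@time_step R d a n) cF mu0.
have XM n z w := scheme_solution_bound (@space_step R n) (@time_step R d a n) F_lip u0M z w.
have [nu [nu_null mnu nu_lim]] : exists nu : 'rV[R]_d * R -> probability (measurableTypeR R) R,
  [/\ forall z, nu z (~` `[- M%:R, M%:R]%classic) = 0%E,
    forall g, continuous g ->
      measurable_fun setT (fun z : 'rV[R]_d * measurableTypeR R => pairing (nu z) g) &
    forall g psi, continuous g ->
      (lebesgue_rV d \x @lebesgue_measure R)%E.-integrable setT (EFin \o psi) ->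
      \int[(lebesgue_rV d \x @lebesgue_measure R)%E]_z (psi z * level_mean P F a u0 n g z)
        @[n --> U] -->
      \int[(lebesgue_rV d \x @lebesgue_measure R)%E]_z (psi z * pairing (nu z) g)].
  exact: (young_limit (@space_time_measure R d) UU P M0 mX XM).
have PU : ProperFilter U := ultra_proper.
have lim := residual_limit cF a0 M0' F_lip mu0 u0M UU ooU nu_null mnu nu_lim sigmaE.
have wd (g : R -> R) (q : R -> 'rV[R]_d) : continuous g ->
    (forall i, continuous (fun xi => q xi ord0 i)) ->
    wd_weak_form nu sigma g q.
  move=> cg cq; split.
  - by apply: (wd_pairing_concentrated M0' nu_null) => //; exact: mnu.
  - by move=> i; apply: (wd_pairing_concentrated M0' nu_null) => //; exact: mnu.
  - by apply: (wd_pairing0_concentrated M0' sigma_null) => //; exact: msigma.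
exists nu; split.
- split; first by apply: measurableX => //; exact: measurable_itv.
  by move=> g [cg _ _]; apply: measurable_funTS; exact: mnu.
- have cid : continuous (@id R) by move=> x; exact: cvg_id.
  split => [|p p_t p_x hp]; first exact: wd.
  have := lim p p_t p_x hp id f cid cF.
  rewrite (_ : (fun n => _) = cst 0); first by move=> /cvg_lim <- //; rewrite lim_cst.
  apply/funext => n; rewrite (@eq_Rintegral _ _ _ _ _ (cst 0)).
    by rewrite Rintegral_cst// mul0r mulr0.
  move=> [x t] _; rewrite /zero_ext/=; case: ifPn => t0; last by rewrite mul0r.
  rewrite /residual /level_mean (mean_conservation P cF F_lip (time_step_gt0 a0 n) mu0 u0M cid cF t0).
    by rewrite subrr mulr0.
  by [].
- move=> eta q [cvx hq].
  have ceta : continuous eta by exact: convex_continuous.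
  have cq i : continuous (fun xi => q xi ord0 i).
    by apply: (entropy_flux_continuous cvx (cphi i)) => v w vw; exact: hq.
  split => [|p p_t p_x hp p0]; first exact: wd.
  have dis c i w v : `|c| <= a -> - M%:R <= w <= M%:R -> - M%:R <= v <= M%:R ->
      right_slope eta w * ((v - c * F i v) - (w - c * F i w)) <=
      (eta v - c * q v ord0 i) - (eta w - c * q w ord0 i).
    move=> ca; apply: (entropy_dissipation cvx (cphi i) (@Fphi i) (fun v w vw => hq v w i vw)).
    move=> x xM; apply: le_trans (phi1 i x xM); rewrite !normrM ler_wpM2r//.
    by rewrite (le_trans ca)// ler_norm.
  have L := lim p p_t p_x hp eta q ceta cq.
  rewrite -(cvg_lim (@norm_hausdorff _ R) L); apply: limr_ge; first exact: cvgP L.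
  apply: nearW => n; rewrite mulr_ge0 ?invr_ge0 ?(ltW (time_step_gt0 _ _))//.
  apply: Rintegral_ge0 => -[x t] _; rewrite /zero_ext/=; case: ifPn => t0; last by rewrite mul0r.
  rewrite mulr_ge0//; first by apply: p0; split => //=; rewrite in_itv/= t0.
  rewrite subr_ge0; apply: (mean_entropy P cF F_lip (time_step_gt0 a0 n) mu0 u0M ceta cq t0) => u uM.
  apply: (lax_friedrichs_entropy (space_step n) F_lip (s := right_slope eta) uM).
  - by move=> w v _ _; exact: right_slope_subgradient.
  - by move=> i w v; apply: dis; rewrite gtr0_norm.
  - move=> i w v wM vM; have := dis (- a) i w v _ wM vM.
    by rewrite normrN gtr0_norm// lexx !mulNr !opprK; apply.
Qed.
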